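(* For every cubic graph $G$, $\gamma_{b,2}(G)\le \frac{|V(G)|}{3}$.
   Context: All graphs are finite and simple (no loops, no multiple edges). A cubic graph is a graph in which every vertex has degree exactly $3$. A function $f:V(G)\to\{0,1,2\}$ is a $2$-limited dominating broadcast on $G$ if for every vertex $u\in V(G)$ there is a vertex $v\in V(G)$ with $f(v)>0$ and $d_G(u,v)\le f(v)$, where $d_G$ is the graph distance (infinite between different connected components; $v=u$ is allowed). The cost of $f$ is $\sum_{v\in V(G)}f(v)$, and $\gamma_{b,2}(G)$, the $2$-limited broadcast domination number, is the minimum cost of a $2$-limited dominating broadcast on $G$. *)

(* Defs.v *)
From mathcomp Require Import all_boot all_order all_algebra.

Set Implicit Arguments.
Unset Strict Implicit.
Unset Printing Implicit Defensive.

Record sgraph := SGraph {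
  vertex :> finType;
  edge : rel vertex;
  edge_sym : symmetric edge;
  edge_irrefl : irreflexive edge
}.

Definition degree (G : sgraph) (v : G) : nat := #|[set w | edge v w]|.

Definition cubic (G : sgraph) : Prop := forall v : G, degree v = 3.

Definition has_walk (G : sgraph) (u v : G) (n : nat) : bool :=
  [exists p : n.-tuple G, path (@edge G) u p && (last u p == v)].

Lemma connect_has_walk (G : sgraph) (u v : G) :
  connect (@edge G) u v -> exists n, has_walk u v n.
Proof.
case/connectP=> p pP ->; exists (size p); apply/existsP.
by exists (in_tuple p); rewrite pP eqxx.
Qed.

(* [None] is the infinite distance between different components. *)
Definition dist (G : sgraph) (u v : G) : option nat :=
  match boolP (connect (@edge G) u v) with
  | AltTrue uv => Some (ex_minn (connect_has_walk uv))
  | AltFalse _ => None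
  end.

Definition dist_le (d : option nat) (k : nat) : bool :=
  if d is Some n then n <= k else false.

Lemma dist_refl (G : sgraph) (u : G) : dist u u = Some 0.
Proof.
rewrite /dist; case: {-}_ / boolP => [uu|]; last by rewrite connect0.
case: ex_minnP => m _ /(_ 0) m_min; congr Some; apply/eqP.
by rewrite -leqn0 m_min //; apply/existsP; exists [tuple]; rewrite /= eqxx.
Qed.

Definition broadcast (G : sgraph) : Type := {ffun G -> 'I_3}.

Definition dominating (G : sgraph) (f : broadcast G) : bool :=
  [forall u : G, exists v : G, (0 < f v) && dist_le (dist u v) (f v)].

Definition cost (G : sgraph) (f : broadcast G) : nat := \sum_(v : G) f v.

Definition ones (G : sgraph) : broadcast G := [ffun=> inord 1].

Lemma ones_dominating (G : sgraph) : dominating (ones G).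
Proof.
apply/forallP=> u; apply/existsP; exists u.
by rewrite ffunE inordK // dist_refl.
Qed.

(* [ones G] only serves as the witness that [arg min] requires; by
   [ones_dominating] it is never an out-of-range default. *)
Definition gamma_b2 (G : sgraph) : nat :=
  cost [arg min_(f < ones G | dominating f) cost f].

Lemma gamma_b2P (G : sgraph) :
  (exists2 f : broadcast G, dominating f & cost f = gamma_b2 G) /\
  (forall f : broadcast G, dominating f -> gamma_b2 G <= cost f).
Proof.
rewrite /gamma_b2; case: arg_minnP; first exact: ones_dominating.
by move=> f f_dom f_min; split=> //; exists f.
Qed.

(* Main.v *)
Require Import Defs.
From mathcomp Require Import all_boot all_order all_algebra.
From mathcomp Require Import zify.

Set Implicit Arguments.
Unset Strict Implicit.
Unset Printing Implicit Defensive.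

(** For a subset [S] of the vertices of a graph of maximum degree 3, let [phi S]
    be [6n - 2m] for the induced graph on [S], plus 3 for each isolated vertex
    and 2 for each component that is a 4-cycle or a [K4] with one subdivided
    edge.  The claim is that [S] can be covered at cost [k] with
    [9 k <= phi S]; for a cubic graph [phi] is [3 |V|].  By induction it is
    enough to find, for every nonempty [S], a few balls of total cost [k] whose
    union can be deleted from [S] while [phi] drops by at least [9 k].
    Deleting [C] lowers [6n - 2m] by [6 |C|] minus twice the number of edges
    that meet [C], so only the small components that the deletion creates can
    spoil it.  For a vertex [u] of degree 3 outside all triangles the ball of
    radius 2 gains at least 18; if it fails, some new isolated vertex or
    4-cycle is attached to it only, which is strong local information.

    The resulting case analysis is finite: first vertices of degree 1, then
    induced 4-cycles by the number of their vertices of degree 2, and finally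
    graphs without induced 4-cycles.  It is carried out by a verified checker
    on partially known graphs, which branches either on all neighbours of a
    vertex or on the reason why a deletion fails. *)

(** The induction cannot stay among cubic graphs, because a deletion leaves vertices of lower degree
    behind. The weight [6 - deg] pays for them, and the factor 9 turns the value 3 of a vertex of
    degree 3 into one third. The balls are taken in the whole graph and only [phi] looks at what is
    left, so the covers of successive steps simply add up.

    The obstacle is that a deletion may create components that receive a bonus, so its gain is not
    determined by the known part of the graph. The analysis stays finite because such a component
    has lost neighbours only to the deleted set: a new isolated vertex had all its neighbours there,
    and a vertex of a new 4-cycle has at most one there. A failure thus adds few vertices in a known
    shape, and then another deletion is tried. The subdivided [K4] causes no branching, since a set
    in which it occurs, even as a subgraph, is reducible at once.

    The certificates need no trust: they only choose the next step, and [check] recomputes all its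
    branches. Each stage may use what the earlier stages excluded, and this prunes most branches. *)

(** * Partial graphs and the checker *)

(* Unlike [andb] and [orb], these do not evaluate [y] eagerly in [vm_compute]. *)
Notation "x &&& y" := (if x then y else false)
  (at level 40, left associativity, only parsing).
Notation "x ||| y" := (if x then true else y)
  (at level 50, left associativity, only parsing).

Fixpoint hasb (A : Type) (p : A -> bool) (s : seq A) : bool :=
  if s is x :: s' then p x ||| hasb p s' else false.
Fixpoint allb (A : Type) (p : A -> bool) (s : seq A) : bool :=
  if s is x :: s' then p x &&& allb p s' else true.
Fixpoint memn (i : nat) (s : seq nat) : bool :=
  if s is j :: s' then eqn i j ||| memn i s' else false.

(* In a partial graph, vertex [i] comes with its known neighbours and a flag
   which tells that these are all its neighbours; as degrees are at most 3, the
   flag is redundant for a vertex with three known neighbours. *)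
Definition pgraph : Type := seq (seq nat * bool).

Definition vtx (P : pgraph) (i : nat) : seq nat * bool := nth ([::], false) P i.
Definition adj (P : pgraph) (i : nat) : seq nat := (vtx P i).1.
Definition full (p : seq nat * bool) : bool :=
  p.2 ||| (if p.1 is [:: _; _; _] then true else false).
Definition closed_at (P : pgraph) (i : nat) : bool := full (vtx P i).
Definition maxdeg (P : pgraph) (i : nat) : nat :=
  let: (a, x) := vtx P i in if x then size a else 3.

(** A single pass in which [i] is the index of the head of [P]. New vertices go to the end, so the
    existing names survive every expansion. *)
Fixpoint link (v : nat) (A new : seq nat) (i : nat) (P : pgraph) : pgraph :=
  if P is p :: P' then
    (if eqn i v then (p.1 ++ A ++ new, true)
     else if memn i A then (v :: p.1, p.2) else p) :: link v A new i.+1 P'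
  else [seq ([:: v], false) | _ <- new].

(* All further neighbours of [v] are the known vertices [A] and [m] new ones. *)
Definition expand (P : pgraph) (v : nat) (A : seq nat) (m : nat) : pgraph :=
  link v A (iota (size P) m) 0 P.

(** Names a vertex about which nothing is known, not even an edge to the known part: an undiscovered
    isolated vertex or corner of a 4-cycle. *)
Definition fresh (P : pgraph) : pgraph := rcons P ([::], false).

Definition cands (P : pgraph) (v : nat) : seq nat :=
  let a := adj P v in
  [seq i <- iota 0 (size P) | ~~ eqn i v &&& ~~ closed_at P i &&& ~~ memn i a].

(** The sublists of length at most [r], where [r] will be the degree still free at a vertex. *)
Fixpoint subs (r : nat) (s : seq nat) : seq (seq nat) :=
  if s is x :: s' then
    if r is r'.+1 then subs r s' ++ [seq x :: A | A <- subs r' s'] else [:: [::]]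
  else [:: [::]].

(** A missing entry proves that there is no edge only if one of the two ends has all its neighbours
    listed. *)
Definition chord_free (P : pgraph) (i j : nat) : bool :=
  (closed_at P i ||| closed_at P j) &&& ~~ memn j (adj P i).

Definition low_c4 (P : pgraph) (t : nat) (v : nat) : bool :=
  let a := adj P v in
  hasb (fun b => hasb (fun d => ~~ eqn b d &&& chord_free P b d &&&
    hasb (fun c => ~~ eqn c v &&& memn c (adj P d) &&& chord_free P v c &&&
      (maxdeg P v + maxdeg P b + maxdeg P c + maxdeg P d < t)) (adj P b)) a) a.

(** Here [s] subdivides the edge from [a] to [b] of the [K4] on [a], [b], [c], [d]. *)
Definition has_d5 (P : pgraph) : bool :=
  let V := iota 0 (size P) in
  hasb (fun s => hasb (fun a => hasb (fun b => hasb (fun c => hasb (fun d =>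
    uniq [:: s; a; b; c; d] &&& memn b (adj P s) &&& memn c (adj P b) &&&
    memn d (adj P b) &&& memn d (adj P c))
    (adj P a)) (adj P a)) (adj P s)) (adj P s)) V.

(* [mind] bounds all degrees from below, and [t] the degree sum along every
   induced 4-cycle; see [facts]. *)
Definition contradicts (mind t : nat) (P : pgraph) (v : nat) : bool :=
  (closed_at P v &&& (size (adj P v) < mind)) ||| low_c4 P t v |||
  (allb full P &&& has_d5 P).

Definition expansions (mind t : nat) (P : pgraph) (v : nat) : seq pgraph :=
  let r := 3 - size (adj P v) in
  [seq Q <- flatten [seq [seq expand P v A m | m <- iota 0 (r - size A).+1]
                    | A <- subs r (cands P v)] | ~~ contradicts mind t Q v].

(** * Deletions and the branches on their failure *)

(* [(c, true)] is the ball of radius 2 around [c], [(c, false)] that of radius 1. *)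
Definition balls : Type := seq (nat * bool).

Definition reach (P : pgraph) (X : balls) : seq nat :=
  flatten [seq x.1 :: adj P x.1 ++
      (if x.2 then flatten [seq adj P j | j <- adj P x.1] else [::]) | x <- X].

Definition cover (P : pgraph) (X : balls) : seq bool :=
  let Y := reach P X in [seq memn i Y | i <- iota 0 (size P)].

Definition price (X : balls) : nat := sumn [seq if x.2 then 2 else 1 | x <- X].

Definition outs (P : pgraph) (C : seq bool) (v : nat) : seq nat :=
  [seq i <- adj P v | ~~ nth false C i].

Definition is_pair (s : seq nat) (i j : nat) : bool :=
  if s is [:: k; l] then (eqn k i &&& eqn l j) ||| (eqn k j &&& eqn l i) else false.

Definition c4_known (P : pgraph) (C : seq bool) (a b c d : nat) : bool :=
  allb (fun i => ~~ nth false C i &&& closed_at P i) [:: a; b; c; d] &&&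
  is_pair (outs P C a) b d &&& is_pair (outs P C b) a c &&&
  is_pair (outs P C c) b d &&& is_pair (outs P C d) a c.

Definition in_c4 (P : pgraph) (C : seq bool) (p : nat -> nat -> nat -> nat -> bool)
    (a : nat) : bool :=
  let o := outs P C a in
  hasb (fun b => hasb (fun d => hasb (fun c =>
    c4_known P C a b c d &&& p a b c d) (outs P C b)) o) o.

Definition iso_known (P : pgraph) (C : seq bool) (t : nat) : bool :=
  ~~ nth false C t &&& closed_at P t &&& nilp (outs P C t).

(* [loss c] bounds the degree of [c] plus its number of neighbours outside [C]. *)
Definition profitable (P : pgraph) (X : balls) (C : seq bool) : bool :=
  let V := iota 0 (size P) in
  let Cs := [seq i <- V | nth false C i] in
  let loss c := maxdeg P c + (maxdeg P c - size (adj P c)) + size (outs P C c) in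
  (0 < price X) &&& (9 * price X + sumn [seq loss c | c <- Cs]
  + 3 * count (iso_known P C) V
  + 2 * count (in_c4 P C (fun a b c d => (a <= b) &&& (a <= c) &&& (a <= d))) V
  <= 6 * size Cs).

(** If [v] becomes isolated, all its neighbours are marked by [C], so no new vertex has to be named.
    It must have at least one, since otherwise it was isolated before the deletion. *)
Definition iso_at (mind t : nat) (C : seq bool) (P : pgraph) (v : nat) : seq pgraph :=
  [seq Q <- [seq expand P v A 0
    | A <- subs (3 - size (adj P v)) [seq i <- cands P v | nth false C i]]
    | (0 < size (adj Q v)) &&& ~~ contradicts mind t Q v].

(** A new isolated vertex that is named and closed is charged in [profitable]. It remains to try the
    open vertices without a known neighbour outside [C], and a vertex without a name. *)
Definition iso_branches (mind t : nat) (P : pgraph) (C : seq bool) : seq pgraph :=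
  flatten [seq iso_at mind t C P v | v <- iota 0 (size P)
     & ~~ nth false C v &&& ~~ closed_at P v &&& nilp (outs P C v)]
  ++ iso_at mind t C (fresh P) (size P).

(** Closes [v] as a corner of a 4-cycle component outside [C]: it gets exactly two neighbours there,
    among them those in [F]. The further neighbours outside [C] are [A] and the [m] new vertices,
    and [B] consists of those in [C]. *)
Definition ring_expansions (P : pgraph) (C : seq bool) (v : nat) (F : seq nat)
    : seq pgraph :=
  let a := adj P v in
  if closed_at P v then
    if eqn (size (outs P C v)) 2 &&& allb (fun i => memn i a) F then [:: P] else [::]
  else
  let f := [seq i <- F | ~~ memn i a] in
  let cd := cands P v in
  let o := size (outs P C v) + size f in
  if allb (fun i => memn i cd) f &&& (o <= 2) then
    flatten [seq let m := 2 - o - size A in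
        if size a + size f + size A + m <= 3 then
          [seq expand P v (f ++ A ++ B) m
             | B <- subs (3 - (size a + size f + size A + m)) [seq i <- cd | nth false C i]]
        else [::]
      | A <- subs (2 - o) [seq i <- cd | ~~ nth false C i &&& ~~ memn i f]]
  else [::].

(* The unique neighbour in [C] of a vertex [v] of a 4-cycle component outside
   [C], or [size C] if there is none. *)
Definition anchor (P : pgraph) (C : seq bool) (v : nat) : nat :=
  let a := adj P v in
  find (fun i => nth false C i &&& memn i a) (iota 0 (size C)).

(* By the symmetry of the 4-cycle [s, b, c, d] we may assume that [s] has the
   smallest anchor and that the anchor of [b] is at most that of [d]. *)
Definition ring_branches (mind t : nat) (P : pgraph) (C : seq bool) (s b d : nat)
    : seq pgraph :=
  flatten [seq if anchor Q C b < anchor P C s then [::] else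
      if [seq i <- outs Q C b | ~~ eqn i s] is [:: c] then
        if eqn c d then [::] else
        flatten [seq if anchor R C d < anchor Q C b then [::] else
            [seq W <- ring_expansions R C c [:: b; d]
               | (anchor P C s <= anchor W C c) &&& ~~ contradicts mind t W s]
          | R <- ring_expansions Q C d [:: s; c]]
      else [::]
    | Q <- ring_expansions P C b [:: s]].

(* For [12 < t] there are no induced 4-cycles, as degrees are at most 3. *)
Definition c4_branches (mind t : nat) (P : pgraph) (C : seq bool) : seq pgraph :=
  if 12 < t then [::] else
  flatten [seq
    flatten [seq
      if anchor Q C s < size C then
        if outs Q C s is [:: b; d] then
          if memn d (adj Q b) then [::] else
          ring_branches mind t Q C s b d ++ ring_branches mind t Q C s d b
        else [::]
      else [::]
    | Q <- ring_expansions (if s < size P then P else fresh P) C s [::]]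
  | s <- iota 0 (size P).+1
  & eqn s (size P) ||| ~~ nth false C s &&& ~~ in_c4 P C (fun _ _ _ _ => true) s].

Definition closes (mind t : nat) (P : pgraph) (X : balls) : bool :=
  let C := cover P X in
  profitable P X C &&& nilp (iso_branches mind t P C) &&& nilp (c4_branches mind t P C).

(** * Proof trees *)

Inductive rule : Type := Delete of balls | Expand of nat.

(* The nodes of a proof tree in prefix order; the deletions listed with a node close
   all those children that have no entry of their own. *)
Definition cert : Type := seq (rule * seq balls).

Definition branches (mind t : nat) (P : pgraph) (r : rule) : option (seq pgraph) :=
  match r with
  | Delete X => let C := cover P X in
      if profitable P X C then Some (iso_branches mind t P C ++ c4_branches mind t P C)
      else None
  | Expand v => if v < size P then Some (expansions mind t P v) else None
  end.

(** The fuel [n] bounds the depth. Each subtree returns the entries that it did not consume, which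
    are then read by the next sibling. *)
Fixpoint check (mind t : nat) (n : nat) (w : cert) (P : pgraph) : option cert :=
  if n is n'.+1 then
    if w is (r, H) :: w' then
      if branches mind t P r is Some s then
        foldl (fun o Q => if o is Some w1 then
            if hasb (closes mind t Q) H then Some w1 else check mind t n' w1 Q
          else None) (Some w') s
      else None
    else None
  else None.

(** * The potential *)

Section Potential.

Variables (T : finType) (e : rel T).
Hypothesis e_sym : symmetric e.
Hypothesis e_irr : irreflexive e.
Hypothesis e_deg : forall v, #|[set w | e v w]| <= 3.

Definition nb (S : {set T}) (v : T) : {set T} := [set w in S | e v w].
Definition deg (S : {set T}) (v : T) : nat := #|nb S v|.

Lemma deg_le3 S v : deg S v <= 3.
Proof.
apply: leq_trans (e_deg v); apply: subset_leq_card.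
by apply/subsetP=> w; rewrite !inE => /andP[].
Qed.

Definition isolated (S : {set T}) : {set T} := [set v in S | nb S v == set0].

Definition c4_at (S : {set T}) (a b c d : T) : bool :=
  [&& uniq [:: a; b; c; d], all (mem S) [:: a; b; c; d],
      nb S a == [set b; d], nb S b == [set a; c], nb S c == [set b; d]
    & nb S d == [set a; c]].

Definition d5_at (S : {set T}) (s a b c d : T) : bool :=
  [&& uniq [:: s; a; b; c; d], all (mem S) [:: s; a; b; c; d],
      nb S s == [set a; b], nb S a == [set s; c; d], nb S b == [set s; c; d],
      nb S c == [set a; b; d] & nb S d == [set a; b; c]].

Definition is_c4 (S Q : {set T}) : bool :=
  [exists a, exists b, exists c, exists d,
    c4_at S a b c d && (Q == [set a; b; c; d])].

Definition is_d5 (S Q : {set T}) : bool :=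
  [exists s, exists a, exists b, exists c, exists d,
    d5_at S s a b c d && (Q == [set s; a; b; c; d])].

(** Vertex sets instead of labellings, so that a component counts once however its vertices are
    named. *)
Definition bad (S : {set T}) : {set {set T}} := [set Q | is_c4 S Q || is_d5 S Q].

Lemma is_c4P S Q :
  reflect (exists a b c d, c4_at S a b c d /\ Q = [set a; b; c; d]) (is_c4 S Q).
Proof.
apply: (iffP existsP) => [[a /existsP[b /existsP[c /existsP[d /andP[h /eqP->]]]]]|].
  by exists a, b, c, d.
move=> [a [b [c [d [h ->]]]]]; exists a; apply/existsP; exists b.
by apply/existsP; exists c; apply/existsP; exists d; rewrite h eqxx.
Qed.

Lemma is_d5P S Q :
  reflect (exists s a b c d, d5_at S s a b c d /\ Q = [set s; a; b; c; d])
    (is_d5 S Q).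
Proof.
apply: (iffP existsP) => [[s /existsP[a /existsP[b /existsP[c /existsP[d]]]]]|].
  by move=> /andP[h /eqP->]; exists s, a, b, c, d.
move=> [s [a [b [c [d [h ->]]]]]]; exists s; apply/existsP; exists a.
apply/existsP; exists b; apply/existsP; exists c.
by apply/existsP; exists d; rewrite h eqxx.
Qed.

(* A vertex of degree 0, 1, 2, 3 contributes 9, 5, 4, 3.  The two components in
   [bad] contribute 16 to the sum but cost 2, that is, 18. *)
Definition phi (S : {set T}) : nat :=
  \sum_(v in S) (6 - deg S v) + 3 * #|isolated S| + 2 * #|bad S|.

Lemma degD (S C : {set T}) v : C \subset S -> deg S v = deg C v + deg (S :\: C) v.
Proof.
move=> CS; rewrite /deg -(cardsID C (nb S v)); congr (_ + _).
  apply: eq_card => w; rewrite !inE; case: (boolP (w \in C)) => wC; rewrite ?andbF //.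
  by rewrite (subsetP CS _ wC) andbT.
by apply: eq_card => w; rewrite !inE andbA.
Qed.

Lemma degE S v : deg S v = \sum_(w in S) e v w.
Proof.
rewrite /deg -sum1_card big_mkcond [RHS]big_mkcond; apply: eq_bigr => w _.
by rewrite inE; case: (w \in S); case: (e v w).
Qed.

Lemma sum_deg (A B : {set T}) : \sum_(v in A) deg B v = \sum_(w in B) deg A w.
Proof.
rewrite (eq_bigr _ (fun v _ => degE B v)) exchange_big /=.
by apply: eq_bigr => w _; rewrite degE; apply: eq_bigr => v _; rewrite e_sym.
Qed.

(* Deleting [C] lowers [\sum (6 - deg)] by [6 |C|] minus twice the number of
   edges incident with [C]. *)
Lemma phi_setD (S C : {set T}) : C \subset S ->
  phi (S :\: C) + 6 * #|C| <=
  phi S + \sum_(v in C) (deg S v + deg (S :\: C) v)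
  + 3 * #|isolated (S :\: C) :\: isolated S| + 2 * #|bad (S :\: C) :\: bad S|.
Proof.
move=> CS; set D := S :\: C.
(* Exceptional components that disappear only lower [phi], so only the new ones have to be
   counted. *)
have cardD (U : finType) (A B : {set U}) : #|A| <= #|B| + #|A :\: B|.
  rewrite -(cardsID B A) leq_add2r; apply: subset_leq_card.
  by apply/subsetP=> x; rewrite inE => /andP[].
have := cardD _ (isolated D) (isolated S); have := cardD _ (bad D) (bad S).
suff : \sum_(v in D) (6 - deg D v) + 6 * #|C| =
    \sum_(v in S) (6 - deg S v) + \sum_(v in C) (deg S v + deg D v).
  by rewrite /phi; lia.
have -> : \sum_(v in S) (6 - deg S v) =
    \sum_(v in C) (6 - deg S v) + \sum_(v in D) (6 - deg S v).
  by rewrite (big_setID C) /= (setIidPr CS).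
rewrite big_split /= (sum_deg C D).
have -> : \sum_(v in D) (6 - deg D v) =
    \sum_(v in D) (6 - deg S v) + \sum_(v in D) deg C v.
  rewrite -big_split; apply: eq_bigr => v _.
  by have := degD v CS; have := deg_le3 S v; rewrite -/D /=; lia.
suff : 6 * #|C| = \sum_(v in C) (6 - deg S v) + \sum_(v in C) deg S v by lia.
rewrite -big_split /= mulnC -sum_nat_const; apply: eq_bigr => v _.
by have := deg_le3 S v; lia.
Qed.

(** * Covering by balls *)

Definition near (r : nat) (u v : T) : bool :=
  match r with
  | 0 => false
  | 1 => (u == v) || e u v
  | _ => [|| u == v, e u v | [exists w, e u w && e w v]]
  end.

Lemma near_le r r' u v : r <= r' -> near r u v -> near r' u v.
Proof.
case: r r' => [|[|r]] [|[|r']] //= _; first by case/orP=> ->; rewrite ?orbT.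
Qed.

Definition covered (A : {set T}) (k : nat) : Prop :=
  exists f : {ffun T -> 'I_3},
    (forall u, u \in A -> exists v, near (f v) u v) /\ \sum_v f v <= k.

Lemma covered0 : covered set0 0.
Proof.
exists [ffun=> ord0]; split=> [u|]; first by rewrite inE.
by rewrite big1 // => v _; rewrite ffunE.
Qed.

(** Adding the two broadcasts and truncating at 2 keeps every ball, because both values are at most
    2 already. *)
Lemma coveredU (A B : {set T}) k l : covered A k -> covered B l -> covered (A :|: B) (k + l).
Proof.
move=> [f [fA fk]] [g [gB gl]].
have minP v : minn 2 (f v + g v) < 3 by rewrite ltnS geq_minl.
exists [ffun v => Ordinal (minP v)]; split.
  move=> u; rewrite inE => /orP[/fA|/gB] [v uv]; exists v; rewrite ffunE /=;
    apply: near_le uv; have := ltn_ord (f v); have := ltn_ord (g v); lia.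
apply: leq_trans (leq_add fk gl); rewrite -big_split /=.
by apply: leq_sum => v _; rewrite ffunE /= geq_minr.
Qed.

Lemma covered_sub (A B : {set T}) k l : A \subset B -> k <= l -> covered B k -> covered A l.
Proof.
move=> AB kl [f [fB fk]]; exists f; split; last exact: leq_trans kl.
by move=> u uA; apply: fB; apply: (subsetP AB).
Qed.

Lemma covered_ball r v : 0 < r <= 2 -> covered [set u | near r u v] r.
Proof.
move=> /andP[r0 r2]; have r3 : r < 3 by [].
exists [ffun w => if w == v then Ordinal r3 else ord0]; split.
  by move=> u; rewrite inE => uv; exists v; rewrite ffunE eqxx.
rewrite (bigD1 v) //= ffunE eqxx big1 ?addn0 // => w /negbTE wv.
by rewrite ffunE wv.
Qed.

Definition reducible (S : {set T}) : Prop :=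
  exists C k, [/\ C != set0, C \subset S, covered C k
    & phi (S :\: C) + 9 * k <= phi S].

Lemma reducible_covered :
  (forall S : {set T}, S != set0 -> reducible S) ->
  forall S : {set T}, exists2 k, covered S k & 9 * k <= phi S.
Proof.
move=> redP S; have [n] := ubnP #|S|; elim: n S => // n IHn S Sn.
have [->|S0] := eqVneq S set0; first by exists 0; first exact: covered0.
have [C [k [C0 CS Ck Sk]]] := redP S S0.
have [|l Dl Sl] := IHn (S :\: C).
  rewrite ltnS in Sn; apply: leq_trans Sn.
  by rewrite cardsD (setIidPr CS) ltn_subrL !card_gt0 C0 S0.
exists (k + l); last by lia.
by rewrite -(setID S C) (setIidPr CS); apply: coveredU.
Qed.

(** * Soundness of the checker *)

Lemma memnE i s : memn i s = (i \in s).
Proof. by elim: s => //= j s ->; rewrite in_cons; case: eqnP => [->|/eqP/negbTE->]; rewrite ?eqxx. Qed.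

Lemma hasbE (A : Type) (p : A -> bool) s : hasb p s = has p s.
Proof. by elim: s => //= x s ->. Qed.

Lemma allbE (A : Type) (p : A -> bool) s : allb p s = all p s.
Proof. by elim: s => //= x s ->. Qed.

(** Completeness of the enumeration: the true set of further neighbours is a [filter] of the
    candidates, so it is among the lists that the checker tries. *)
Lemma subs_filter (p : pred nat) r s :
  size (filter p s) <= r -> filter p s \in subs r s.
Proof.
elim: s r => [|x s IHs] r //=; case: (p x) => /= sr.
  by case: r sr => // r sr; rewrite mem_cat map_f ?orbT // IHs.
case: r sr => [|r] sr; last by rewrite mem_cat IHs.
by move: sr; rewrite leqn0 size_eq0 => /eqP->.
Qed.

Lemma size_expand P v A m : size (expand P v A m) = size P + m.
Proof.
rewrite /expand -{2}(size_iota (size P) m); move: (iota _ _) => new.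
by elim: P 0 => [|p P IHP] k /=; rewrite ?size_map // IHP.
Qed.

Lemma vtx_expand P v A m i : vtx (expand P v A m) i =
  if i < size P then
    if i == v then (adj P v ++ A ++ iota (size P) m, true)
    else if i \in A then (v :: adj P i, (vtx P i).2) else vtx P i
  else if i < size P + m then ([:: v], false) else ([::], false).
Proof.
rewrite /expand -{3}(size_iota (size P) m); move: (iota _ _) => new.
suff E k : vtx (link v A new k P) i =
    if i < size P then
      if k + i == v then (adj P i ++ A ++ new, true)
      else if k + i \in A then (v :: adj P i, (vtx P i).2) else vtx P i
    else if i < size P + size new then ([:: v], false) else ([::], false).
  by rewrite E add0n; case: ifP => // _; case: eqP => [->|].
elim: P k i => [|p P IHP] k i /=.
  rewrite /vtx; case: ltnP => si; last by rewrite nth_default ?size_map.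
  by rewrite (nth_map 0).
case: i => [|i] /=.
  by rewrite addn0 memnE; case: eqnP => [->|/eqP/negbTE->]; rewrite ?eqxx.
by rewrite [LHS](IHP k.+1 i) addSnnS.
Qed.

(** * Partial graphs as descriptions of an induced subgraph *)

(* [P] describes a part of the graph induced on [S], vertex [i] being [f i]. *)
Record desc (S : {set T}) (P : pgraph) (f : nat -> T) : Prop := Desc {
  desc_in : forall i, i < size P -> f i \in S;
  desc_inj : forall i j, i < size P -> j < size P -> f i = f j -> i = j;
  desc_lt : forall i j, j \in adj P i -> j < size P;
  desc_sym : forall i j, j \in adj P i -> i \in adj P j;
  desc_edge : forall i j, j \in adj P i -> e (f i) (f j);
  desc_uniq : forall i, uniq (adj P i);
  desc_full : forall i w, (vtx P i).2 -> w \in S -> e (f i) w ->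
    exists2 j, j \in adj P i & w = f j }.

Section Description.

Variables (S : {set T}) (P : pgraph) (f : nat -> T).
Hypothesis D : desc S P f.

Lemma desc_ltl i j : j \in adj P i -> i < size P.
Proof. by move/(desc_sym D)/(desc_lt D). Qed.

Lemma desc_map_uniq i : uniq [seq f j | j <- adj P i].
Proof.
rewrite map_inj_in_uniq ?(desc_uniq D) // => j k jA kA.
by apply: (desc_inj D); apply: (desc_lt D); eassumption.
Qed.

Lemma desc_sub_nb i : i < size P -> {subset [seq f j | j <- adj P i] <= nb S (f i)}.
Proof.
move=> iP w /mapP[j jA ->]; rewrite inE (desc_edge D jA) andbT.
exact: (desc_in D (desc_lt D jA)).
Qed.

Lemma size_adj_deg i : i < size P -> size (adj P i) <= deg S (f i).
Proof.
move=> iP; rewrite -(size_map f) -(card_uniqP (desc_map_uniq i)).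
by apply: subset_leq_card; apply/subsetP; apply: desc_sub_nb.
Qed.

Lemma desc_closed i w : closed_at P i -> w \in S -> e (f i) w ->
  exists2 j, j \in adj P i & w = f j.
Proof.
rewrite /closed_at /full; case: ifP => [i2 _|_]; first exact: (desc_full D i2).
rewrite -/(adj P i) => i3 wS ew.
have s3 : size (adj P i) = 3 by case: (adj P i) i3 => [|? [|? [|? []]]].
have iP : i < size P.
  by case: (adj P i) (@desc_ltl i) s3 => // j s /(_ j); rewrite mem_head => ->.
have sub : [seq f j | j <- adj P i] \subset nb S (f i).
  by apply/subsetP; apply: desc_sub_nb.
have := (subset_leqif_card sub).2.
rewrite eqn_leq (subset_leq_card sub) (card_uniqP (desc_map_uniq i)) size_map s3.
rewrite (deg_le3 S (f i)) => /esym/subsetP/(_ w); rewrite inE wS ew.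
by case/(_ isT)/mapP=> j jA ->; exists j.
Qed.

Lemma closed_lt i : closed_at P i -> i < size P.
Proof.
by rewrite /closed_at /vtx; case: ltnP => // iP; rewrite nth_default.
Qed.

Lemma deg_closed i : closed_at P i -> deg S (f i) = size (adj P i).
Proof.
move=> ci; apply/eqP; rewrite eqn_leq size_adj_deg ?closed_lt // andbT.
rewrite -(size_map f) -(card_uniqP (desc_map_uniq i)).
apply: subset_leq_card; apply/subsetP=> w; rewrite inE => /andP[wS ew].
by have [j jA ->] := desc_closed ci wS ew; apply: map_f.
Qed.

Lemma deg_le_maxdeg i : deg S (f i) <= maxdeg P i.
Proof.
rewrite /maxdeg; case E : (vtx P i) => [a []]; last exact: deg_le3.
have ci : closed_at P i by rewrite /closed_at /full E.
by rewrite deg_closed // /adj E.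
Qed.

Lemma size_adj_maxdeg i : i < size P -> size (adj P i) <= maxdeg P i.
Proof. by move=> iP; apply: leq_trans (size_adj_deg iP) (deg_le_maxdeg i). Qed.

Lemma edge_closed i j : closed_at P i || closed_at P j ->
  i < size P -> j < size P -> e (f i) (f j) = (j \in adj P i).
Proof.
move=> cij iP jP; apply/idP/idP=> [eij|]; last exact: (desc_edge D).
case/orP: cij => [ci|cj].
  have [k kA fk] := desc_closed ci (desc_in D jP) eij.
  by rewrite (desc_inj D jP _ fk) // (desc_lt D kA).
rewrite e_sym in eij; have [k kA fk] := desc_closed cj (desc_in D iP) eij.
by apply: (desc_sym D); rewrite (desc_inj D iP _ fk) // (desc_lt D kA).
Qed.

End Description.

(** * Expanding a vertex *)

Lemma andifE a b : (if a then b else false) = a && b.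
Proof. by case: a. Qed.

Lemma orifE a b : (if a then true else b) = a || b.
Proof. by case: a. Qed.

(** The indices from [n] on name the elements of [B]; the default [f 0] is reached only beyond
    [n + size B]. *)
Definition extend (n : nat) (f : nat -> T) (B : seq T) (i : nat) : T :=
  if i < n then f i else nth (f 0) B (i - n).

Lemma desc_expand S P f v A B : desc S P f -> v < size P -> uniq A ->
  (forall i, i \in A -> [/\ i < size P, i \notin adj P v & e (f v) (f i)]) ->
  uniq B ->
  (forall w, w \in B ->
     [/\ w \in S, e (f v) w & forall i, i < size P -> f i != w]) ->
  (forall w, w \in S -> e (f v) w ->
     (exists2 j, j \in adj P v ++ A & w = f j) \/ w \in B) ->
  desc S (expand P v A (size B)) (extend (size P) f B).
Proof.
move=> D vP uA AP uB BP allP; set n := size P; set g := extend n f B.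
have gE i : i < n -> g i = f i by rewrite /g /extend => ->.
have gB i : n <= i < n + size B -> g i \in B.
  move=> /andP[ni iB]; rewrite /g /extend ltnNge ni /=.
  by rewrite mem_nth // ltn_subLR.
have adjE i : adj (expand P v A (size B)) i =
    if i < n then
      if i == v then adj P v ++ A ++ iota n (size B)
      else if i \in A then v :: adj P i else adj P i
    else if i < n + size B then [:: v] else [::].
  by rewrite /adj vtx_expand -/n; do 4?case: ifP.
have vA : v \notin A by apply/negP=> /AP[_ _]; rewrite e_irr.
have Alt i : i \in A -> i < n by case/AP.
have adjlt i j : j \in adj P i -> (i < n) * (j < n).
  by move=> jA; split; [apply: desc_ltl jA | apply: desc_lt jA]; exact: D.
(* Adjacency after the expansion in a form that is symmetric in [i] and [j]; symmetry, range and the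
   edge condition are all read off from it. *)
have memE i j : (j \in adj (expand P v A (size B)) i) =
    [|| j \in adj P i, (i == v) && (j \in A), (j == v) && (i \in A),
        (i == v) && (n <= j < n + size B) | (j == v) && (n <= i < n + size B)].
  rewrite adjE; case: (ltnP i n) => iN.
    rewrite andbF orbF; case: eqP => [->|_].
      by rewrite !mem_cat mem_iota (negbTE vA) andbF.
    by case: (i \in A); rewrite ?in_cons ?andbT ?andbF ?orbF // orbC.
  have -> : (j \in adj P i) = false by apply: contraTF iN => /adjlt[iN _]; rewrite -ltnNge.
  have -> : (i == v) = false by apply: contraTF iN => /eqP->; rewrite -ltnNge.
  have -> : (i \in A) = false by apply: contraTF iN => /Alt iN; rewrite -ltnNge.
  by rewrite andbF /=; case: ifP => _; rewrite ?inE ?andbT ?andbF.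
have symE i j : (j \in adj (expand P v A (size B)) i) ->
                (i \in adj (expand P v A (size B)) j).
  rewrite !memE => /or4P[jA|->|->|/orP[]->]; rewrite ?orbT //.
  by rewrite (desc_sym D jA).
have ltE i j : (j \in adj (expand P v A (size B)) i) -> j < n + size B.
  rewrite memE => /or4P[/adjlt[_ jN]|/andP[_ /Alt jN]|/andP[/eqP-> _]|/orP[]].
  - exact: ltn_addr.
  - exact: ltn_addr.
  - exact: ltn_addr.
  - by case/and3P.
  - by case/andP=> /eqP-> _; apply: ltn_addr.
split.
- move=> i; rewrite size_expand -/n => iN; case: (ltnP i n) => ni.
    by rewrite gE //; apply: (desc_in D).
  by have /BP[] : g i \in B by apply: gB; rewrite ni.
- move=> i j; rewrite size_expand -/n => iN jN.
  case: (ltnP i n) => ni; case: (ltnP j n) => nj.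
  + by rewrite !gE //; apply: (desc_inj D).
  + have /BP[_ _ /(_ i ni) /eqP ne] : g j \in B by apply: gB; rewrite nj.
    by rewrite (gE i ni) => /ne.
  + have /BP[_ _ /(_ j nj) /eqP ne] : g i \in B by apply: gB; rewrite ni.
    by rewrite (gE j nj) => /esym/ne.
  + rewrite /g /extend !ltnNge ni nj /= => /eqP.
    by rewrite nth_uniq ?ltn_subLR // => /eqP; lia.
- by move=> i j; rewrite size_expand; apply: ltE.
- exact: symE.
- move=> i j ji.
  suff H i' j' : [|| j' \in adj P i', (i' == v) && (j' \in A) |
      (i' == v) && (n <= j' < n + size B)] -> e (g i') (g j').
    move: ji; rewrite memE => /or4P[h|h|h|/orP[]h].
    + by apply: H; rewrite h.
    + by apply: H; rewrite h orbT.
    + by rewrite e_sym; apply: H; rewrite h orbT.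
    + by apply: H; rewrite h !orbT.
    + by rewrite e_sym; apply: H; rewrite h !orbT.
  case/or3P=> [jA|/andP[/eqP-> jA]|/andP[/eqP-> jB]].
  + by have [iN jN] := adjlt _ _ jA; rewrite !gE //; apply: (desc_edge D).
  + by have [jN _ ej] := AP _ jA; rewrite !gE.
  + by rewrite (gE v vP); have /BP[] := gB _ jB.
- move=> i; rewrite adjE; case: ifP => iN; last by case: ifP.
  case: eqP => [_|/eqP iv].
    rewrite !cat_uniq (desc_uniq D) uA iota_uniq andbT /=; apply/andP; split.
      rewrite has_cat negb_or; apply/andP; split.
        by apply/hasPn=> j /AP[].
      apply/hasPn=> j; rewrite mem_iota => /andP[nj _].
      by apply: contraL nj => /adjlt[_ jN]; rewrite -ltnNge.
    apply/hasPn=> j; rewrite mem_iota => /andP[nj _].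
    by apply: contraL nj => /Alt jN; rewrite -ltnNge.
  case: ifP => iA; last exact: (desc_uniq D).
  rewrite cons_uniq (desc_uniq D) andbT; have [_ ni _] := AP _ iA.
  by apply: contra ni => /(desc_sym D).
- move=> i w; rewrite vtx_expand -/n; case: ifP => iN; last by case: ifP.
  rewrite (gE i iN); case: eqP => [->{i iN} _ wS ew|_ i2 wS ew].
    case: (allP w wS ew) => [[j jA ->]|wB].
      exists j; last by rewrite gE //; move: jA; rewrite mem_cat => /orP[/adjlt[]|/Alt].
      by rewrite memE eqxx; move: jA; rewrite mem_cat => /orP[]->; rewrite ?orbT.
    exists (n + index w B).
      by rewrite memE eqxx leq_addr ltn_add2l index_mem wB !orbT.
    by rewrite /g /extend ltnNge leq_addr /= addKn nth_index.
  have i2' : (vtx P i).2 by move: i2; case: ifP.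
  have [j jA ->] := desc_full D i2' wS ew.
  by exists j; [rewrite memE jA | rewrite gE // (adjlt _ _ jA).2].
Qed.

Definition missing (S : {set T}) (P : pgraph) (f : nat -> T) (v : nat) : pred T :=
  [pred w | [&& w \in S, e (f v) w & w \notin [seq f j | j <- adj P v]]].

Definition unnamed (S : {set T}) (P : pgraph) (f : nat -> T) (v : nat) : seq T :=
  [seq w <- enum T | missing S P f v w & w \notin [seq f i | i <- iota 0 (size P)]].

Lemma mem_names (P : pgraph) (f : nat -> T) w :
  reflect (exists2 i, i < size P & w = f i) (w \in [seq f i | i <- iota 0 (size P)]).
Proof.
apply: (iffP mapP) => [[i]|[i iP ->]]; first by rewrite mem_iota => iP ->; exists i.
by exists i => //; rewrite mem_iota.
Qed.

(** A closed vertex lists all its neighbours and adjacency lists are symmetric, so a named neighbour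
    that [v] does not list must still be open. *)
Lemma missing_cands S P f v i : desc S P f -> v < size P -> i < size P ->
  missing S P f v (f i) -> i \in cands P v.
Proof.
move=> D vP iP /and3P[iS ei iA]; rewrite mem_filter mem_iota iP andbT.
have -> : eqn i v = false.
  by apply/negP=> /eqnP ev; move: ei; rewrite ev e_irr.
have niA : i \notin adj P v by apply: contra iA; apply: map_f.
rewrite memnE niA /=; case: ifPn => //; rewrite negbK => ci.
rewrite e_sym in ei; have := edge_closed D (i := i) (j := v).
rewrite ci ei => /(_ isT iP vP)/esym/(desc_sym D).
by rewrite (negbTE niA).
Qed.

(** The expansion that really happens: [A] names all missing neighbours that already have a name,
    and the others receive new ones. *)
Lemma expand_desc S P f v A : desc S P f -> v < size P -> uniq A ->
  (forall i, (i \in A) = (i < size P) && missing S P f v (f i)) ->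
  [/\ desc S (expand P v A (size (unnamed S P f v)))
        (extend (size P) f (unnamed S P f v)),
      size (adj P v) + size A + size (unnamed S P f v) = deg S (f v)
    & forall w, w \in unnamed S P f v ->
        missing S P f v w /\ forall i, i < size P -> f i != w].
Proof.
move=> D vP uA AP; set B := unnamed S P f v.
have BP w : w \in B -> missing S P f v w /\ forall i, i < size P -> f i != w.
  rewrite mem_filter => /andP[/andP[mw nw] _]; split=> // i iP.
  by apply: contraNneq nw => <-; apply/mem_names; exists i.
have uB : uniq B by rewrite filter_uniq ?enum_uniq.
have DE : desc S (expand P v A (size B)) (extend (size P) f B).
  apply: desc_expand => //.
  - move=> i; rewrite AP => /andP[iP /and3P[_ ei niA]]; split=> //.
    by apply: contra niA; apply: map_f.
  - by move=> w /BP[/and3P[wS ew _] wn]; split.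
  move=> w wS ew; case: (boolP (w \in [seq f j | j <- adj P v])) => [|wA].
    by case/mapP=> j jA ->; left; exists j; rewrite ?mem_cat ?jA.
  have mw : missing S P f v w by apply/and3P; split.
  case: (boolP (w \in [seq f i | i <- iota 0 (size P)])) => [/mem_names[i iP wi]|wn].
    by left; exists i => //; rewrite mem_cat AP iP -wi mw orbT.
  by right; rewrite mem_filter mw wn mem_enum.
split=> //; have cv : closed_at (expand P v A (size B)) v.
  by rewrite /closed_at vtx_expand vP eqxx.
have := deg_closed DE cv; rewrite {1}/extend vP => ->.
by rewrite /adj vtx_expand vP eqxx /= !size_cat size_iota addnA.
Qed.

(** * The assumptions of a stage *)

(* The last clause excludes [K4] with one edge subdivided by [s]. *)
Record facts (mind t : nat) (S : {set T}) : Prop := Facts {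
  facts_min : forall v, v \in S -> mind <= deg S v;
  facts_c4 : forall a b c d, all (mem S) [:: a; b; c; d] ->
    [&& e a b, e b c, e c d & e d a] -> [&& a != c, b != d, ~~ e a c & ~~ e b d] ->
    t <= deg S a + deg S b + deg S c + deg S d;
  facts_d5 : forall s a b c d, all (mem S) [:: s; a; b; c; d] ->
    uniq [:: s; a; b; c; d] ->
    ~~ [&& e s a, e s b, e a c, e a d, e b c, e b d & e c d] }.

(** Pruning never discards a true branch: known edges, known non-edges and the bounds [maxdeg] all
    hold in [S], so any pattern that is found would violate [F]. *)
Lemma contradicts_false mind t S P f v : facts mind t S -> desc S P f -> v < size P ->
  contradicts mind t P v = false.
Proof.
move=> F D vP; have lt := desc_lt D.
have -> : contradicts mind t P v = [|| closed_at P v && (size (adj P v) < mind),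
    low_c4 P t v | all full P && has_d5 P] by rewrite /contradicts allbE; case: closed_at; case: (_ < mind); case: low_c4.
apply/negbTE; rewrite !negb_or; apply/and3P; split.
- apply/negP=> /andP[cv]; rewrite -(deg_closed D cv) ltnNge.
  by rewrite (facts_min F) ?(desc_in D).
- apply/negP; rewrite /low_c4 hasbE => /hasP[b bA]; rewrite hasbE => /hasP[d dA].
  case: eqnP => //= /eqP bd; case: ifP => // /andP[]; rewrite memnE.
  move=> cbd dbA; rewrite hasbE => /hasP[c cA].
  case: eqnP => //= /eqP cv; rewrite memnE; case: ifP => // /andP[cdA].
  rewrite /chord_free memnE => /andP[cvc cvA]; rewrite ltnNge => /negP; apply.
  have [bP dP cP] : [/\ b < size P, d < size P & c < size P].
    by split; apply: lt; eassumption.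
  apply: leq_trans (facts_c4 F (a := f v) (b := f b) (c := f c) (d := f d) _ _ _) _.
  + by rewrite /= !(desc_in D).
  + rewrite (desc_edge D bA) (desc_edge D cA) [e _ (f d)]e_sym (desc_edge D cdA).
    by rewrite e_sym (desc_edge D dA).
  + rewrite (edge_closed D) ?cvc // (edge_closed D) // cvA dbA !andbT.
    apply/andP; split; [apply: contraNneq cv | apply: contraNneq bd].
      by move/(desc_inj D vP cP)->.
    by move/(desc_inj D bP dP)->.
  by rewrite !leq_add // (deg_le_maxdeg D).
apply/negP=> /andP[_]; rewrite /has_d5 hasbE => /hasP[s _].
rewrite hasbE => /hasP[a aA]; rewrite hasbE => /hasP[b bA].
rewrite hasbE => /hasP[c cA]; rewrite hasbE => /hasP[d dA].
rewrite !memnE !andifE => /andP[/andP[/andP[/andP[us bs] cb] db] dc].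
have sP := desc_ltl D aA.
have [aP bP cP dP] : [/\ a < size P, b < size P, c < size P & d < size P].
  by split; apply: lt; eassumption.
apply: (negP (facts_d5 F (s := f s) (a := f a) (b := f b) (c := f c) (d := f d) _ _)).
- by rewrite /= !(desc_in D).
- rewrite -[[:: f s; _; _; _; _]]/(map f [:: s; a; b; c; d]) map_inj_in_uniq //.
  have ltP k : k \in [:: s; a; b; c; d] -> k < size P.
    by rewrite !inE => /or4P[/eqP->|/eqP->|/eqP->|/orP[]/eqP->].
  by move=> k l /ltP kP /ltP lP; apply: (desc_inj D).
by rewrite !(desc_edge D).
Qed.

Lemma leq_sub_left a b c n : a + b + c <= n -> b <= n - a.
Proof. by lia. Qed.

Lemma leq_sub_right a b c n : a + b + c <= n -> c < 0 + (n - a - b).+1.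
Proof. by lia. Qed.

Lemma expansions_sound mind t S P f v : facts mind t S -> desc S P f -> v < size P ->
  exists Q g, Q \in expansions mind t P v /\ desc S Q g.
Proof.
move=> F D vP; pose A := [seq i <- cands P v | missing S P f v (f i)].
have uA : uniq A by rewrite !filter_uniq ?iota_uniq.
have AP i : (i \in A) = (i < size P) && missing S P f v (f i).
  rewrite mem_filter andbC; apply/andP/andP=> [[iC mi]|[iP mi]]; split=> //.
    by move: iC; rewrite mem_filter mem_iota => /andP[_].
  exact: missing_cands mi.
have [DE sE _] := expand_desc D vP uA AP; set Q := expand _ _ _ _ in DE.
exists Q, (extend (size P) f (unnamed S P f v)); split=> //.
have vQ : v < size Q by rewrite size_expand ltn_addr.
rewrite mem_filter (contradicts_false F DE vQ); apply/flatten_mapP.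
have := deg_le3 S (f v); rewrite -sE => s3.
exists A; first by apply: subs_filter; apply: leq_sub_left s3.
by apply/mapP; exists (size (unnamed S P f v)); rewrite // mem_iota leq_sub_right.
Qed.

(** * Partial graphs with a marked set *)

(* The vertices of [I] are those marked by [C]. *)
Definition located S (I : {set T}) (C : seq bool) P f : Prop :=
  [/\ desc S P f, size C <= size P,
      forall i, i < size P -> (f i \in I) = nth false C i
    & forall w, w \in I -> exists2 i, i < size P & w = f i].

(** All of [I] has names already, so a newly named vertex lies outside [I]. This agrees with
    [nth false] beyond the end of [C], which is why [C] stays fixed while [P] grows. *)
Lemma located_expand S I C P f v A : located S I C P f -> v < size P -> uniq A ->
  (forall i, (i \in A) = (i < size P) && missing S P f v (f i)) ->
  located S I C (expand P v A (size (unnamed S P f v)))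
    (extend (size P) f (unnamed S P f v)).
Proof.
move=> [D sC IC nI] vP uA AP; have [DE _ BP] := expand_desc D vP uA AP.
split=> //; first by rewrite size_expand (leq_trans sC) ?leq_addr.
  move=> i; rewrite size_expand /extend => iE; case: ltnP => iP; first exact: IC.
  rewrite (nth_default _ (leq_trans sC iP)).
  have /BP[_ nw] : nth (f 0) (unnamed S P f v) (i - size P) \in unnamed S P f v.
    by rewrite mem_nth // ltn_subLR.
  by apply/negP=> /nI[j jP E]; move: (nw j jP); rewrite E eqxx.
move=> w /nI[i iP ->]; exists i; first by rewrite size_expand ltn_addr.
by rewrite /extend iP.
Qed.

Lemma located_fresh S I C P f w : located S I C P f -> w \in S ->
  (forall i, i < size P -> f i != w) ->
  located S I C (fresh P) (extend (size P) f [:: w]).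
Proof.
move=> [D sC IC nI] wS nw; set n := size P; set g := extend n f [:: w].
have gE i : i < n -> g i = f i by rewrite /g /extend => ->.
have gn : g n = w by rewrite /g /extend ltnn subnn.
have sF : size (fresh P) = n.+1 by rewrite size_rcons.
have vE i : vtx (fresh P) i = vtx P i.
  rewrite /vtx nth_rcons; case: ltnP => // ni; rewrite nth_default //.
  by case: eqP.
have aE i : adj (fresh P) i = adj P i by rewrite /adj vE.
have lt i j : j \in adj P i -> (i < n) * (j < n).
  by move=> jA; split; [apply: (desc_ltl D jA) | apply: (desc_lt D jA)].
split.
- split.
  + move=> i; rewrite sF ltnS leq_eqVlt => /predU1P[->|iP]; first by rewrite gn.
    by rewrite gE //; apply: (desc_in D).
  + move=> i j; rewrite sF !ltnS (leq_eqVlt i) (leq_eqVlt j).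
    move=> /predU1P[->|iP] /predU1P[->|jP] //; rewrite ?gn ?gE //.
    * by move=> E; move: (nw j jP); rewrite -E eqxx.
    * by move=> E; move: (nw i iP); rewrite E eqxx.
    * exact: (desc_inj D).
  + by move=> i j; rewrite aE sF => /lt[_ jn]; apply: ltnW.
  + by move=> i j; rewrite !aE; apply: (desc_sym D).
  + by move=> i j; rewrite aE => jA; rewrite !gE ?(lt _ _ jA) //; apply: (desc_edge D).
  + by move=> i; rewrite aE; apply: (desc_uniq D).
  move=> i u; rewrite vE aE => i2; have iP : i < n.
    by move: i2; rewrite /vtx; case: ltnP => // ni; rewrite nth_default.
  rewrite gE // => uS eu; have [j jA ->] := desc_full D i2 uS eu.
  by exists j => //; rewrite gE // (lt _ _ jA).
- by rewrite sF; apply: leq_trans (leqnSn n).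
- move=> i; rewrite sF ltnS leq_eqVlt => /predU1P[->|iP]; last by rewrite gE // IC.
  rewrite gn nth_default //; apply/negP=> /nI[j jP E].
  by move: (nw j jP); rewrite E eqxx.
by move=> u /nI[i iP ->]; exists i; rewrite ?gE // sF ltnS ltnW.
Qed.

Section Located.

Variables (S I : {set T}) (C : seq bool) (P : pgraph) (f : nat -> T).
Hypothesis L : located S I C P f.

Let D : desc S P f. Proof. by case: L. Qed.
Let IC i : i < size P -> (f i \in I) = nth false C i.
Proof. by case: L => _ _ h _; apply: h. Qed.

Lemma mem_outs v i : (i \in outs P C v) = (i \in adj P v) && (f i \notin I).
Proof.
rewrite mem_filter andbC; case: (boolP (i \in adj P v)) => //= iA.
by rewrite IC ?(desc_lt D iA).
Qed.

Lemma outs_sub v : v < size P -> {subset [seq f i | i <- outs P C v] <= nb (S :\: I) (f v)}.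
Proof.
move=> vP w /mapP[i]; rewrite mem_outs => /andP[iA iI] ->.
by rewrite !inE iI (desc_in D (desc_lt D iA)) (desc_edge D iA).
Qed.

Lemma nb_outs v w : closed_at P v -> w \in nb (S :\: I) (f v) ->
  exists2 i, i \in outs P C v & w = f i.
Proof.
move=> cv; rewrite !inE => /andP[/andP[wI wS] ew].
have [i iA wi] := desc_closed D cv wS ew.
by exists i; rewrite // mem_outs iA -wi.
Qed.

Lemma outs_uniq v : uniq (outs P C v).
Proof. by rewrite filter_uniq // (desc_uniq D). Qed.

Lemma outs_map_uniq v : uniq [seq f i | i <- outs P C v].
Proof.
rewrite map_inj_in_uniq ?outs_uniq // => i j.
rewrite !mem_outs => /andP[iA _] /andP[jA _].
by apply: (desc_inj D); apply: (desc_lt D); eassumption.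
Qed.

Lemma size_outs v : closed_at P v -> size (outs P C v) = deg (S :\: I) (f v).
Proof.
move=> cv; rewrite -(size_map f) -(card_uniqP (outs_map_uniq v)); apply: eq_card => w.
apply/idP/idP=> [/(outs_sub (closed_lt cv)) //|/(nb_outs cv)[i iO ->]].
exact: map_f.
Qed.

Lemma outs_pair v x y : closed_at P v -> nb (S :\: I) (f v) = [set x; y] -> x != y ->
  exists p q, outs P C v = [:: p; q] /\
    ((f p = x /\ f q = y) \/ (f p = y /\ f q = x)).
Proof.
move=> cv nE xy; have := size_outs cv; rewrite /deg nE cards2 xy.
case E : (outs P C v) => [|p [|q []]] // _; exists p, q; split=> //.
have pq : f p != f q by have := outs_map_uniq v; rewrite E /= inE andbT.
have H i : i \in [:: p; q] -> f i \in [set x; y].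
  by rewrite -nE => iE; apply: (outs_sub (closed_lt cv)); rewrite E map_f.
have := H p (mem_head _ _); have := H q; rewrite !inE eqxx orbT => /(_ isT).
move=> /pred2P[qx|qy] /pred2P[px|py]; [|by right|by left|].
  by rewrite px qx eqxx in pq.
by rewrite py qy eqxx in pq.
Qed.

End Located.

(** * Branches on a new isolated vertex *)

Lemma iso_at_sound mind t S I C P f v : facts mind t S -> located S I C P f ->
  v < size P -> nb S (f v) \subset I -> nb S (f v) != set0 ->
  exists Q g, Q \in iso_at mind t C P v /\ desc S Q g.
Proof.
move=> F L vP nI n0; have [D sC IC IP] := L.
pose A := [seq i <- [seq i <- cands P v | nth false C i] | missing S P f v (f i)].
have uA : uniq A by rewrite !filter_uniq ?iota_uniq.
have AP i : (i \in A) = (i < size P) && missing S P f v (f i).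
  rewrite mem_filter andbC; apply/andP/andP=> [[iC mi]|[iP mi]]; split=> //.
    by move: iC; rewrite !mem_filter mem_iota => /and3P[_ _].
  rewrite mem_filter (missing_cands D vP iP mi) -IC // (subsetP nI) //.
  by case/and3P: mi => iS ei _; rewrite inE iS.
have [DE sE BP] := expand_desc D vP uA AP.
(* All neighbours of [f v] lie in [I], where every vertex has a name. *)
have B0 : unnamed S P f v = [::].
  case E : (unnamed S P f v) => [//|w B]; have := BP w; rewrite E mem_head.
  case=> // /and3P[wS ew _] nw; have := subsetP nI w; rewrite inE wS ew.
  by case/(_ isT)/IP=> i iP wi; move: (nw i iP); rewrite wi eqxx.
move: DE sE; rewrite B0 /= addn0; set Q := expand _ _ _ _ => DE sE.
exists Q, (extend (size P) f [::]); split=> //.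
have vQ : v < size Q by rewrite size_expand ltn_addr.
rewrite mem_filter andifE (contradicts_false F DE vQ) andbT; apply/andP; split.
  by rewrite /adj /Q vtx_expand vP eqxx /= !size_cat addn0 sE card_gt0.
apply/mapP; exists A => //; apply: subs_filter.
by apply: (@leq_sub_left _ _ 0); rewrite addn0 sE deg_le3.
Qed.

(** The alternative behind a deletion: a new isolated vertex is either visible in [P], and then
    charged in [profitable], or its discovery refines the partial graph. *)
Lemma iso_branches_sound mind t S I C P f w : facts mind t S -> located S I C P f ->
  size C = size P -> w \in S :\: I -> nb S w \subset I -> nb S w != set0 ->
  (exists i, [/\ i < size P, iso_known P C i & w = f i]) \/
  exists Q g, Q \in iso_branches mind t P C /\ desc S Q g.
Proof.
move=> F L sCP; rewrite inE => /andP[wI wS] nI n0; have [D sC IC IP] := L.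
case: (boolP (w \in [seq f i | i <- iota 0 (size P)])) => [/mem_names[i iP wi]|nw].
  have o0 : nilp (outs P C i).
    case E : (outs P C i) => [//|j s].
    have : j \in outs P C i by rewrite E mem_head.
    rewrite (mem_outs L) => /andP[jA /negP[]]; apply: (subsetP nI).
    by rewrite wi inE (desc_edge D jA) (desc_in D (desc_lt D jA)).
  have Ci : nth false C i = false by rewrite -IC // -wi (negbTE wI).
  case: (boolP (closed_at P i)) => ci.
    by left; exists i; rewrite /iso_known Ci ci o0.
  right; rewrite wi in nI n0.
  have [Q [g [QB Dg]]] := iso_at_sound F L iP nI n0; exists Q, g; split=> //.
  rewrite mem_cat; apply/orP; left; apply/flatten_mapP; exists i => //.
  by rewrite mem_filter Ci ci o0 mem_iota.
right; have nw' i : i < size P -> f i != w.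
  by move=> iP; apply: contraNneq nw => <-; apply/mem_names; exists i.
have := located_fresh L wS nw'; set g := extend _ _ _ => Lg.
have gw : g (size P) = w by rewrite /g /extend ltnn subnn.
have [||| Q [h [QB Dh]]] := iso_at_sound (v := size P) F Lg.
- by rewrite size_rcons.
- by rewrite gw.
- by rewrite gw.
by exists Q, h; rewrite mem_cat QB orbT.
Qed.

(** * Branches on a new 4-cycle *)

Lemma ring_expansions_sound S I C P f v F x y : located S I C P f -> v < size P ->
  nb (S :\: I) (f v) = [set x; y] -> x != y -> uniq F ->
  (forall i, i \in F -> i < size P /\ f i \in [set x; y]) ->
  exists Q g, [/\ Q \in ring_expansions P C v F, located S I C Q g, closed_at Q v,
    size P <= size Q & forall i, i < size P -> g i = f i].
Proof.
move=> L vP nE xy uF FP; have [D sC IC nI] := L.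
have FO i : i \in F -> [/\ i < size P, f i \in S, f i \notin I & e (f v) (f i)].
  move=> /FP[iP]; rewrite -nE !inE => /andP[/andP[iI iS] ei].
  by split.
rewrite /ring_expansions; case: (boolP (closed_at P v)) => cv.
  exists P, f; split=> //; rewrite (size_outs L cv) /deg nE cards2 xy allbE.
  have -> : all (memn^~ (adj P v)) F.
    apply/allP=> i /FO[iP _ _ ei].
    by rewrite /= memnE -(edge_closed D) ?cv ?ei ?iP ?vP.
  by rewrite mem_head.
set a := adj P v; set h := [seq i <- F | ~~ memn i a]; set cd := cands P v.
set o := size (outs P C v) + size h.
pose A := [seq i <- [seq i <- cd | ~~ nth false C i &&& ~~ memn i h]
               | missing S P f v (f i)].
pose B := [seq i <- [seq i <- cd | nth false C i] | missing S P f v (f i)].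
have inh i : (i \in h) = (i \in F) && (i \notin a) by rewrite mem_filter memnE andbC.
have inA i : (i \in A) = [&& missing S P f v (f i), ~~ nth false C i, i \notin h & i \in cd].
  by rewrite 2!mem_filter /= andifE memnE -andbA.
have inB i : (i \in B) = [&& missing S P f v (f i), nth false C i & i \in cd].
  by rewrite 2!mem_filter.
have hm i : i \in h -> missing S P f v (f i).
  rewrite inh => /andP[/FO[iP iS _ ei] niA]; apply/and3P; split=> //.
  apply: contra niA => /mapP[j jA E].
  by rewrite (desc_inj D iP _ E) // (desc_lt D jA).
have hC i : i \in h -> nth false C i = false.
  by rewrite inh => /andP[/FO[iP _ iI _] _]; rewrite -IC // (negbTE iI).
have hlt i : i \in h -> i < size P by rewrite inh => /andP[/FO[]].
have hcd : {subset h <= cd} by move=> i ih; apply: (missing_cands D); auto.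
have cdlt i : i \in cd -> i < size P by rewrite mem_filter mem_iota => /andP[].
have ucd : uniq cd by rewrite filter_uniq ?iota_uniq.
have uA : uniq (h ++ A ++ B).
  have [uh uA uB] : [/\ uniq h, uniq A & uniq B] by split; [apply: filter_uniq | do 2!apply: filter_uniq..].
  rewrite !cat_uniq uh uA uB /= andbT; apply/andP; split.
    apply/hasPn=> i; rewrite mem_cat inA inB => /orP[/and4P[_ _ ->]//|/and3P[_ Ci _]].
    by apply/negP=> /hC; rewrite Ci.
  by apply/hasPn=> i; rewrite /= inA inB => /and3P[_ -> _]; rewrite andbF.
have AP i : (i \in h ++ A ++ B) = (i < size P) && missing S P f v (f i).
  rewrite !mem_cat inA inB; apply/idP/andP=> [|[iP mi]].
    by case/or3P=> [ih|/and4P[mi _ _ /cdlt]|/and3P[mi _ /cdlt]]; split; auto.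
  rewrite mi (missing_cands D vP iP mi : i \in cd).
  by case: (i \in h) => //=; case: (nth false C i).
have [DE sE _] := expand_desc D vP uA AP.
have := located_expand L vP uA AP; move: DE sE.
set m := size (unnamed S P f v); set g := extend _ _ _.
set Q := expand _ _ _ _ => DE sE LE.
have gE i : i < size P -> g i = f i by rewrite /g /extend => ->.
have cvQ : closed_at Q v by rewrite /closed_at vtx_expand vP eqxx.
(* A corner of the cycle has degree 2 outside [I], which determines the number [m] of its new
   neighbours. *)
have oE : o + size A + m = 2.
  have := size_outs LE cvQ; rewrite gE // /deg nE cards2 xy => <-.
  rewrite /outs /adj vtx_expand vP eqxx /= !filter_cat !size_cat !addnA.
  have -> : [seq i <- h | ~~ nth false C i] = h.
    by apply/all_filterP/allP=> i /hC->.
  have -> : [seq i <- A | ~~ nth false C i] = A.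
    by apply/all_filterP/allP=> i; rewrite inA => /and4P[].
  have -> : [seq i <- B | ~~ nth false C i] = [::].
    apply/eqP; rewrite -size_eq0 size_filter -leqn0 leqNgt -has_count.
    by apply/hasPn=> i; rewrite inB negbK => /and3P[].
  have -> : [seq i <- iota (size P) m | ~~ nth false C i] = iota (size P) m.
    apply/all_filterP/allP=> i; rewrite mem_iota => /andP[iP _].
    by rewrite nth_default // (leq_trans sC).
  by rewrite size_iota addn0.
exists Q, g; split=> //; last by rewrite size_expand leq_addr.
rewrite allbE; have -> : all (memn^~ cd) h.
  by apply/allP=> i /hcd; rewrite memnE.
have -> : o <= 2 by rewrite -oE -addnA leq_addr.
have mE : 2 - o - size A = m by rewrite -oE -addnA addKn addKn.
apply/flatten_mapP; exists A.
  by apply: subs_filter; rewrite -/A -oE -addnA addKn leq_addr.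
have s3 : size a + size h + size A + m + size B <= 3.
  have arith p q r k l : p + (q + (r + k)) + l <= 3 -> p + q + r + l + k <= 3 by lia.
  by apply: arith; rewrite -(size_cat A) -(size_cat h) sE deg_le3.
rewrite mE (leq_trans (leq_addr _ _) s3); apply/mapP; exists B => //.
have arith p q : p + q <= 3 -> q <= 3 - p by lia.
by apply: subs_filter; apply: arith.
Qed.

(** The anchor read off the graph itself. Unlike [anchor] it does not depend on how far the partial
    graph has been expanded, so anchors computed at different moments can be compared. *)
Definition anch (C : seq bool) (f : nat -> T) (w : T) : nat :=
  find (fun i => nth false C i && e w (f i)) (iota 0 (size C)).

Lemma anchorE S I C P f g v : located S I C P g -> closed_at P v ->
  (forall i, i < size C -> g i = f i) -> anchor P C v = anch C f (g v).
Proof.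
move=> [D sC _ _] cv gf; apply: eq_in_find => i; rewrite mem_iota => /andP[_ iC].
rewrite andifE memnE -gf //; congr (_ && _); apply/esym.
by rewrite (edge_closed D) ?cv ?(closed_lt cv) // (leq_trans iC).
Qed.

Lemma c4_atP (D : {set T}) a b c d :
  reflect [/\ uniq [:: a; b; c; d] /\ all (mem D) [:: a; b; c; d],
              nb D a = [set b; d], nb D b = [set a; c], nb D c = [set b; d]
            & nb D d = [set a; c]] (c4_at D a b c d).
Proof.
apply: (iffP idP) => [/and5P[u m /eqP na /eqP nb' /andP[/eqP nc /eqP nd]] //|].
by case=> -[u m] na nb' nc nd; rewrite /c4_at na nb' nc nd !eqxx u m.
Qed.

Section Ring.

Variable D : {set T}.

Lemma c4_at_rot a b c d : c4_at D a b c d -> c4_at D b c d a.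
Proof.
case/c4_atP=> -[u m] na nb' nc nd; apply/c4_atP; split.
- by split; [rewrite -(rot_uniq 1) in u | move: m; rewrite /= !andbT => /and4P[-> -> -> ->]].
- by rewrite nb' setUC.
- by rewrite nc.
- by rewrite nd setUC.
- by rewrite na.
Qed.

Lemma c4_at_flip a b c d : c4_at D a b c d -> c4_at D a d c b.
Proof.
case/c4_atP=> -[u m] na nb' nc nd; apply/c4_atP; split.
- split; last by move: m; rewrite /= !andbT => /and4P[-> -> -> ->].
  move: u; rewrite /= !inE !negb_or !andbT.
  move=> /and3P[/and3P[ab ac ad] /andP[bc bd] cd].
  by rewrite ad ac ab !(eq_sym d) cd bd (eq_sym c) bc.
- by rewrite na setUC.
- by rewrite nd.
- by rewrite nc setUC.
- by rewrite nb'.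
Qed.

(** The ball of radius 2 in [D]. It recovers the vertex set of a 4-cycle component from any one
    corner, so that a component can be identified with an index. *)
Definition square (w : T) : {set T} :=
  w |: (nb D w :|: \bigcup_(u in nb D w) nb D u).

Lemma squareE a b c d : nb D a = [set b; d] -> nb D b = [set a; c] ->
  nb D d = [set a; c] -> square a = [set a; b; c; d].
Proof.
move=> na nb' nd; rewrite /square na; apply/setP=> w; rewrite !inE.
apply/idP/idP=> [|/orP[/orP[/orP[]|]|]/eqP->]; rewrite ?eqxx ?orbT //.
  case/or3P=> [->//|/orP[]->|/bigcupP[u ub wu]]; rewrite ?orbT //.
  have : w \in [set a; c] by move: wu; case/set2P: ub => ->; rewrite ?nb' ?nd.
  by rewrite !inE => /orP[]->; rewrite ?orbT.
by apply/orP; right; apply/orP; right; apply/bigcupP; exists b; rewrite ?nb' ?set21 ?set22 // !inE eqxx.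
Qed.

Lemma c4_at_square a b c d : c4_at D a b c d -> square a = [set a; b; c; d].
Proof. by case/c4_atP=> _ na nb' _ nd; apply: squareE. Qed.

Lemma c4_at_edges a b c d : c4_at D a b c d ->
  [/\ all (mem D) [:: a; b; c; d], [&& e a b, e b c, e c d & e d a]
    & [&& a != c, b != d, ~~ e a c & ~~ e b d]].
Proof.
case/c4_atP=> -[u m] na nb' nc nd; split=> //.
  have eE x y z w : nb D x = [set z; w] -> y \in [set z; w] -> e x y.
    by move=> <-; rewrite inE => /andP[].
  rewrite (eE a b b d) ?(eE b c a c) ?(eE c d b d) ?(eE d a a c) //;
    by rewrite !inE eqxx ?orbT.
move: m u; rewrite /= !inE !negb_or !andbT => /and4P[aD bD cD dD].
move=> /and3P[/and3P[ab ac ad] /andP[bc bd] cd]; rewrite ac bd /=.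
have eE x y z w : nb D x = [set z; w] -> y \in D -> y != z -> y != w -> ~~ e x y.
  move=> /setP/(_ y); rewrite !inE => E yD /negbTE yz /negbTE yw.
  by move: E; rewrite yD yz yw /= => ->.
by rewrite (eE a c b d) ?(eE b d a c) // eq_sym.
Qed.

End Ring.

Lemma is_pairP s i j : is_pair s i j ->
  [/\ i \in s, j \in s & forall k, k \in s -> k = i \/ k = j].
Proof.
case: s => [|k [|l []]] //=; rewrite !andifE orifE.
by case/orP=> /andP[/eqnP-> /eqnP->]; rewrite !inE !eqxx ?orbT; split=> // m;
  rewrite !inE => /orP[]/eqP->; auto.
Qed.

Lemma is_pairC s i j : is_pair s i j = is_pair s j i.
Proof.
by case: s => [|k [|l []]] //=; rewrite !andifE !orifE orbC.
Qed.

Lemma c4_knownE P C a b c d : c4_known P C a b c d =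
  [&& all (fun i => ~~ nth false C i && closed_at P i) [:: a; b; c; d],
      is_pair (outs P C a) b d, is_pair (outs P C b) a c,
      is_pair (outs P C c) b d & is_pair (outs P C d) a c].
Proof. by rewrite /c4_known !andifE -!andbA. Qed.

Lemma c4_known_rot P C a b c d : c4_known P C a b c d -> c4_known P C b c d a.
Proof.
rewrite !c4_knownE /= !andbT => /and5P[/and4P[-> -> -> ->] ha hb hc hd].
by rewrite is_pairC hb hc is_pairC hd ha.
Qed.

Lemma in_c4P P C p a :
  reflect (exists b c d, c4_known P C a b c d && p a b c d) (in_c4 P C p a).
Proof.
rewrite /in_c4 hasbE; apply: (iffP hasP) => [[b _]|[b [c [d /andP[k pk]]]]].
  rewrite hasbE => /hasP[d _]; rewrite hasbE => /hasP[c _]; rewrite andifE => h.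
  by exists b, c, d.
move: (k); rewrite c4_knownE => /and5P[_ /is_pairP[ba da _] /is_pairP[_ cb _] _ _].
exists b => //; rewrite hasbE; apply/hasP; exists d => //; rewrite hasbE.
by apply/hasP; exists c => //; rewrite andifE k.
Qed.

(** The predicate counted in [profitable]: each known cycle is represented by its smallest name. *)
Definition least_c4 (P : pgraph) (C : seq bool) : nat -> bool :=
  in_c4 P C (fun a b c d => (a <= b) &&& (a <= c) &&& (a <= d)).

Lemma nb_pair S I C P f v i j : located S I C P f -> closed_at P v ->
  is_pair (outs P C v) i j -> nb (S :\: I) (f v) = [set f i; f j].
Proof.
move=> L cv /is_pairP[iO jO O2]; apply/setP=> w; apply/idP/set2P => [/(nb_outs L cv)|].
  by case=> k /O2[]->; auto.
by case=> ->; apply: (outs_sub L (closed_lt cv)); apply: map_f.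
Qed.

Lemma c4_known_square S I C P f a b c d : located S I C P f ->
  c4_known P C a b c d ->
  square (S :\: I) (f a) = [set f a; f b; f c; f d].
Proof.
move=> L; rewrite c4_knownE /= andbT => /and5P[/and4P[/andP[_ ca] /andP[_ cb] _ /andP[_ cd]]].
move=> ha hb _ hd; apply: squareE; exact: (nb_pair L).
Qed.

Lemma least_c4_exists S I C P f a b c d : located S I C P f ->
  c4_known P C a b c d ->
  exists i, [/\ i < size P, least_c4 P C i
    & square (S :\: I) (f i) = square (S :\: I) (f a)].
Proof.
move=> L; have wl i j k l : c4_known P C i j k l -> i <= j -> i <= k -> i <= l ->
    i < size P /\ least_c4 P C i.
  move=> K ij ik il; split.
    by move: K; rewrite c4_knownE => /and5P[/=/andP[/andP[_ /closed_lt]]].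
  by apply/in_c4P; exists j, k, l; rewrite K !andifE ij ik il.
move=> K; have K1 := c4_known_rot K; have K2 := c4_known_rot K1.
have K3 := c4_known_rot K2.
have : [|| (a <= b) && (a <= c) && (a <= d), (b <= c) && (b <= d) && (b <= a),
   (c <= d) && (c <= a) && (c <= b) | (d <= a) && (d <= b) && (d <= c)] by lia.
case/or4P=> /andP[/andP[m1 m2] m3].
- by have [] := wl _ _ _ _ K m1 m2 m3; exists a.
- have [iP li] := wl _ _ _ _ K1 m1 m2 m3; exists b; split=> //.
  rewrite (c4_known_square L K) (c4_known_square L K1).
  by apply/setP=> w; rewrite !inE; case: (w == f a); case: (w == f b); case: (w == f c); case: (w == f d).
- have [iP li] := wl _ _ _ _ K2 m1 m2 m3; exists c; split=> //.
  rewrite (c4_known_square L K) (c4_known_square L K2).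
  by apply/setP=> w; rewrite !inE; case: (w == f a); case: (w == f b); case: (w == f c); case: (w == f d).
have [iP li] := wl _ _ _ _ K3 m1 m2 m3; exists d; split=> //.
rewrite (c4_known_square L K) (c4_known_square L K3).
by apply/setP=> w; rewrite !inE; case: (w == f a); case: (w == f b); case: (w == f c); case: (w == f d).
Qed.

Lemma outs_rest S I C P f v s x y : located S I C P f -> closed_at P v ->
  nb (S :\: I) (f v) = [set x; y] -> x != y -> s < size P -> f s = x ->
  exists k, [/\ [seq i <- outs P C v | ~~ eqn i s] = [:: k], f k = y & k < size P].
Proof.
move=> L cv nE xy sP fs; have [D _ _ _] := L.
have [p [q [oE pq]]] := outs_pair L cv nE xy.
have lt i : i \in outs P C v -> i < size P.
  by rewrite (mem_outs L) => /andP[/(desc_lt D)].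
have pP : p < size P by apply: lt; rewrite oE mem_head.
have qP : q < size P by apply: lt; rewrite oE !inE eqxx orbT.
have neq i : f i = y -> eqn i s = false.
  by move=> fi; apply/eqnP=> E; move: xy; rewrite -fs -fi E eqxx.
rewrite oE /=; case: pq => -[fp fq].
  rewrite (neq q fq) (desc_inj D pP sP (etrans fp (esym fs))).
  by rewrite !eqnE eqxx; exists q.
rewrite (neq p fp) (desc_inj D qP sP (etrans fq (esym fs))).
by rewrite !eqnE eqxx; exists p.
Qed.

Lemma ring_branches_sound mind t S I C f0 P f s b c d : facts mind t S ->
  located S I C P f -> (forall i, i < size C -> f i = f0 i) ->
  s < size P -> b < size P -> d < size P -> closed_at P s ->
  c4_at (S :\: I) (f s) (f b) c (f d) ->
  anch C f0 (f s) <= anch C f0 (f b) <= anch C f0 (f d) ->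
  anch C f0 (f s) <= anch C f0 c ->
  exists Q g, Q \in ring_branches mind t P C s b d /\ desc S Q g.
Proof.
move=> F L ff0 sP bP dP cs c4 /andP[asb abd] asc; have [D sC _ _] := L.
have /c4_atP[[u _] ns nb' nc nd] := c4.
move: u; rewrite /= !inE !negb_or !andbT.
move=> /and3P[/and3P[nesb nesc nesd] /andP[nebc nebd] necd].
have [Q [g [QB LQ cQ PQ gf]]] : exists Q g, [/\ Q \in ring_expansions P C b [:: s],
    located S I C Q g, closed_at Q b, size P <= size Q
    & forall i, i < size P -> g i = f i].
  apply: (ring_expansions_sound L bP nb') => // i; rewrite inE => /eqP->.
  by rewrite set21.
have gE i : i < size P -> g i = f i by apply: gf.
have anQ := anchorE LQ cQ (fun i iC => etrans (gf i (leq_trans iC sC)) (ff0 i iC)).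
have sQ : s < size Q by apply: leq_trans PQ.
have bQ : b < size Q by apply: leq_trans PQ.
have dQ : d < size Q by apply: leq_trans PQ.
(* Closing [b] gives a name [k] to its second neighbour on the cycle, the corner opposite to [s]. *)
have [|k [kE gk kQ]] := outs_rest LQ cQ _ nesc sQ (gE s sP); first by rewrite gE.
have kd : k != d by apply: contraNneq necd => kd; rewrite -gk kd gE.
have [R [h [RB LR cR QR hg]]] : exists R h, [/\ R \in ring_expansions Q C d [:: s; k],
    located S I C R h, closed_at R d, size Q <= size R
    & forall i, i < size Q -> h i = g i].
  apply: (ring_expansions_sound LQ dQ (x := f s) (y := c)) => //.
  - by rewrite gE.
  - by rewrite /= inE andbT; apply: contraNneq nesc => E; rewrite -gk -E gE.
  move=> i; rewrite inE => /orP[/eqP->|]; first by rewrite gE // set21.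
  by rewrite inE => /eqP->; rewrite gk set22.
have hE i : i < size P -> h i = f i.
  by move=> iP; rewrite hg ?gE // (leq_trans iP).
have hk : h k = c by rewrite hg.
have anR := anchorE LR cR (fun i iC => etrans (hE i (leq_trans iC sC)) (ff0 i iC)).
have [W [w [WB LW cW RW wh]]] : exists W w, [/\ W \in ring_expansions R C k [:: b; d],
    located S I C W w, closed_at W k, size R <= size W
    & forall i, i < size R -> w i = h i].
  apply: (ring_expansions_sound LR (leq_trans kQ QR) (x := f b) (y := f d)) => //.
  - by rewrite hk.
  - by rewrite /= inE andbT; apply: contraNneq nebd => ->.
  move=> i; rewrite inE => /orP[/eqP->|].
    by rewrite hE // set21; split=> //; apply: leq_trans QR.
  by rewrite inE => /eqP->; rewrite hE // set22; split=> //; apply: leq_trans QR.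
have wE i : i < size P -> w i = f i.
  by move=> iP; rewrite wh ?hE // (leq_trans iP) // (leq_trans PQ).
have anW := anchorE LW cW (fun i iC => etrans (wE i (leq_trans iC sC)) (ff0 i iC)).
have anP := anchorE L cs ff0.
have [DW _ _ _] := LW; exists W, w; split=> //.
apply/flatten_mapP; exists Q => //.
rewrite anQ anP gE // ltnNge asb /= kE eqnE (negbTE kd).
apply/flatten_mapP; exists R => //; rewrite anR hE // ltnNge abd /=.
rewrite mem_filter WB andbT andifE ?anP anW wh ?hk ?(leq_trans kQ) // asc /=.
by rewrite (contradicts_false F DW) // (leq_trans sQ) // (leq_trans QR).
Qed.

Lemma badP (S Q : {set T}) : reflect (is_c4 S Q \/ is_d5 S Q) (Q \in bad S).
Proof. by rewrite inE; apply: orP. Qed.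

(* Unification would otherwise unfold the quantifiers in [bad]. *)
Opaque bad.

(* By [facts_d5], the other kind of bad component does not arise. *)
Lemma new_bad_c4 mind t S I N : facts mind t S ->
  N \in bad (S :\: I) -> N \notin bad S ->
  exists a b c d, [/\ c4_at (S :\: I) a b c d, N = [set a; b; c; d]
    & exists2 w, w \in [:: a; b; c; d] & nb S w :&: I != set0].
Proof.
move=> F /badP[/is_c4P[a [b [c [d [c4 ->]]]]]|].
  move=> nbad; exists a, b, c, d; split=> //; apply/hasP.
  (* If no corner had a neighbour in [I], the cycle would have been a component of [S] already. *)
  apply: contraR nbad; rewrite -all_predC => /allP nI.
  have nE w : w \in [:: a; b; c; d] -> nb S w = nb (S :\: I) w.
    move=> wL; have /= := nI w wL; rewrite negbK => /eqP/setP nSI.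
    apply/setP=> u; have := nSI u; rewrite !inE.
    by case: (u \in S); case: (u \in I); case: (e w u).
  apply/badP; left; apply/is_c4P; exists a, b, c, d; split=> //.
  case/c4_atP: c4 => -[u m] na nb' nc nd; apply/c4_atP; split.
  - by split=> //; apply/allP=> w /(allP m)/setDP[].
  - by rewrite nE ?inE ?eqxx.
  - by rewrite nE ?inE ?eqxx ?orbT.
  - by rewrite nE ?inE ?eqxx ?orbT.
  - by rewrite nE ?inE ?eqxx ?orbT.
case/is_d5P=> s [a [b [c [d [d5 _]]]]] _; exfalso; move: d5.
case/and5P=> u m /eqP ns /eqP na /and3P[/eqP nb' /eqP nc _].
have edge x y : y \in nb (S :\: I) x -> e x y by rewrite inE => /andP[].
have mS : all (mem S) [:: s; a; b; c; d].
  by apply/allP=> w /(allP m)/setDP[].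
apply: (negP (facts_d5 F mS u)); apply/and5P; split.
- by apply: edge; rewrite ns !inE eqxx.
- by apply: edge; rewrite ns !inE eqxx orbT.
- by apply: edge; rewrite na !inE eqxx orbT.
- by apply: edge; rewrite na !inE eqxx orbT.
apply/and3P; split; apply: edge; rewrite ?nb' ?nc !inE eqxx ?orbT //.
Qed.

Lemma anch_lt S I C P f w : located S I C P f -> size C = size P ->
  nb S w :&: I != set0 -> anch C f w < size C.
Proof.
move=> [_ _ IC nI] sCP /set0Pn[u]; rewrite !inE => /andP[/andP[_ ew] uI].
have [i iP ui] := nI u uI; rewrite /anch -{2}(size_iota 0 (size C)) -has_find.
by apply/hasP; exists i; rewrite ?mem_iota ?sCP // -IC // -ui uI ew.
Qed.

(** Symmetry breaking: a rotation brings a minimum of [h] to the front, and a reflection then puts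
    its two neighbours in order. It is applied to [anch]. *)
Lemma c4_labelling (D : {set T}) (h : T -> nat) a b c d : c4_at D a b c d ->
  exists a' b' c' d', [/\ c4_at D a' b' c' d',
    [set a; b; c; d] = [set a'; b'; c'; d'],
    forall w, w \in [:: a; b; c; d] -> h a' <= h w,
    h a' <= h b' <= h d' & h a' <= h c'].
Proof.
have wl x y z w : c4_at D x y z w -> h x <= h y -> h x <= h z -> h x <= h w ->
    exists y' w', [/\ c4_at D x y' z w', [set x; y; z; w] = [set x; y'; z; w'],
      h x <= h y' <= h w' & h x <= h z].
  move=> c4 xy xz xw; case: (leqP (h y) (h w)) => yw; first by exists y, w; rewrite xy.
  exists w, y; split=> //; first exact: c4_at_flip.
    by apply/setP=> u; rewrite !inE; case: (u == x); case: (u == y); case: (u == z); case: (u == w).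
  by rewrite xw ltnW.
move=> c4; have c41 := c4_at_rot c4; have c42 := c4_at_rot c41; have c43 := c4_at_rot c42.
have seE (x y z w : T) : [set x; y; z; w] = [set y; z; w; x].
  by apply/setP=> u; rewrite !inE; case: (u == x); case: (u == y); case: (u == z); case: (u == w).
have all4 m : m <= h a -> m <= h b -> m <= h c -> m <= h d ->
    forall w, w \in [:: a; b; c; d] -> m <= h w.
  by move=> ma mb mc md w; rewrite !inE => /or4P[] /eqP->.
have : [|| (h a <= h b) && (h a <= h c) && (h a <= h d),
   (h b <= h c) && (h b <= h d) && (h b <= h a),
   (h c <= h d) && (h c <= h a) && (h c <= h b)
   | (h d <= h a) && (h d <= h b) && (h d <= h c)] by lia.
case/or4P=> /andP[/andP[m1 m2] m3].
- have [y [w [H E o z]]] := wl _ _ _ _ c4 m1 m2 m3.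
  by exists a, y, c, w; split=> //; apply: all4.
- have [y [w [H E o z]]] := wl _ _ _ _ c41 m1 m2 m3.
  by exists b, y, d, w; split=> //; [rewrite seE | apply: all4].
- have [y [w [H E o z]]] := wl _ _ _ _ c42 m1 m2 m3.
  by exists c, y, a, w; split=> //; [rewrite seE seE | apply: all4].
have [y [w [H E o z]]] := wl _ _ _ _ c43 m1 m2 m3.
by exists d, y, b, w; split=> //; [rewrite seE seE seE | apply: all4].
Qed.

Lemma c4_branches_sound mind t S I C P f N : facts mind t S -> located S I C P f ->
  size C = size P -> N \in bad (S :\: I) -> N \notin bad S ->
  (exists i, [/\ i < size P, least_c4 P C i & N = square (S :\: I) (f i)]) \/
  exists Q g, Q \in c4_branches mind t P C /\ desc S Q g.
Proof.
move=> F L sCP Nb NbS; have [D sC IC nI] := L.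
have [a0 [b0 [c0 [d0 [c40 NE [w0 w0L w0I]]]]]] := new_bad_c4 F Nb NbS.
have [a [b [c [d [c4 NE' aw /andP[ab bd] ac]]]]] := c4_labelling (anch C f) c40.
(* A new cycle has a corner with a neighbour in [I], and [a] has the least anchor of all corners; so
   its anchor is a genuine index. *)
have aC : anch C f a < size C.
  by apply: leq_ltn_trans (aw _ w0L) (anch_lt L sCP w0I).
have /c4_atP[[u m] na nb' nc nd] := c4.
have [mE ed nch] := c4_at_edges c4.
have inS w : w \in [:: a; b; c; d] -> w \in S by move/(allP mE)/setDP=> [].
have t12 : (12 < t) = false.
  apply/negbTE; rewrite -leqNgt.
  apply: leq_trans (facts_c4 F (a := a) (b := b) (c := c) (d := d) _ ed nch) _.
    exact/allP.
  by rewrite (@leq_add _ _ 9 3) ?(@leq_add _ _ 6 3) ?(@leq_add _ _ 3 3) ?deg_le3.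
have NS : N = square (S :\: I) a by rewrite NE NE' (c4_at_square c4).
have nebd : b != d by case/and4P: nch.
(* Shared by the two cases for [a]: a vertex of [P], or the last vertex of [fresh P]. *)
have go P' f' s : located S I C P' f' -> s < size P' -> f' s = a ->
    (forall i, i < size P -> f' i = f i) -> size P <= size P' ->
    P' = (if s < size P then P else fresh P) ->
    s < (size P).+1 ->
    eqn s (size P) || (~~ nth false C s && ~~ in_c4 P C (fun _ _ _ _ => true) s) ->
    exists Q g, Q \in c4_branches mind t P C /\ desc S Q g.
  move=> L' sP' fs ff' PP' P'E sP cond.
  have [|||| Q [g [QB LQ cQ P'Q gf]]] :=
      ring_expansions_sound (F := [::]) (x := b) (y := d) L' sP'.
  - by rewrite fs.
  - by [].
  - by [].
  - by [].
  have gs : g s = a by rewrite gf.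
  have gf0 i : i < size C -> g i = f i.
    by rewrite sCP => iP; rewrite gf ?ff' // (leq_trans iP).
  have anE := anchorE LQ cQ gf0; rewrite gs in anE.
  have sQ : s < size Q by apply: leq_trans P'Q.
  have [|p [q [oE pq]]] := outs_pair LQ cQ _ nebd; first by rewrite gs.
  have [DQ _ _ _] := LQ.
  have [pQ qQ] : p < size Q /\ q < size Q.
    have lt i : i \in outs Q C s -> i < size Q.
      by rewrite (mem_outs LQ) => /andP[/(desc_lt DQ)].
    by split; apply: lt; rewrite oE !inE eqxx ?orbT.
  have nbd : ~~ e b d by case/and4P: nch.
  have npq : memn q (adj Q p) = false.
    rewrite memnE; apply/negP=> /(desc_edge DQ) epq; move: nbd.
    by case: pq epq => -[-> ->]; rewrite 1?e_sym => ->.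
  have [W [w [WB DW]]] : exists W w, (W \in ring_branches mind t Q C s p q
      ++ ring_branches mind t Q C s q p) /\ desc S W w.
    (* [outs] lists the neighbours of [s] in an unknown order, while [ring_branches] assumes the one
       with the smaller anchor first; hence its two calls. *)
    case: pq => -[gp gq].
      have [||| W [w [WB DW]]] := ring_branches_sound (c := c) F LQ gf0 sQ pQ qQ cQ.
      - by rewrite gs gp gq.
      - by rewrite gs gp gq ab bd.
      - by rewrite gs.
      by exists W, w; rewrite mem_cat WB.
    have [||| W [w [WB DW]]] := ring_branches_sound (c := c) F LQ gf0 sQ qQ pQ cQ.
    - by rewrite gs gp gq.
    - by rewrite gs gp gq ab bd.
    - by rewrite gs.
    by exists W, w; rewrite mem_cat WB orbT.
  exists W, w; split=> //; rewrite /c4_branches t12.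
  apply/flatten_mapP; exists s.
    by rewrite mem_filter mem_iota sP andbT orifE andifE cond.
  apply/flatten_mapP; exists Q; first by rewrite -P'E.
  by rewrite anE aC oE npq.
case: (boolP (a \in [seq f i | i <- iota 0 (size P)])) => [/mem_names[i iP ai]|an].
  case: (boolP (in_c4 P C (fun _ _ _ _ => true) i)) => [/in_c4P[j [k [l]]]|ni].
    rewrite andbT => K; have [i' [i'P li' sq]] := least_c4_exists L K.
    by left; exists i'; rewrite sq -ai.
  right; apply: (go P f i) => //; first by rewrite iP.
    exact: ltnW.
  rewrite ni andbT -IC // -ai orbC.
  by have /setDP[_ ->] := allP m a (mem_head _ _).
right; have na' i : i < size P -> f i != a.
  by move=> iP; apply: contraNneq an => <-; apply/mem_names; exists i.
have := located_fresh L (inS a (mem_head _ _)) na'; set g := extend _ _ _ => Lg.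
apply: (go _ _ (size P) Lg); rewrite ?size_rcons //.
- by rewrite /g /extend ltnn subnn.
- by move=> i iP; rewrite /g /extend iP.
- by rewrite ltnn.
by rewrite eqnE eqxx.
Qed.

(** * Soundness of a deletion *)

Definition image_of (P : pgraph) (C : seq bool) (f : nat -> T) : {set T} :=
  [set w in [seq f i | i <- [seq i <- iota 0 (size P) | nth false C i]]].

Lemma image_ofP P C f w : reflect
  (exists2 i, (i < size P) && nth false C i & w = f i) (w \in image_of P C f).
Proof.
rewrite inE; apply: (iffP mapP) => [[i]|[i /andP[iP Ci] ->]].
  by rewrite mem_filter mem_iota => /andP[Ci iP] ->; exists i => //; rewrite Ci andbT.
by exists i => //; rewrite mem_filter mem_iota Ci.
Qed.

Lemma located_image S P C f : desc S P f -> size C = size P ->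
  located S (image_of P C f) C P f.
Proof.
move=> D sC; split=> //; first by rewrite sC.
  move=> i iP; apply/image_ofP/idP => [[j /andP[jP Cj] E]|Ci]; last by exists i; rewrite ?iP.
  by rewrite (desc_inj D iP jP E).
by move=> w /image_ofP[i /andP[iP _] ->]; exists i.
Qed.

Lemma covered_move (f : nat -> T) (X : balls) (A : {set T}) :
  (forall w, w \in A -> exists2 x, x \in X & near (if x.2 then 2 else 1) w (f x.1)) ->
  covered A (price X).
Proof.
elim: X A => [|x X IHX] A AX.
  have -> : A = set0 by apply/setP=> w; rewrite inE; apply/negP=> /AX[].
  exact: covered0.
set B := [set w | near (if x.2 then 2 else 1) w (f x.1)].
apply: (@covered_sub _ (B :|: (A :\: B)) _ _ _ (leqnn _)).
  by apply/subsetP=> w wA; rewrite !inE wA; case: near.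
rewrite /price /=; apply: coveredU; first by apply: covered_ball; case: x.2.
apply: IHX => w; rewrite !inE => /andP[nB /AX[y]].
by rewrite inE => /predU1P[-> nw|yX nw]; [rewrite nw in nB | exists y].
Qed.

(** Listed edges are edges of the graph, so what the partial graph sees of a ball lies in the true
    ball. Only the visible part is deleted, at the full price. *)
Lemma covered_image S P f X : desc S P f -> covered (image_of P (cover P X) f) (price X).
Proof.
move=> D; apply: (covered_move (f := f)) => w /image_ofP[i /andP[iP]].
rewrite /cover (nth_map 0) ?size_iota // nth_iota // memnE add0n.
case/flatten_mapP=> x xX iX ->; exists x => //.
have sub1 u v : near 1 u v -> near (if x.2 then 2 else 1) u v.
  by case: x.2 => //; apply: near_le.
move: iX; rewrite inE mem_cat => /or3P[/eqP->|iA|].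
- by apply: sub1; rewrite /= eqxx.
- by apply: sub1; rewrite /= e_sym (desc_edge D iA) orbT.
case: x.2 => // /flatten_mapP[j jA iA]; apply/or3P; apply: Or33.
by apply/existsP; exists (f j); rewrite !(e_sym _ (f j)) (desc_edge D iA) e_sym (desc_edge D jA).
Qed.

(** The worst case is that every neighbour of [c] that may still be missing exists and lies outside
    [I]; it then counts in both degrees. *)
Lemma loss_bound S I C P f c : located S I C P f -> c < size P ->
  I \subset S ->
  deg S (f c) + deg (S :\: I) (f c) <=
  maxdeg P c + (maxdeg P c - size (adj P c)) + size (outs P C c).
Proof.
move=> L cP IS; have [D sC IC nI] := L.
have degI : size (adj P c) <= deg I (f c) + size (outs P C c).
  have /= := count_predC (nth false C) (adj P c); rewrite -!size_filter => <-.
  rewrite leq_add2r -(size_map f).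
  have u : uniq [seq f i | i <- [seq i <- adj P c | nth false C i]].
    apply: subseq_uniq (desc_map_uniq D c); apply: map_subseq; exact: filter_subseq.
  rewrite -(card_uniqP u); apply: subset_leq_card; apply/subsetP=> w.
  case/mapP=> i; rewrite mem_filter => /andP[Ci iA] ->.
  by rewrite inE IC ?(desc_lt D iA) // Ci (desc_edge D iA).
have := deg_le_maxdeg D c; have := degD (f c) IS; have := size_adj_maxdeg D cP.
by move: degI; lia.
Qed.

(** A new exceptional component that is not visible in [P] leads into one of the branches. If all of
    them are visible, the counts in [profitable] bound their number and [phi_setD] yields the
    gain. *)
Lemma delete_sound mind t S P f X : facts mind t S -> desc S P f ->
  profitable P X (cover P X) ->
  (forall Q g, Q \in iso_branches mind t P (cover P X) ++ c4_branches mind t P (cover P X) ->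
    desc S Q g -> reducible S) ->
  reducible S.
Proof.
move=> F D pr br; set C := cover P X in pr br.
have sC : size C = size P by rewrite /C size_map size_iota.
set I := image_of P C f; have L : located S I C P f := located_image D sC.
have IS : I \subset S.
  by apply/subsetP=> w /image_ofP[i /andP[iP _] ->]; apply: (desc_in D).
set Iso := isolated (S :\: I) :\: isolated S.
set Bad := bad (S :\: I) :\: bad S.
case: (boolP [exists w in Iso, ~~ has (fun i => iso_known P C i && (f i == w))
    (iota 0 (size P))]) => [/exists_inP[w]|isoK].
  rewrite inE => /andP[wS]; rewrite inE => /andP[wD /eqP w0] nk.
  have nwI : nb S w \subset I.
    apply/subsetP=> u uw; apply: contraT => uI.
    have : u \in nb (S :\: I) w by case/setIdP: uw => uS wu; apply/setIdP; split=> //; apply/setDP.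
    by rewrite w0 in_set0.
  have nw0 : nb S w != set0.
    by apply: contra wS => w1; rewrite inE w1 andbT; case/setDP: wD.
  case: (iso_branches_sound F L sC wD nwI nw0) => [[i [iP ik wi]]|[Q [g [QB DQ]]]].
    by case/negP: nk; apply/hasP; exists i; rewrite ?mem_iota // ik wi eqxx.
  by apply: (br Q g) DQ; rewrite mem_cat QB.
case: (boolP [exists N in Bad, ~~ has (fun i => least_c4 P C i &&
    (square (S :\: I) (f i) == N)) (iota 0 (size P))]) => [/exists_inP[N]|badK].
  rewrite inE => /andP[NS NB] nk.
  case: (c4_branches_sound F L sC NB NS) => [[i [iP ik Ni]]|[Q [g [QB DQ]]]].
    by case/negP: nk; apply/hasP; exists i; rewrite ?mem_iota // ik Ni eqxx.
  by apply: (br Q g) DQ; rewrite mem_cat QB orbT.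
(* The indices selected by [p] map onto a set that contains [A]. *)
have cardK (U : finType) (A : {set U}) (p : pred nat) (h : nat -> U) :
    ~~ [exists w in A, ~~ has (fun i => p i && (h i == w)) (iota 0 (size P))] ->
    #|A| <= count p (iota 0 (size P)).
  rewrite negb_exists_in => /forall_inP Ap; rewrite -size_filter -(size_map h).
  apply: leq_trans (card_size _); apply: subset_leq_card; apply/subsetP=> w.
  case/Ap; rewrite negbK => /hasP[i iP /andP[pi /eqP <-]].
  by apply: map_f; rewrite mem_filter pi.
have isoN := cardK _ _ _ _ isoK; have badN := cardK _ _ _ _ badK.
move: pr; rewrite /profitable andifE => /andP[X0].
set Cs := [seq i <- iota 0 (size P) | nth false C i].
have IE : #|I| = size Cs.
  rewrite /I /image_of cardsE -(size_map f); apply/card_uniqP.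
  rewrite map_inj_in_uniq ?filter_uniq ?iota_uniq // => i j.
  rewrite !mem_filter !mem_iota => /andP[_ iP] /andP[_ jP].
  exact: (desc_inj D).
set loss := sumn _ => pr.
have lossE : \sum_(w in I) (deg S w + deg (S :\: I) w) <= loss.
  have -> : \sum_(w in I) (deg S w + deg (S :\: I) w) =
      \sum_(w <- [seq f i | i <- Cs]) (deg S w + deg (S :\: I) w).
    rewrite big_uniq; last first.
      rewrite map_inj_in_uniq ?filter_uniq ?iota_uniq // => i j.
      rewrite !mem_filter !mem_iota => /andP[_ iP] /andP[_ jP].
      exact: (desc_inj D).
    by apply: eq_bigl => w; rewrite inE.
  rewrite big_map /loss sumnE big_map big_seq [leqRHS]big_seq.
  apply: leq_sum => i; rewrite mem_filter mem_iota => /andP[_ iP].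
  exact: loss_bound.
exists I, (price X); split=> //.
- have arith p l i b c : 0 < p -> 9 * p + l + 3 * i + 2 * b <= 6 * c -> 0 < c by lia.
  by rewrite -card_gt0 IE; apply: arith X0 pr.
- exact: (covered_image X D).
have arith x y p l l' i i' b b' c : 9 * p + l + 3 * i + 2 * b <= 6 * c -> l' <= l ->
  i' <= i -> b' <= b -> x + 6 * c <= y + l' + 3 * i' + 2 * b' -> x + 9 * p <= y by lia.
by apply: arith pr lossE isoN badN _; rewrite -IE; apply: phi_setD.
Qed.

(** * Soundness of proof trees *)

Lemma branches_sound mind t S P f r s : facts mind t S -> desc S P f ->
  branches mind t P r = Some s ->
  (forall Q g, Q \in s -> desc S Q g -> reducible S) -> reducible S.
Proof.
move=> F D; case: r => [X|v] /=.
  by case: ifP => // pr [<-]; exact: (delete_sound F D pr).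
case: ifP => // vP [<-] H; have [Q [g [QE DQ]]] := expansions_sound F D vP.
exact: H QE DQ.
Qed.

Lemma closes_sound mind t S P f X : facts mind t S -> desc S P f ->
  closes mind t P X -> reducible S.
Proof.
move=> F D; rewrite /closes !andifE => /andP[/andP[pr /nilP i0] /nilP c0].
by apply: (delete_sound F D pr) => Q g; rewrite i0 c0.
Qed.

(** Nothing is assumed about the certificate. The outer induction is on the fuel and the inner one
    on the children of a node; a child that fails turns the rest of the fold into [None]. *)
Lemma check_sound mind t n w P w' S f : facts mind t S ->
  check mind t n w P = Some w' -> desc S P f -> reducible S.
Proof.
move=> F; elim: n w P w' f => [|n IHn] //= [|[r H] w] P w' f //.
case E : branches => [s|] // fl D; apply: (branches_sound F D E) => Q g.
elim: s (w) fl {E} => //= Q0 s IHs w0; rewrite hasbE inE.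
case: ifP => [/hasP[X _ cl] fl|_ fl] /predU1P[->|Qs].
- by move/closes_sound; apply; eassumption.
- exact: IHs fl Qs.
- case E : check fl => [w1|] fl.
    by apply: IHn E.
  by move: fl; elim: (s) => //=.
case E : check fl => [w1|] fl; first exact: IHs fl Qs.
by move: fl; elim: (s) => //=.
Qed.

(** * Exceptional components *)

Lemma one_of_three x y z : x = y + z -> x <= 3 -> 1 < y -> 0 < z -> z = 1.
Proof. by lia. Qed.

Lemma gain_nine x y z : x <= 14 -> y + 6 * 4 <= z + x -> y + 9 * 1 <= z.
Proof. by lia. Qed.

Lemma bad_transfer (D S N : {set T}) : D \subset S ->
  (forall w, w \in N -> nb S w = nb D w) -> N \in bad D -> N \in bad S.
Proof.
move=> DS nE /badP[/is_c4P[a [b [c [d [c4 NE]]]]]|/is_d5P[s [a [b [c [d [d5 NE]]]]]]];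
  apply/badP; [left | right]; subst N.
  apply/is_c4P; exists a, b, c, d; split=> //; move: c4.
  rewrite /c4_at !nE ?inE ?eqxx ?orbT // => /and3P[-> m ->]; rewrite andbT.
  by apply/allP=> w /(allP m)/(subsetP DS).
apply/is_d5P; exists s, a, b, c, d; split=> //; move: d5.
rewrite /d5_at !nE ?inE ?eqxx ?orbT // => /and3P[-> m ->]; rewrite andbT.
by apply/allP=> w /(allP m)/(subsetP DS).
Qed.

Lemma cards3 (x y z : T) : uniq [:: x; y; z] -> #|[set x; y; z]| = 3.
Proof.
move=> u; rewrite -[3]/(size [:: x; y; z]) -(card_uniqP u).
by apply: eq_card => w; rewrite !inE orbA.
Qed.

(** In particular, a vertex that keeps only one neighbour cannot lie in a bad component;
    [d5_reducible] relies on this. *)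
Lemma bad_deg2 (S N : {set T}) w : N \in bad S -> w \in N -> w \in S /\ 2 <= deg S w.
Proof.
case/badP=> [/is_c4P[a [b [c [d [/c4_atP[[u m] na nb' nc nd] ->]]]]]|].
  move: u; rewrite /= !inE !negb_or !andbT => /and3P[/and3P[_ ac _] /andP[_ bd] _].
  move=> wN; split; first by apply: (allP m); rewrite !inE !orbA.
  by case/orP: wN => [/orP[/orP[]|]|] /eqP->;
     rewrite /deg ?na ?nb' ?nc ?nd cards2 ?ac ?bd.
case/is_d5P=> s [a [b [c [d [/and5P[u m /eqP ns /eqP na /and3P[/eqP nb' /eqP nc /eqP nd]] ->]]]]].
move=> wN; split; first by apply: (allP m); move: wN; rewrite !inE !orbA.
move: u; rewrite /= !inE !negb_or !andbT.
move=> /and4P[/and4P[sa sb sc sd] /and3P[ab ac ad] /andP[bc bd] cd].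
move: wN; rewrite !inE => /orP[/orP[/orP[/orP[]|]|]|] /eqP->;
  rewrite /deg ?ns ?na ?nb' ?nc ?nd ?cards2 ?ab //;
  by rewrite cards3 //= !inE negb_or ?sc ?sd ?cd ?ab ?ad ?bd ?ac ?bc.
Qed.

(** No edge leaves [Q], so its deletion changes no other neighbourhood and [phi] splits. The bonuses
    of [Q] itself thus become available to pay for its cover. *)
Lemma phi_component (S Q : {set T}) : Q \subset S -> Q != set0 ->
  (forall q, q \in Q -> nb S q \subset Q) ->
  phi (S :\: Q) + \sum_(q in Q) (6 - deg S q) + 3 * #|isolated S :&: Q|
    + 2 * (Q \in bad S) <= phi S.
Proof.
move=> QS Q0 QC; set D := S :\: Q.
have nE w : w \in D -> nb S w = nb D w.
  case/setDP=> wS wQ; apply/setP=> u; apply/setIdP/setIdP=> -[uS wu]; split=> //.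
    apply/setDP; split=> //; apply: contra wQ => uQ.
    by apply: (subsetP (QC u uQ)); apply/setIdP; rewrite e_sym.
  by case/setDP: uS.
have isoE : #|isolated S| = #|isolated S :&: Q| + #|isolated D|.
  rewrite -(cardsID Q (isolated S)); congr (_ + _); apply: eq_card => w.
  apply/setDP/setIdP=> [[/setIdP[wS w0] wQ]|[wD w0]].
    by have wD : w \in D := introT setDP (conj wS wQ); rewrite -nE.
  by have /setDP[wS wQ] := wD; split=> //; apply/setIdP; rewrite nE.
have badE : #|bad D| + (Q \in bad S) <= #|bad S|.
  have bDS : bad D \subset bad S.
    apply/subsetP=> N NB; apply: (bad_transfer _ _ NB); first exact: subsetDl.
    by move=> w wN; apply: nE; case: (bad_deg2 NB wN).
  case: (boolP (Q \in bad S)) => QB; last by rewrite addn0 subset_leq_card.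
  have badQ := cardsD1 Q (bad S); rewrite QB in badQ.
  have arith x y z : y = true + z -> x <= z -> x + true <= y by move=> -> xz; rewrite addnC leq_add2l.
  apply: (arith _ _ _ badQ); apply: subset_leq_card.
  apply/subsetP=> N NB; apply/setD1P; split; last exact: (subsetP bDS).
  have /set0Pn[q qQ] := Q0; apply/eqP=> NQ; have qN : q \in N by rewrite NQ.
  by have [/setDP[_]] := bad_deg2 NB qN; rewrite qQ.
have sumE : \sum_(v in S) (6 - deg S v) =
    \sum_(q in Q) (6 - deg S q) + \sum_(v in D) (6 - deg D v).
  rewrite (big_setID Q) /= (setIidPr QS); congr (_ + _).
  by apply: eq_bigr => w wD; rewrite /deg nE.
by rewrite /phi sumE isoE; move: badE; lia.
Qed.

Lemma component_reducible (S Q : {set T}) k : Q \subset S -> Q != set0 ->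
  (forall q, q \in Q -> nb S q \subset Q) -> covered Q k ->
  9 * k <= \sum_(q in Q) (6 - deg S q) + 3 * #|isolated S :&: Q| + 2 * (Q \in bad S) ->
  reducible S.
Proof.
move=> QS Q0 QC Qk kQ; exists Q, k; split=> //.
by have := phi_component QS Q0 QC; move: kQ; lia.
Qed.

Lemma isolated_reducible (S : {set T}) v : v \in isolated S -> reducible S.
Proof.
move=> vI; have /setIdP[vS /eqP v0] := vI.
apply: (@component_reducible S [set v] 1).
- by rewrite sub1set.
- by apply/set0Pn; exists v; rewrite set11.
- by move=> q /set1P->; rewrite v0 sub0set.
- apply: covered_sub (leqnn _) (covered_ball v (r := 1) isT).
  by apply/subsetP=> w /set1P->; rewrite inE /= eqxx.
have -> : isolated S :&: [set v] = [set v] by apply/setIidPr; rewrite sub1set.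
by rewrite big_set1 /deg v0 cards0 cards1; lia.
Qed.

Lemma c4_reducible (S : {set T}) a b c d : c4_at S a b c d -> reducible S.
Proof.
move=> c4; have /c4_atP[[u m] na nb' nc nd] := c4.
have [_ /and4P[eab ebc _ eda] _] := c4_at_edges c4.
move: (u); rewrite /= !inE !negb_or !andbT.
move=> /and3P[/and3P[ab ac ad] /andP[bc bd] cd].
apply: (@component_reducible S [set a; b; c; d] 2).
- by apply/subsetP=> w wN; apply: (allP m); move: wN; rewrite !inE !orbA.
- by apply/set0Pn; exists a; rewrite !inE eqxx.
- move=> q; rewrite !inE => /orP[/orP[/orP[]|]|] /eqP->;
    by rewrite ?na ?nb' ?nc ?nd; apply/subsetP=> w /set2P[]->; rewrite !inE eqxx ?orbT.
- apply: covered_sub (leqnn _) (covered_ball a (r := 2) isT).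
  apply/subsetP=> w; rewrite !inE /= => /orP[/orP[/orP[]|]|] /eqP->.
  + by rewrite eqxx.
  + by rewrite e_sym eab orbT.
  + by apply/or3P; apply: Or33; apply/existsP; exists b; rewrite e_sym ebc e_sym eab.
  + by rewrite eda orbT.
have -> : [set a; b; c; d] \in bad S.
  by apply/badP; left; apply/is_c4P; exists a, b, c, d.
have -> : \sum_(q in [set a; b; c; d]) (6 - deg S q) = 16.
  rewrite (eq_bigl (mem [:: a; b; c; d])) => [|w]; last by rewrite !inE !orbA.
  by rewrite -big_uniq //= !big_cons big_nil /deg na nb' nc nd !cards2 ac bd.
by rewrite addnAC; apply: leq_addr.
Qed.

(** If [s] has no third neighbour, the five vertices form a bad component with value 16 + 2, which
    pays for the ball of radius 2 around [s]. Otherwise the other four vertices are the ball of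
    radius 1 around [c]. They meet 7 edges, so their deletion gains 24 - 14 = 10. It leaves [s] with
    degree 1 and changes no other neighbourhood, hence creates neither an isolated vertex nor a bad
    component. *)
Lemma d5_reducible (S : {set T}) s a b c d : all (mem S) [:: s; a; b; c; d] ->
  uniq [:: s; a; b; c; d] ->
  [&& e s a, e s b, e a c, e a d, e b c, e b d & e c d] -> reducible S.
Proof.
move=> m u /and5P[esa esb eac ead /and3P[ebc ebd ecd]].
have /and5P[sS aS bS cS /andP[dS _]] := m.
move: (u); rewrite /= !inE !negb_or !andbT.
move=> /and4P[/and4P[sa sb sc sd] /and3P[ab ac ad] /andP[bc bd] cd].
have nb3 x y z w : y \in S -> z \in S -> w \in S -> uniq [:: y; z; w] ->
    [&& e x y, e x z & e x w] -> nb S x = [set y; z; w].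
  move=> yS zS wS uyzw /and3P[xy xz xw]; apply/esym/eqP; rewrite eqEcard cards3 //.
  rewrite -/(deg S x) deg_le3 andbT; apply/subsetP=> v.
  by rewrite !inE => /orP[/orP[]|] /eqP->; rewrite ?yS ?zS ?wS.
have na : nb S a = [set s; c; d].
  by apply: nb3 => //=; rewrite ?inE ?negb_or ?sc ?sd ?cd // e_sym esa eac ead.
have nb' : nb S b = [set s; c; d].
  by apply: nb3 => //=; rewrite ?inE ?negb_or ?sc ?sd ?cd // e_sym esb ebc ebd.
have nc : nb S c = [set a; b; d].
  by apply: nb3 => //=; rewrite ?inE ?negb_or ?ab ?ad ?bd // !(e_sym c) eac ebc e_sym ecd.
have nd : nb S d = [set a; b; c].
  by apply: nb3 => //=; rewrite ?inE ?negb_or ?ab ?ac ?bc // !(e_sym d) ead ebd ecd.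
have deg3 x : x \in [:: a; b; c; d] -> deg S x = 3.
  rewrite /deg !inE => /or4P[] /eqP->; rewrite ?na ?nb' ?nc ?nd cards3 //=;
    by rewrite ?inE ?negb_or ?sc ?sd ?cd ?ab ?ad ?bd ?ac ?bc.
case: (eqVneq (nb S s) [set a; b]) => [ns|nsx].
  have d5 : d5_at S s a b c d by rewrite /d5_at ns na nb' nc nd !eqxx m u.
  apply: (@component_reducible S [set s; a; b; c; d] 2).
  - by apply/subsetP=> w wN; apply: (allP m); move: wN; rewrite !inE !orbA.
  - by apply/set0Pn; exists a; rewrite !inE eqxx orbT.
  - move=> q; rewrite !inE => /orP[/orP[/orP[/orP[]|]|]|] /eqP->;
      rewrite ?ns ?na ?nb' ?nc ?nd; apply/subsetP=> w; rewrite !inE;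
      by do ?[case/orP]; move=> ->; rewrite ?orbT.
  - apply: covered_sub (leqnn _) (covered_ball s (r := 2) isT).
    apply/subsetP=> w; rewrite !inE /= => /orP[/orP[/orP[/orP[]|]|]|] /eqP->.
    + by rewrite eqxx.
    + by rewrite e_sym esa orbT.
    + by rewrite e_sym esb orbT.
    + by apply/or3P; apply: Or33; apply/existsP; exists a; rewrite e_sym eac e_sym esa.
    + by apply/or3P; apply: Or33; apply/existsP; exists a; rewrite e_sym ead e_sym esa.
  have -> : [set s; a; b; c; d] \in bad S.
    by apply/badP; right; apply/is_d5P; exists s, a, b, c, d.
  have -> : \sum_(q in [set s; a; b; c; d]) (6 - deg S q) = 16.
    rewrite (eq_bigl (mem [:: s; a; b; c; d])) => [|w]; last by rewrite !inE !orbA.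
    rewrite -big_uniq //= !big_cons big_nil (deg3 a) ?(deg3 b) ?(deg3 c) ?(deg3 d);
      rewrite ?inE ?eqxx ?orbT //.
    by rewrite /deg ns cards2 ab.
  by rewrite addnAC; apply: leq_addr.
have [p ps] : exists p, p \in nb S s :\: [set a; b].
  apply/set0Pn; apply: contraNneq nsx => /eqP; rewrite setD_eq0 => sub.
  rewrite eqEsubset sub; apply/subsetP=> w /set2P[]->; apply/setIdP; by split.
have /setDP[/setIdP[pS esp] pab] := ps.
set C := [set a; b; c; d].
have CS : C \subset S by apply/subsetP=> w; rewrite !inE => /orP[/orP[/orP[]|]|] /eqP->.
have notin_nb x y : x \in S -> x \notin nb S y -> ~~ e x y.
  by move=> xS; rewrite inE xS e_sym.
have pC : p \notin C.
  rewrite !inE !negb_or; move: pab; rewrite !inE negb_or => ->.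
  apply/andP; split; apply: contraTneq esp => ->; apply: notin_nb => //.
    by rewrite nc !inE !negb_or sa sb sd.
  by rewrite nd !inE !negb_or sa sb sc.
set D := S :\: C.
have nbC x : x \in C -> nb S x \subset s |: C.
  rewrite [x \in _]inE => xC; have : x \in [:: a; b; c; d] by move: xC; rewrite !inE !orbA.
  rewrite !inE => /or4P[] /eqP->; rewrite ?na ?nb' ?nc ?nd !subUset !sub1set;
    by rewrite !inE !eqxx ?orbT.
have only_s w x : w \in D -> x \in C -> e w x -> w = s.
  case/setDP=> wS wC xC wx.
  have wx' : w \in nb S x by apply/setIdP; rewrite e_sym.
  by have /setU1P[|wC'] := subsetP (nbC x xC) w wx'; last by rewrite wC' in wC.
have sC : s \notin C by rewrite !inE !negb_or sa sb sc sd.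
have nD w : w \in D -> w != s -> nb S w = nb D w.
  move=> wD ws; apply/setP=> z; apply/setIdP/setIdP=> -[zS wz]; split=> //.
    apply/setDP; split=> //; apply: contra ws => zC.
    by apply/eqP; apply: only_s zC wz.
  by case/setDP: zS.
have pD : p \in nb D s by apply/setIdP; split=> //; apply/setDP.
have degDs : deg D s = 1.
  have sub : [set a; b] \subset nb S s :&: C.
    apply/subsetP=> w /set2P[]->; apply/setIP; split; try (by apply/setIdP);
      by rewrite !inE eqxx ?orbT.
  have C2 : 1 < deg C s.
    have -> : deg C s = #|nb S s :&: C|.
      apply: eq_card => w; apply/setIdP/setIP=> [[wC sw]|[/setIdP[_ sw] wC]] //.
      by split=> //; apply/setIdP; split=> //; apply: (subsetP CS).
    by have := subset_leq_card sub; rewrite cards2 ab.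
  have D1 : 0 < deg D s by rewrite card_gt0; apply/set0Pn; exists p.
  exact: one_of_three (degD s CS) (deg_le3 S s) C2 D1.
have iso0 : #|isolated D :\: isolated S| = 0.
  apply: eq_card0 => w; apply/negP=> /setDP[/setIdP[wD /eqP w0] /setIdP[]].
  case: (eqVneq w s) => [ws|ws]; first by move: pD; rewrite -ws w0 in_set0.
  by split; [case/setDP: wD | rewrite nD ?w0].
have bad0 : #|bad D :\: bad S| = 0.
  apply: eq_card0 => N; apply/negP=> /setDP[NB /negP[]].
  apply: (bad_transfer _ _ NB); first exact: subsetDl.
  move=> w wN; have [wD w2] := bad_deg2 NB wN; apply: nD => //.
  by apply: contraTneq w2 => ->; rewrite degDs.
exists C, 1; split=> //.
- by apply/set0Pn; exists a; rewrite !inE eqxx.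
- apply: covered_sub (leqnn _) (covered_ball c (r := 1) isT).
  apply/subsetP=> w; rewrite !inE /= => /orP[/orP[/orP[]|]|] /eqP->.
  + by rewrite eac orbT.
  + by rewrite ebc orbT.
  + by rewrite eqxx.
  + by rewrite e_sym ecd orbT.
have := phi_setD CS; rewrite -/D iso0 bad0 !muln0 !addn0.
have cC : #|C| = 4.
  have u4 : uniq [:: a; b; c; d] by case/andP: u.
  rewrite -[4]/(size [:: a; b; c; d]) -(card_uniqP u4).
  by apply: eq_card => w; rewrite !inE !orbA.
(* Degree 3 at all four vertices, and at most one edge from each of [a] and [b] to [s]. *)
have sumC : \sum_(v in C) (deg S v + deg D v) <= 14.
  rewrite (eq_bigl (mem [:: a; b; c; d])) => [|w]; last by rewrite !inE !orbA.
  have u4 : uniq [:: a; b; c; d] by case/andP: u.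
  rewrite -big_uniq //= !big_cons big_nil.
  rewrite (deg3 a) ?(deg3 b) ?(deg3 c) ?(deg3 d); rewrite ?inE ?eqxx ?orbT //.
  have degD1 x : nb D x \subset [set s] -> deg D x <= 1.
    by move/subset_leq_card; rewrite cards1.
  have degD0 x : nb D x \subset set0 -> deg D x = 0.
    by rewrite subset0 => /eqP x0; rewrite /deg x0 cards0.
  have sub_s x : x \in C -> nb D x \subset [set s].
    move=> xC; apply/subsetP=> w /setIdP[wD xw]; apply/set1P.
    by apply: (only_s w x) => //; rewrite e_sym.
  have nos x : s \notin nb S x -> x \in C -> nb D x \subset set0.
    move=> sx xC; apply/subsetP=> w wD; have /set1P ws := subsetP (sub_s x xC) w wD.
    case/negP: sx; rewrite -ws; case/setIdP: wD => /setDP[wS _] xw.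
    by apply/setIdP.
  have da : deg D a <= 1 by apply/degD1/sub_s; rewrite !inE eqxx.
  have db : deg D b <= 1 by apply/degD1/sub_s; rewrite !inE eqxx ?orbT.
  have dc : deg D c = 0.
    by apply/degD0/nos; rewrite ?nc !inE ?eqxx ?orbT // !negb_or sa sb sd.
  have dd : deg D d = 0.
    by apply/degD0/nos; rewrite ?nd !inE ?eqxx ?orbT // !negb_or sa sb sc.
  rewrite dc dd.
  exact: (leq_add (leq_add (leqnn 3) da) (leq_add (leq_add (leqnn 3) db) (leqnn 6))).
by rewrite cC; apply: gain_nine sumC.
Qed.

(** * Certificates and conclusion *)

Definition leaf_root : pgraph := [:: ([:: 1], true); ([:: 0], false)].

(** A set flag gives a corner degree 2, and for the others the bound [t] of the stage forces degree
    3. A partial graph cannot record that two open vertices are not adjacent, so the certificates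
    have to deal with a chord between open corners as well. *)
Definition c4_root (x0 x1 x2 x3 : bool) : pgraph :=
  [:: ([:: 1; 3], x0); ([:: 0; 2], x1); ([:: 1; 3], x2); ([:: 2; 0], x3)].

Definition point_root : pgraph := [:: ([::], false)].

(** A vertex of degree 1, when there are no isolated vertices and no induced 4-cycles of degree sum
    8. *)
Definition cert_leaf : cert := [::
(Expand 1, [:: [:: (0, false)]]); (Delete [:: (1, false)], [:: [:: (2, true)]; [:: (6, false)]]); (Expand 2,
[:: [:: (1, false)]]); (Delete [:: (1, true)], [:: [:: (4, true)]; [:: (8, false)]]); (Delete [:: (2, true)],
[:: [:: (2, true)]]); (Delete [:: (1, false)], [:: [:: (7, false)]; [:: (1, true)]; [:: (4, false)]; [:: (5,
false)]; [:: (6, false)]]); (Expand 3, [::]); (Delete [:: (1, false)], [:: [:: (2, true)]; [:: (8, false)]]);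
(Delete [:: (1, true)], [:: [:: (1, true)]]); (Delete [:: (1, true)], [:: [:: (9, false)]; [:: (1, false); (5,
true)]; [:: (6, false)]; [:: (7, false)]; [:: (8, false)]]); (Delete [:: (3, true)], [:: [:: (2, true)]; [::
(10, false)]; [:: (5, false)]; [:: (5, true)]; [:: (5, false); (8, false)]; [:: (5, false); (9, false)]]);
(Delete [:: (1, true)], [:: [:: (8, true)]; [:: (2, false)]; [:: (5, false)]]); (Delete [:: (1, true)], [::
[:: (5, true)]; [:: (7, true)]; [:: (2, false)]; [:: (10, false)]; [:: (2, false); (10, false)]]); (Delete [::
(1, true)], [:: [:: (8, true)]; [:: (2, false)]; [:: (5, false)]]); (Delete [:: (1, true)], [:: [:: (7,
true)]; [:: (1, true)]; [:: (2, false)]; [:: (5, false)]]); (Delete [:: (5, true)], [:: [:: (1, true)]]);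
(Delete [:: (5, true)], [:: [:: (1, true)]]); (Delete [:: (5, true)], [:: [:: (1, true)]]); (Delete [:: (5,
true)], [:: [:: (1, true)]]); (Delete [:: (6, false)], [:: [:: (2, true)]]); (Delete [:: (2, true)], [:: [::
(2, true)]]); (Delete [:: (8, false); (3, true)], [:: [:: (13, false)]; [:: (1, true)]; [:: (2, false); (9,
false)]; [:: (5, false); (8, false)]]); (Delete [:: (2, true)], [:: [:: (1, true)]]); (Delete [:: (5, true)],
[:: [:: (1, false)]]); (Delete [:: (2, true)], [:: [:: (1, true)]]); (Delete [:: (6, false)], [:: [:: (2,
true)]]); (Delete [:: (2, true)], [:: [:: (2, true)]]); (Delete [:: (7, false); (3, true)], [:: [:: (13,
false)]; [:: (1, true)]; [:: (2, false); (9, false)]; [:: (5, false); (7, false)]]); (Delete [:: (2, true)],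
[:: [:: (1, true)]]); (Delete [:: (5, true)], [:: [:: (1, false)]]); (Delete [:: (2, true)], [:: [:: (1,
true)]]); (Delete [:: (1, false)], [:: [:: (1, true)]]); (Expand 2, [::]); (Delete [:: (1, false)], [:: [::
(3, true)]; [:: (8, false)]]); (Delete [:: (1, true)], [:: [:: (1, true)]]); (Delete [:: (1, true)], [:: [::
(9, false)]; [:: (1, false); (5, true)]; [:: (6, false)]; [:: (7, false)]; [:: (8, false)]]); (Delete [:: (2,
true)], [:: [:: (3, true)]; [:: (10, false)]; [:: (5, false)]; [:: (5, true)]; [:: (5, false); (8, false)];
[:: (5, false); (9, false)]]); (Delete [:: (1, true)], [:: [:: (8, true)]; [:: (3, false)]; [:: (5, false)]]);
(Delete [:: (1, true)], [:: [:: (5, true)]; [:: (7, true)]; [:: (3, false)]; [:: (10, false)]; [:: (3, false);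
(10, false)]]); (Delete [:: (1, true)], [:: [:: (8, true)]; [:: (3, false)]; [:: (5, false)]]); (Delete [::
(1, true)], [:: [:: (7, true)]; [:: (1, true)]; [:: (3, false)]; [:: (5, false)]]); (Delete [:: (5, true)],
[:: [:: (1, true)]]); (Delete [:: (5, true)], [:: [:: (1, true)]]); (Delete [:: (5, true)], [:: [:: (1,
true)]]); (Delete [:: (5, true)], [:: [:: (1, true)]]); (Delete [:: (6, false)], [:: [:: (3, true)]]); (Delete
[:: (3, true)], [:: [:: (2, true)]]); (Delete [:: (8, false); (2, true)], [:: [:: (13, false)]; [:: (1,
true)]; [:: (3, false); (9, false)]; [:: (5, false); (8, false)]]); (Delete [:: (3, true)], [:: [:: (1,
true)]]); (Delete [:: (5, true)], [:: [:: (1, false)]]); (Delete [:: (3, true)], [:: [:: (1, true)]]); (Delete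
[:: (6, false)], [:: [:: (3, true)]]); (Delete [:: (3, true)], [:: [:: (2, true)]]); (Delete [:: (7, false);
(2, true)], [:: [:: (13, false)]; [:: (1, true)]; [:: (3, false); (9, false)]; [:: (5, false); (7, false)]]);
(Delete [:: (3, true)], [:: [:: (1, true)]]); (Delete [:: (5, true)], [:: [:: (1, false)]]); (Delete [:: (3,
true)], [:: [:: (1, true)]]); (Delete [:: (1, false)], [:: [:: (1, true)]]); (Expand 2, [:: [:: (1, false)]]);
(Delete [:: (1, false)], [:: [:: (1, true)]]); (Delete [:: (1, true)], [:: [:: (6, true)]; [:: (1, false); (3,
false)]; [:: (1, true)]; [:: (9, false)]; [:: (3, false)]]); (Delete [:: (2, true)], [:: [:: (5, false)]; [::
(3, true)]]); (Delete [:: (1, false); (3, false)], [:: [:: (1, true)]]); (Delete [:: (3, true)], [:: [:: (2,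
true)]; [:: (11, false)]]); (Delete [:: (3, true)], [:: [:: (2, true)]]); (Delete [:: (3, true)], [:: [:: (2,
true)]; [:: (11, false)]]); (Delete [:: (3, true)], [:: [:: (1, true)]]); (Delete [:: (3, true)], [:: [:: (2,
true)]; [:: (11, false)]]); (Delete [:: (3, true)], [:: [:: (2, true)]]); (Delete [:: (3, true)], [:: [:: (2,
true)]; [:: (11, false)]]); (Delete [:: (3, true)], [:: [:: (1, true)]]); (Delete [:: (4, false)], [:: [::
(11, false)]]); (Delete [:: (2, true)], [:: [:: (2, true)]]); (Delete [:: (2, true)], [:: [:: (2, true)]; [::
(11, false)]]); (Delete [:: (2, true)], [:: [:: (2, true)]]); (Expand 2, [:: [:: (1, false)]]); (Delete [::
(1, false)], [:: [:: (1, true)]]); (Delete [:: (2, true)], [:: [:: (6, false); (9, true)]; [:: (1, true)]; [::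
(5, true)]; [:: (12, false)]; [:: (3, false); (6, false)]]); (Delete [:: (6, false); (8, false)], [:: [:: (8,
false)]]); (Delete [:: (5, true)], [:: [:: (1, true)]]); (Delete [:: (2, true)], [:: [:: (1, true)]]); (Delete
[:: (3, true)], [:: [:: (1, true)]]); (Delete [:: (2, true)], [:: [:: (2, true)]; [:: (11, false)]]); (Delete
[:: (2, true)], [:: [:: (1, true)]]); (Delete [:: (4, false)], [:: [:: (11, false)]]); (Delete [:: (2, true)],
[:: [:: (2, true)]]); (Delete [:: (2, true)], [:: [:: (2, true)]; [:: (11, false)]]); (Delete [:: (2, true)],
[:: [:: (2, true)]]); (Expand 2, [:: [:: (1, false)]]); (Delete [:: (1, false)], [:: [:: (1, true)]]); (Delete
[:: (2, true)], [:: [:: (5, false); (9, true)]; [:: (1, true)]; [:: (6, true)]; [:: (12, false)]; [:: (3,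
false); (5, false)]]); (Delete [:: (5, false); (8, false)], [:: [:: (8, false)]]); (Delete [:: (6, true)], [::
[:: (1, true)]]); (Delete [:: (2, true)], [:: [:: (1, true)]]); (Delete [:: (3, true)], [:: [:: (1, true)]]);
(Delete [:: (2, true)], [:: [:: (2, true)]; [:: (11, false)]]); (Delete [:: (2, true)], [:: [:: (1, true)]])].

Lemma check_leaf : check 1 9 20 cert_leaf leaf_root = Some [::].
Proof. by vm_compute. Qed.

(** Three corners of degree 2: the ball of radius 1 around the middle one meets four edges and gains
    18 - 8 = 10, while the fourth corner keeps its third neighbour. *)
Definition cert_c1 : cert := [::
(Delete [:: (2, false)], [::])].

Lemma check_c1 : check 2 9 20 cert_c1 (c4_root false true true true) = Some [::].
Proof. by vm_compute. Qed.

(** Two opposite corners of degree 2; [cert_c2a] treats two adjacent ones. *)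
Definition cert_c2o : cert := [::
(Expand 0, [:: [:: (0, false)]]); (Delete [:: (0, false)], [:: [:: (4, true)]]); (Expand 4, [:: [:: (0,
false)]]); (Delete [:: (0, true)], [:: [:: (0, false); (5, true)]])].

Lemma check_c2o : check 2 10 20 cert_c2o (c4_root false true false true) = Some [::].
Proof. by vm_compute. Qed.

Definition cert_c2a : cert := [::
(Expand 0, [::]); (Expand 1, [::]); (Expand 4, [:: [:: (0, true)]]); (Delete [:: (1, true)], [:: [:: (0,
true)]; [:: (5, true)]]); (Delete [:: (2, false); (4, false)], [:: [:: (8, true)]; [:: (3, false); (5,
false)]; [:: (2, false); (8, false)]; [:: (5, true)]; [:: (8, false)]]); (Delete [:: (0, true)], [:: [:: (0,
true)]]); (Expand 6, [:: [:: (3, false); (6, false)]; [:: (1, true)]]); (Delete [:: (1, false); (4, true)],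
[:: [:: (1, true)]; [:: (10, true)]; [:: (3, false); (5, false)]]); (Delete [:: (3, false); (8, true)], [::
[:: (6, true)]]); (Delete [:: (3, false); (8, true)], [:: [:: (6, true)]]); (Delete [:: (1, true)], [:: [::
(0, true)]]); (Expand 4, [:: [:: (0, false)]]); (Delete [:: (0, true)], [:: [:: (5, true)]])].

Lemma check_c2a : check 2 10 20 cert_c2a (c4_root false false true true) = Some [::].
Proof. by vm_compute. Qed.

(** One corner of degree 2. *)
Definition cert_c3 : cert := [::
(Expand 0, [:: [:: (0, false)]]); (Expand 1, [:: [:: (0, false)]]); (Expand 2, [:: [:: (2, false)]]); (Expand
4, [:: [:: (0, false)]]); (Delete [:: (0, true)], [:: [:: (9, true)]; [:: (2, true)]; [:: (2, false); (11,
false)]; [:: (4, true)]; [:: (9, false)]; [:: (2, false); (10, false)]; [:: (1, true)]; [:: (2, false)]]);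
(Delete [:: (0, false); (6, false)], [:: [:: (0, false); (6, false)]]); (Delete [:: (2, true)], [:: [:: (1,
true)]]); (Delete [:: (2, true)], [:: [:: (1, true)]]); (Delete [:: (4, true)], [:: [:: (1, true)]; [:: (0,
false); (5, true)]]); (Delete [:: (0, false); (9, false)], [:: [:: (2, false); (4, false)]; [:: (4, true)]]);
(Delete [:: (0, false); (9, false)], [:: [:: (2, false); (4, false)]; [:: (4, true)]]); (Delete [:: (0,
false); (9, false)], [:: [:: (9, true)]]); (Delete [:: (4, true)], [:: [:: (4, true)]]); (Delete [:: (4,
true)], [:: [:: (4, true)]]); (Delete [:: (7, false); (11, false)], [:: [:: (4, true)]]); (Delete [:: (4,
true)], [:: [:: (4, true)]]); (Delete [:: (4, true)], [:: [:: (4, true)]]); (Delete [:: (7, false); (10,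
false)], [:: [:: (4, true)]]); (Delete [:: (0, true)], [:: [:: (2, true)]; [:: (4, true)]; [:: (2, false); (4,
false)]; [:: (1, true)]; [:: (0, false); (8, false)]]); (Delete [:: (0, true)], [:: [:: (2, false); (4,
false)]; [:: (2, false)]; [:: (4, true)]]); (Delete [:: (0, true)], [:: [:: (1, true)]]); (Expand 4, [:: [::
(0, true)]]); (Delete [:: (0, true)], [:: [:: (1, true)]]); (Delete [:: (1, true)], [:: [:: (1, true)]; [::
(0, false); (4, false)]]); (Delete [:: (0, false); (5, true)], [:: [:: (0, true)]]); (Delete [:: (0, false);
(6, true)], [:: [:: (0, true)]]); (Delete [:: (0, false); (5, true)], [:: [:: (0, true)]]); (Delete [:: (0,
false); (6, true)], [:: [:: (0, true)]])].

Lemma check_c3 : check 2 11 20 cert_c3 (c4_root false false false true) = Some [::].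
Proof. by vm_compute. Qed.

(** All four corners have degree 3. *)
Definition cert_c4 : cert := [::
(Expand 0, [:: [:: (0, false)]]); (Expand 1, [:: [:: (1, false)]]); (Expand 1, [:: [:: (1, false)]]); (Expand
2, [::]); (Expand 3, [::]); (Expand 4, [::]); (Delete [:: (0, true)], [:: [:: (9, true)]; [:: (5, true)]; [::
(3, true)]; [:: (8, true)]; [:: (1, false); (7, false)]; [:: (1, true)]; [:: (1, false); (8, false)]; [:: (3,
false); (8, false)]]); (Delete [:: (1, false); (8, false)], [:: [:: (3, true)]]); (Delete [:: (3, false); (8,
false)], [:: [:: (1, true)]]); (Delete [:: (1, false); (8, false)], [:: [:: (3, true)]]); (Delete [:: (0,
false); (9, false)], [:: [:: (8, true)]]); (Delete [:: (1, true)], [:: [:: (0, true)]]); (Delete [:: (1,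
true)], [:: [:: (0, true)]]); (Delete [:: (0, true)], [:: [:: (10, true)]; [:: (8, true)]; [:: (9, true)]; [::
(5, true)]; [:: (7, true)]; [:: (11, true)]; [:: (12, true)]; [:: (2, true)]]); (Delete [:: (0, false); (6,
false)], [:: [:: (2, true)]; [:: (1, false); (9, false)]]); (Delete [:: (0, false); (6, false)], [:: [:: (2,
true)]; [:: (1, false); (8, false)]]); (Delete [:: (0, false); (6, false)], [:: [:: (5, true)]; [:: (3,
true)]; [:: (0, false); (5, true)]]); (Delete [:: (2, false); (4, false)], [:: [:: (2, true)]; [:: (7,
true)]]); (Delete [:: (2, false); (4, false)], [:: [:: (2, true)]; [:: (7, true)]]); (Delete [:: (2, false);
(4, false)], [:: [:: (2, true)]; [:: (5, true)]]); (Delete [:: (2, false); (4, false)], [:: [:: (2, true)];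
[:: (5, true)]]); (Expand 8, [:: [:: (4, true)]]); (Delete [:: (3, true)], [:: [:: (1, false); (7, false)];
[:: (1, true)]; [:: (7, false)]; [:: (0, false); (6, false)]]); (Delete [:: (4, false); (7, false)], [:: [::
(1, true)]]); (Delete [:: (3, false); (9, false)], [:: [:: (0, true)]]); (Delete [:: (3, false); (9, false)],
[:: [:: (3, true)]]); (Delete [:: (3, true)], [:: [:: (1, false); (7, false)]; [:: (1, true)]; [:: (7,
false)]; [:: (0, false); (6, false)]]); (Delete [:: (3, false); (8, false)], [:: [:: (0, true)]]); (Delete [::
(3, false); (8, false)], [:: [:: (3, true)]]); (Delete [:: (4, false); (7, false)], [:: [:: (1, true)]]);
(Delete [:: (0, false); (10, false)], [:: [:: (4, false); (7, false)]; [:: (8, true)]; [:: (9, true)]]);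
(Delete [:: (1, true)], [:: [:: (3, false); (5, false)]; [:: (2, true)]; [:: (5, false)]; [:: (0, false); (6,
false)]]); (Delete [:: (4, false); (5, false)], [:: [:: (1, true)]]); (Delete [:: (1, false); (9, false)], [::
[:: (0, true)]]); (Delete [:: (1, false); (9, false)], [:: [:: (1, true)]]); (Delete [:: (1, true)], [:: [::
(3, false); (5, false)]; [:: (2, true)]; [:: (5, false)]; [:: (0, false); (6, false)]]); (Delete [:: (1,
false); (8, false)], [:: [:: (0, true)]]); (Delete [:: (1, false); (8, false)], [:: [:: (1, true)]]); (Delete
[:: (4, false); (5, false)], [:: [:: (1, true)]]); (Delete [:: (0, false); (10, false)], [:: [:: (4, false);
(5, false)]; [:: (8, true)]; [:: (9, true)]]); (Delete [:: (1, false); (7, false)], [:: [:: (1, true)]]);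
(Delete [:: (0, false); (10, false)], [:: [:: (1, false); (7, false)]; [:: (1, false); (9, false)]; [:: (3,
false); (5, false)]]); (Delete [:: (0, false); (10, false)], [:: [:: (1, false); (7, false)]; [:: (1, false);
(8, false)]; [:: (3, false); (5, false)]]); (Delete [:: (2, false); (12, false)], [:: [:: (0, true)]]);
(Delete [:: (2, false); (12, false)], [:: [:: (0, true)]]); (Delete [:: (10, true)], [:: [:: (1, true)]]);
(Delete [:: (10, true)], [:: [:: (1, true)]]); (Delete [:: (10, true)], [:: [:: (1, true)]]); (Delete [:: (10,
true)], [:: [:: (1, true)]]); (Delete [:: (2, true)], [:: [:: (1, true)]]); (Delete [:: (2, true)], [:: [::
(1, true)]]); (Delete [:: (2, false); (12, false)], [:: [:: (0, true)]]); (Delete [:: (2, false); (12,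
false)], [:: [:: (0, true)]]); (Delete [:: (11, true)], [:: [:: (1, true)]]); (Delete [:: (11, true)], [:: [::
(1, true)]]); (Delete [:: (11, true)], [:: [:: (1, true)]]); (Delete [:: (11, true)], [:: [:: (1, true)]]);
(Delete [:: (2, true)], [:: [:: (1, true)]]); (Delete [:: (2, true)], [:: [:: (1, true)]]); (Delete [:: (10,
false); (3, true)], [:: [:: (1, true)]; [:: (3, true)]; [:: (8, false); (12, false)]]); (Delete [:: (2,
false); (4, false)], [:: [:: (4, true)]]); (Delete [:: (2, false); (4, false)], [:: [:: (4, true)]]); (Delete
[:: (12, true)], [:: [:: (1, true)]]); (Delete [:: (12, true)], [:: [:: (1, true)]]); (Delete [:: (10, false);
(3, true)], [:: [:: (1, true)]; [:: (3, true)]; [:: (8, false); (11, false)]]); (Delete [:: (2, false); (4,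
false)], [:: [:: (4, true)]]); (Delete [:: (2, false); (4, false)], [:: [:: (4, true)]]); (Delete [:: (11,
true)], [:: [:: (1, true)]]); (Delete [:: (11, true)], [:: [:: (1, true)]]); (Delete [:: (0, true)], [:: [::
(3, true)]; [:: (2, false); (4, false)]; [:: (5, true)]; [:: (0, false); (9, false)]; [:: (3, false); (5,
false)]; [:: (3, false); (8, false)]]); (Delete [:: (0, false); (6, false)], [:: [:: (3, true)]; [:: (5,
true)]]); (Delete [:: (2, false); (4, false)], [:: [:: (3, true)]; [:: (8, false)]]); (Delete [:: (0, true)],
[:: [:: (1, true)]; [:: (1, false); (6, false)]; [:: (0, false); (8, false)]]); (Delete [:: (2, true)], [::
[:: (9, true)]; [:: (4, true)]; [:: (10, true)]; [:: (5, true)]; [:: (7, true)]]); (Delete [:: (3, false); (4,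
false)], [:: [:: (0, true)]]); (Delete [:: (1, false); (4, false)], [:: [:: (0, true)]]); (Delete [:: (0,
true)], [:: [:: (0, true)]]); (Delete [:: (3, false); (6, false)], [:: [:: (0, true)]]); (Delete [:: (1,
false); (7, false)], [:: [:: (1, true)]]); (Delete [:: (1, false); (6, false)], [:: [:: (0, true)]]); (Delete
[:: (2, true)], [:: [:: (0, true)]]); (Delete [:: (3, true)], [:: [:: (0, true)]]); (Delete [:: (0, true)],
[:: [:: (9, true)]; [:: (6, true)]; [:: (1, true)]; [:: (2, false); (4, false)]; [:: (0, false); (9, false)];
[:: (1, false); (7, false)]; [:: (1, false); (8, false)]]); (Delete [:: (0, false); (6, false)], [:: [:: (5,
true)]]); (Delete [:: (2, false); (4, false)], [:: [:: (1, true)]; [:: (8, false)]]); (Delete [:: (0, true)],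
[:: [:: (0, false); (6, false)]]); (Delete [:: (1, true)], [:: [:: (0, true)]]); (Expand 6, [:: [:: (2,
false)]]); (Expand 7, [:: [:: (6, false)]; [:: (0, true)]]); (Delete [:: (6, true)], [:: [:: (10, true)]; [::
(0, true)]; [:: (1, true)]; [:: (4, false); (6, false)]; [:: (5, false); (6, false)]]); (Delete [:: (1,
true)], [:: [:: (0, true)]]); (Delete [:: (1, true)], [:: [:: (0, true)]]); (Delete [:: (1, true)], [:: [::
(0, true)]]); (Delete [:: (1, true)], [:: [:: (0, true)]]); (Delete [:: (7, true)], [:: [:: (0, true)]]);
(Delete [:: (2, true)], [:: [:: (1, true)]]); (Delete [:: (3, true)], [:: [:: (0, true)]]); (Delete [:: (0,
true)], [:: [:: (0, true)]]); (Delete [:: (0, true)], [:: [:: (0, true)]]); (Expand 5, [::]); (Delete [:: (1,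
true)], [:: [:: (4, true)]; [:: (6, true)]; [:: (7, true)]; [:: (0, false); (6, false)]; [:: (0, false); (7,
false)]; [:: (2, false); (7, false)]]); (Expand 4, [:: [:: (0, false); (6, false)]; [:: (0, false); (7,
false)]]); (Delete [:: (2, false); (4, false)], [:: [:: (5, false); (6, false)]]); (Delete [:: (1, true)], [::
[:: (0, false); (6, false)]]); (Delete [:: (1, true)], [:: [:: (2, false); (4, false)]]); (Expand 4, [:: [::
(0, false)]]); (Expand 7, [:: [:: (4, false)]; [:: (1, true)]]); (Delete [:: (4, true)], [:: [:: (10, true)];
[:: (1, true)]; [:: (2, true)]; [:: (4, false); (5, false)]; [:: (4, false); (6, false)]]); (Delete [:: (2,
true)], [:: [:: (0, true)]]); (Delete [:: (2, true)], [:: [:: (0, true)]]); (Delete [:: (1, true)], [:: [::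
(1, true)]]); (Delete [:: (1, true)], [:: [:: (1, true)]]); (Delete [:: (7, true)], [:: [:: (1, true)]]);
(Delete [:: (3, true)], [:: [:: (2, true)]]); (Delete [:: (0, true)], [:: [:: (1, true)]]); (Delete [:: (0,
true)], [:: [:: (1, true)]]); (Delete [:: (1, true)], [:: [:: (1, true)]]); (Expand 3, [:: [:: (2, false)]]);
(Expand 5, [:: [:: (1, false)]]); (Expand 7, [:: [:: (5, false)]; [:: (0, true)]]); (Delete [:: (5, true)],
[:: [:: (10, true)]; [:: (0, true)]; [:: (3, true)]; [:: (4, false); (5, false)]; [:: (5, false); (6,
false)]]); (Delete [:: (3, true)], [:: [:: (0, true)]]); (Delete [:: (3, true)], [:: [:: (0, true)]]); (Delete
[:: (3, true)], [:: [:: (0, true)]]); (Delete [:: (3, true)], [:: [:: (0, true)]]); (Delete [:: (7, true)],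
[:: [:: (0, true)]]); (Delete [:: (2, true)], [:: [:: (3, true)]]); (Delete [:: (1, true)], [:: [:: (0,
true)]]); (Delete [:: (0, true)], [:: [:: (0, true)]]); (Delete [:: (0, true)], [:: [:: (0, true)]]); (Expand
4, [:: [:: (0, true)]]); (Delete [:: (0, true)], [:: [:: (5, false)]]); (Expand 3, [:: [:: (3, false)]]);
(Expand 4, [::]); (Delete [:: (0, true)], [:: [:: (5, true)]; [:: (6, true)]; [:: (7, true)]; [:: (1, false);
(6, false)]; [:: (1, false); (7, false)]; [:: (3, false); (7, false)]]); (Expand 5, [:: [:: (1, false); (6,
false)]; [:: (1, false); (7, false)]]); (Delete [:: (3, false); (5, false)], [:: [:: (4, false); (6,
false)]]); (Delete [:: (0, true)], [:: [:: (1, false); (6, false)]]); (Delete [:: (0, true)], [:: [:: (3,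
false); (5, false)]]); (Expand 4, [:: [:: (0, true)]]); (Delete [:: (0, true)], [:: [:: (4, false); (5,
false)]]); (Expand 2, [:: [:: (1, false)]]); (Expand 3, [:: [:: (0, false)]]); (Expand 4, [:: [:: (0,
false)]]); (Expand 7, [:: [:: (4, false)]; [:: (2, true)]]); (Delete [:: (4, true)], [:: [:: (10, true)]; [::
(2, true)]; [:: (3, true)]; [:: (4, false); (5, false)]; [:: (4, false); (6, false)]]); (Delete [:: (3,
true)], [:: [:: (1, true)]]); (Delete [:: (3, true)], [:: [:: (1, true)]]); (Delete [:: (2, true)], [:: [::
(0, true)]]); (Delete [:: (2, true)], [:: [:: (0, true)]]); (Delete [:: (7, true)], [:: [:: (2, true)]]);
(Delete [:: (0, true)], [:: [:: (3, true)]]); (Delete [:: (1, true)], [:: [:: (2, true)]]); (Delete [:: (1,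
true)], [:: [:: (2, true)]]); (Delete [:: (0, true)], [:: [:: (2, true)]]); (Expand 4, [:: [:: (0, true)]]);
(Delete [:: (0, true)], [:: [:: (5, false)]])].

Lemma check_c4 : check 2 12 20 cert_c4 (c4_root false false false false) = Some [::].
Proof. by vm_compute. Qed.

(** Minimum degree 2 and no induced 4-cycles. Any vertex can serve as the root, and nothing is known
    about it at first. *)
Definition cert_rest : cert := [::
(Expand 0, [::]); (Expand 1, [:: [:: (0, false)]; [:: (1, false)]]); (Expand 2, [:: [:: (0, false)]]); (Expand
3, [:: [:: (0, true)]; [:: (1, false)]]); (Delete [:: (2, false); (3, false)], [:: [:: (0, false); (8,
false)]; [:: (1, false); (8, false)]]); (Expand 5, [:: [:: (2, true)]; [:: (3, true)]]); (Delete [:: (2,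
true)], [:: [:: (2, true)]]); (Expand 5, [:: [:: (2, true)]; [:: (3, true)]]); (Delete [:: (2, true)], [:: [::
(2, true)]]); (Expand 4, [:: [:: (2, true)]; [:: (3, true)]]); (Delete [:: (2, true)], [:: [:: (2, true)]]);
(Expand 4, [:: [:: (2, true)]; [:: (3, true)]]); (Delete [:: (2, true)], [:: [:: (2, true)]]); (Delete [:: (5,
true)], [::]); (Delete [:: (2, true)], [:: [:: (1, true)]; [:: (2, true)]]); (Delete [:: (4, true)], [::]);
(Delete [:: (2, true)], [:: [:: (1, true)]; [:: (2, true)]]); (Expand 2, [::]); (Expand 3, [:: [:: (1,
false)]]); (Expand 4, [:: [:: (1, false)]]); (Delete [:: (1, true)], [:: [:: (2, false); (3, false)]; [:: (2,
false); (4, false)]]); (Delete [:: (4, true)], [:: [:: (3, true)]]); (Delete [:: (1, false); (10, false)], [::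
[:: (7, false)]; [:: (9, false)]]); (Delete [:: (1, false); (10, false)], [:: [:: (7, false)]; [:: (8,
false)]]); (Delete [:: (1, false); (10, false)], [:: [:: (3, true)]]); (Delete [:: (1, false); (10, false)],
[:: [:: (6, false)]; [:: (9, false)]]); (Delete [:: (1, false); (10, false)], [:: [:: (6, false)]; [:: (8,
false)]]); (Delete [:: (1, false); (10, false)], [:: [:: (3, true)]]); (Delete [:: (3, true)], [:: [:: (4,
true)]]); (Delete [:: (1, false); (10, false)], [:: [:: (4, true)]]); (Delete [:: (1, false); (10, false)],
[:: [:: (4, true)]]); (Delete [:: (4, true)], [:: [:: (2, true)]]); (Delete [:: (3, true)], [:: [:: (3,
true)]]); (Delete [:: (3, true)], [:: [:: (3, true)]]); (Delete [:: (1, true)], [:: [:: (5, false)]]); (Delete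
[:: (1, true)], [:: [:: (1, true)]]); (Delete [:: (1, false)], [:: [:: (1, true)]]); (Expand 3, [:: [:: (1,
false)]]); (Expand 4, [:: [:: (1, false)]]); (Delete [:: (1, true)], [:: [:: (2, false)]]); (Delete [:: (2,
false); (4, false)], [:: [:: (2, false); (9, false)]; [:: (2, false); (10, false)]]); (Delete [:: (1, false);
(5, false)], [:: [:: (0, false); (8, false)]; [:: (0, false); (10, false)]]); (Delete [:: (1, false); (5,
false)], [:: [:: (0, false); (8, false)]; [:: (0, false); (9, false)]]); (Delete [:: (1, false); (5, false)],
[:: [:: (0, false); (7, false)]; [:: (0, false); (10, false)]]); (Delete [:: (1, false); (5, false)], [:: [::
(0, false); (7, false)]; [:: (0, false); (9, false)]]); (Delete [:: (2, false); (3, false)], [:: [:: (2,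
false); (7, false)]; [:: (2, false); (8, false)]]); (Delete [:: (2, false); (4, false)], [:: [:: (2, false);
(9, false)]; [:: (2, false); (10, false)]]); (Delete [:: (1, false); (6, false)], [:: [:: (0, false); (8,
false)]; [:: (0, false); (10, false)]]); (Delete [:: (1, false); (6, false)], [:: [:: (0, false); (8, false)];
[:: (0, false); (9, false)]]); (Delete [:: (1, false); (6, false)], [:: [:: (0, false); (7, false)]; [:: (0,
false); (10, false)]]); (Delete [:: (1, false); (6, false)], [:: [:: (0, false); (7, false)]; [:: (0, false);
(9, false)]]); (Delete [:: (2, false); (3, false)], [:: [:: (2, false); (7, false)]; [:: (2, false); (8,
false)]]); (Delete [:: (4, true)], [:: [:: (3, true)]]); (Delete [:: (1, false); (11, false)], [:: [:: (8,
false)]; [:: (10, false)]]); (Delete [:: (1, false); (11, false)], [:: [:: (8, false)]; [:: (9, false)]]);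
(Delete [:: (1, false); (11, false)], [:: [:: (3, true)]]); (Delete [:: (1, false); (11, false)], [:: [:: (7,
false)]; [:: (10, false)]]); (Delete [:: (1, false); (11, false)], [:: [:: (7, false)]; [:: (9, false)]]);
(Delete [:: (1, false); (11, false)], [:: [:: (3, true)]]); (Delete [:: (3, true)], [:: [:: (4, true)]]);
(Delete [:: (1, false); (11, false)], [:: [:: (4, true)]]); (Delete [:: (1, false); (11, false)], [:: [:: (4,
true)]]); (Delete [:: (1, true)], [:: [:: (2, false)]; [:: (6, true)]; [:: (1, false); (10, false)]]); (Delete
[:: (2, false); (3, false)], [:: [:: (4, true)]]); (Delete [:: (1, false); (10, false)], [:: [:: (3, false)];
[:: (3, true)]]); (Delete [:: (1, false); (10, false)], [:: [:: (3, false)]; [:: (3, true)]]); (Delete [:: (3,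
true)], [:: [:: (3, true)]]); (Delete [:: (2, true)], [:: [:: (2, true)]]); (Delete [:: (2, true)], [:: [::
(2, true)]]); (Delete [:: (4, true)], [:: [:: (2, false)]]); (Delete [:: (1, true)], [:: [:: (2, false)]; [::
(5, true)]; [:: (1, false); (10, false)]]); (Delete [:: (2, false); (3, false)], [:: [:: (4, true)]]); (Delete
[:: (1, false); (10, false)], [:: [:: (3, false)]; [:: (3, true)]]); (Delete [:: (1, false); (10, false)], [::
[:: (3, false)]; [:: (3, true)]]); (Delete [:: (3, true)], [:: [:: (3, true)]]); (Delete [:: (2, true)], [::
[:: (2, true)]]); (Delete [:: (2, true)], [:: [:: (2, true)]]); (Delete [:: (4, true)], [:: [:: (2, false)]]);
(Delete [:: (0, true)], [:: [:: (2, true)]]); (Expand 4, [:: [:: (1, false)]]); (Delete [:: (1, true)], [::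
[:: (2, false)]; [:: (6, true)]; [:: (1, false); (10, false)]]); (Delete [:: (2, false); (4, false)], [:: [::
(3, true)]]); (Delete [:: (4, true)], [:: [:: (4, true)]]); (Delete [:: (1, false); (10, false)], [:: [:: (4,
false)]; [:: (4, true)]]); (Delete [:: (1, false); (10, false)], [:: [:: (4, false)]; [:: (4, true)]]);
(Delete [:: (2, true)], [:: [:: (2, true)]]); (Delete [:: (2, true)], [:: [:: (2, true)]]); (Delete [:: (3,
true)], [:: [:: (2, false)]]); (Delete [:: (1, true)], [:: [:: (0, true)]; [:: (2, false); (7, false)]; [::
(2, false); (8, false)]]); (Expand 4, [:: [:: (1, false)]]); (Delete [:: (1, true)], [:: [:: (2, false)]; [::
(5, true)]; [:: (1, false); (10, false)]]); (Delete [:: (2, false); (4, false)], [:: [:: (3, true)]]); (Delete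
[:: (4, true)], [:: [:: (4, true)]]); (Delete [:: (1, false); (10, false)], [:: [:: (4, false)]; [:: (4,
true)]]); (Delete [:: (1, false); (10, false)], [:: [:: (4, false)]; [:: (4, true)]]); (Delete [:: (2, true)],
[:: [:: (2, true)]]); (Delete [:: (2, true)], [:: [:: (2, true)]]); (Delete [:: (3, true)], [:: [:: (2,
false)]]); (Delete [:: (1, true)], [:: [:: (0, true)]; [:: (2, false); (7, false)]; [:: (2, false); (8,
false)]]); (Delete [:: (0, true)], [:: [:: (1, false); (5, false)]; [:: (1, false); (6, false)]]); (Delete [::
(1, false)], [:: [:: (1, true)]]); (Expand 1, [:: [:: (0, false)]]); (Expand 4, [::]); (Expand 2, [:: [:: (0,
false)]]); (Expand 3, [:: [:: (0, false)]]); (Delete [:: (0, true)], [:: [:: (2, false); (4, false)]; [:: (3,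
false); (4, false)]]); (Delete [:: (3, true)], [:: [:: (2, true)]]); (Delete [:: (0, false); (10, false)], [::
[:: (7, false)]; [:: (9, false)]]); (Delete [:: (0, false); (10, false)], [:: [:: (7, false)]; [:: (8,
false)]]); (Delete [:: (0, false); (10, false)], [:: [:: (2, true)]]); (Delete [:: (0, false); (10, false)],
[:: [:: (6, false)]; [:: (9, false)]]); (Delete [:: (0, false); (10, false)], [:: [:: (6, false)]; [:: (8,
false)]]); (Delete [:: (0, false); (10, false)], [:: [:: (2, true)]]); (Delete [:: (2, true)], [:: [:: (3,
true)]]); (Delete [:: (0, false); (10, false)], [:: [:: (3, true)]]); (Delete [:: (0, false); (10, false)],
[:: [:: (3, true)]]); (Delete [:: (3, true)], [:: [:: (4, true)]]); (Delete [:: (2, true)], [:: [:: (2,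
true)]]); (Delete [:: (2, true)], [:: [:: (2, true)]]); (Delete [:: (0, true)], [:: [:: (5, false)]]); (Delete
[:: (0, true)], [:: [:: (0, true)]]); (Delete [:: (0, false)], [:: [:: (0, true)]]); (Expand 2, [:: [:: (0,
false)]]); (Expand 3, [:: [:: (0, false)]]); (Delete [:: (0, true)], [:: [:: (4, false)]]); (Delete [:: (3,
false); (4, false)], [:: [:: (4, false); (9, false)]; [:: (4, false); (10, false)]]); (Delete [:: (0, false);
(5, false)], [:: [:: (1, false); (8, false)]; [:: (1, false); (10, false)]]); (Delete [:: (0, false); (5,
false)], [:: [:: (1, false); (8, false)]; [:: (1, false); (9, false)]]); (Delete [:: (0, false); (5, false)],
[:: [:: (1, false); (7, false)]; [:: (1, false); (10, false)]]); (Delete [:: (0, false); (5, false)], [:: [::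
(1, false); (7, false)]; [:: (1, false); (9, false)]]); (Delete [:: (2, false); (4, false)], [:: [:: (4,
false); (7, false)]; [:: (4, false); (8, false)]]); (Delete [:: (3, false); (4, false)], [:: [:: (4, false);
(9, false)]; [:: (4, false); (10, false)]]); (Delete [:: (0, false); (6, false)], [:: [:: (1, false); (8,
false)]; [:: (1, false); (10, false)]]); (Delete [:: (0, false); (6, false)], [:: [:: (1, false); (8, false)];
[:: (1, false); (9, false)]]); (Delete [:: (0, false); (6, false)], [:: [:: (1, false); (7, false)]; [:: (1,
false); (10, false)]]); (Delete [:: (0, false); (6, false)], [:: [:: (1, false); (7, false)]; [:: (1, false);
(9, false)]]); (Delete [:: (2, false); (4, false)], [:: [:: (4, false); (7, false)]; [:: (4, false); (8,
false)]]); (Delete [:: (3, true)], [:: [:: (2, true)]]); (Delete [:: (0, false); (11, false)], [:: [:: (8,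
false)]; [:: (10, false)]]); (Delete [:: (0, false); (11, false)], [:: [:: (8, false)]; [:: (9, false)]]);
(Delete [:: (0, false); (11, false)], [:: [:: (2, true)]]); (Delete [:: (0, false); (11, false)], [:: [:: (7,
false)]; [:: (10, false)]]); (Delete [:: (0, false); (11, false)], [:: [:: (7, false)]; [:: (9, false)]]);
(Delete [:: (0, false); (11, false)], [:: [:: (2, true)]]); (Delete [:: (2, true)], [:: [:: (3, true)]]);
(Delete [:: (0, false); (11, false)], [:: [:: (3, true)]]); (Delete [:: (0, false); (11, false)], [:: [:: (3,
true)]]); (Delete [:: (0, true)], [:: [:: (4, false)]; [:: (6, true)]; [:: (0, false); (10, false)]]); (Delete
[:: (2, false); (4, false)], [:: [:: (3, true)]]); (Delete [:: (0, false); (10, false)], [:: [:: (2, false)];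
[:: (2, true)]]); (Delete [:: (0, false); (10, false)], [:: [:: (2, false)]; [:: (2, true)]]); (Delete [:: (2,
true)], [:: [:: (2, true)]]); (Delete [:: (4, true)], [:: [:: (4, true)]]); (Delete [:: (4, true)], [:: [::
(4, true)]]); (Delete [:: (3, true)], [:: [:: (3, true)]]); (Delete [:: (0, true)], [:: [:: (4, false)]; [::
(5, true)]; [:: (0, false); (10, false)]]); (Delete [:: (2, false); (4, false)], [:: [:: (3, true)]]); (Delete
[:: (0, false); (10, false)], [:: [:: (2, false)]; [:: (2, true)]]); (Delete [:: (0, false); (10, false)], [::
[:: (2, false)]; [:: (2, true)]]); (Delete [:: (2, true)], [:: [:: (2, true)]]); (Delete [:: (4, true)], [::
[:: (4, true)]]); (Delete [:: (4, true)], [:: [:: (4, true)]]); (Delete [:: (3, true)], [:: [:: (3, true)]]);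
(Delete [:: (1, true)], [:: [:: (2, true)]]); (Expand 3, [:: [:: (0, false)]]); (Delete [:: (0, true)], [::
[:: (4, false)]; [:: (6, true)]; [:: (0, false); (10, false)]]); (Delete [:: (3, false); (4, false)], [:: [::
(2, true)]]); (Delete [:: (3, true)], [:: [:: (3, true)]]); (Delete [:: (0, false); (10, false)], [:: [:: (3,
false)]; [:: (3, true)]]); (Delete [:: (0, false); (10, false)], [:: [:: (3, false)]; [:: (3, true)]]);
(Delete [:: (4, true)], [:: [:: (4, true)]]); (Delete [:: (4, true)], [:: [:: (4, true)]]); (Delete [:: (2,
true)], [:: [:: (2, true)]]); (Delete [:: (0, true)], [:: [:: (1, true)]; [:: (4, false); (7, false)]; [:: (4,
false); (8, false)]]); (Expand 3, [:: [:: (0, false)]]); (Delete [:: (0, true)], [:: [:: (4, false)]; [:: (5,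
true)]; [:: (0, false); (10, false)]]); (Delete [:: (3, false); (4, false)], [:: [:: (2, true)]]); (Delete [::
(3, true)], [:: [:: (3, true)]]); (Delete [:: (0, false); (10, false)], [:: [:: (3, false)]; [:: (3, true)]]);
(Delete [:: (0, false); (10, false)], [:: [:: (3, false)]; [:: (3, true)]]); (Delete [:: (4, true)], [:: [::
(4, true)]]); (Delete [:: (4, true)], [:: [:: (4, true)]]); (Delete [:: (2, true)], [:: [:: (2, true)]]);
(Delete [:: (0, true)], [:: [:: (1, true)]; [:: (4, false); (7, false)]; [:: (4, false); (8, false)]]);
(Delete [:: (0, true)], [:: [:: (0, false); (5, false)]; [:: (0, false); (6, false)]]); (Delete [:: (0,
false)], [:: [:: (0, true)]]); (Expand 2, [:: [:: (0, false)]]); (Expand 3, [::]); (Delete [:: (0, false)],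
[::]); (Delete [:: (0, true)], [:: [:: (1, false); (6, false)]; [:: (3, false); (6, false)]]); (Delete [:: (3,
true)], [:: [:: (7, false)]; [:: (8, false)]]); (Delete [:: (3, false); (6, false)], [:: [:: (6, false)]]);
(Delete [:: (3, false); (6, false)], [:: [:: (6, false)]]); (Delete [:: (0, false); (9, false)], [:: [:: (5,
false)]; [:: (8, false)]]); (Delete [:: (0, false); (9, false)], [:: [:: (5, false)]; [:: (7, false)]]);
(Delete [:: (0, false); (9, false)], [:: [:: (9, true)]; [:: (1, true)]; [:: (7, true)]; [:: (8, true)]]);
(Delete [:: (1, false); (6, false)], [:: [:: (6, false)]]); (Delete [:: (0, false); (9, false)], [:: [:: (1,
false); (6, false)]; [:: (3, false)]; [:: (3, false); (6, false)]]); (Delete [:: (0, false); (9, false)], [::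
[:: (1, false); (6, false)]; [:: (3, false)]; [:: (3, false); (6, false)]]); (Delete [:: (0, false); (9,
false)], [:: [:: (4, false)]; [:: (8, false)]]); (Delete [:: (0, false); (9, false)], [:: [:: (4, false)]; [::
(7, false)]]); (Delete [:: (0, false); (9, false)], [:: [:: (9, true)]; [:: (1, true)]; [:: (7, true)]; [::
(8, true)]]); (Delete [:: (1, false); (6, false)], [:: [:: (6, false)]]); (Delete [:: (0, false); (9, false)],
[:: [:: (1, false); (6, false)]; [:: (3, false)]; [:: (3, false); (6, false)]]); (Delete [:: (0, false); (9,
false)], [:: [:: (1, false); (6, false)]; [:: (3, false)]; [:: (3, false); (6, false)]]); (Delete [:: (1,
true)], [:: [:: (4, false)]; [:: (5, false)]]); (Delete [:: (0, false); (9, false)], [:: [:: (9, true)]; [::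
(3, true)]; [:: (4, true)]; [:: (5, true)]]); (Delete [:: (0, false); (9, false)], [:: [:: (9, true)]; [:: (3,
true)]; [:: (4, true)]; [:: (5, true)]]); (Expand 3, [::]); (Delete [:: (0, true)], [:: [:: (1, false); (8,
false)]; [:: (2, false); (8, false)]]); (Delete [:: (2, false); (8, false)], [:: [:: (8, false)]]); (Delete
[:: (2, false); (8, false)], [:: [:: (8, false)]]); (Delete [:: (2, true)], [:: [:: (6, false)]; [:: (7,
false)]]); (Delete [:: (1, false); (8, false)], [:: [:: (8, false)]]); (Delete [:: (0, false); (9, false)],
[:: [:: (5, false)]; [:: (7, false)]]); (Delete [:: (0, false); (9, false)], [:: [:: (1, false); (8, false)];
[:: (2, false); (8, false)]]); (Delete [:: (0, false); (9, false)], [:: [:: (5, false)]; [:: (6, false)]]);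
(Delete [:: (0, false); (9, false)], [:: [:: (1, false); (8, false)]; [:: (2, false); (8, false)]]); (Delete
[:: (0, false); (9, false)], [:: [:: (9, true)]; [:: (1, true)]; [:: (6, true)]; [:: (7, true)]]); (Delete [::
(1, false); (8, false)], [:: [:: (8, false)]]); (Delete [:: (0, false); (9, false)], [:: [:: (4, false)]; [::
(7, false)]]); (Delete [:: (0, false); (9, false)], [:: [:: (1, false); (8, false)]; [:: (2, false); (8,
false)]]); (Delete [:: (0, false); (9, false)], [:: [:: (4, false)]; [:: (6, false)]]); (Delete [:: (0,
false); (9, false)], [:: [:: (1, false); (8, false)]; [:: (2, false); (8, false)]]); (Delete [:: (0, false);
(9, false)], [:: [:: (9, true)]; [:: (1, true)]; [:: (6, true)]; [:: (7, true)]]); (Delete [:: (1, true)], [::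
[:: (4, false)]; [:: (5, false)]]); (Delete [:: (0, false); (9, false)], [:: [:: (9, true)]; [:: (2, true)];
[:: (4, true)]; [:: (5, true)]]); (Delete [:: (0, false); (9, false)], [:: [:: (9, true)]; [:: (2, true)]; [::
(4, true)]; [:: (5, true)]]); (Delete [:: (0, true)], [::]); (Expand 8, [:: [:: (8, false)]]); (Expand 7, [::
[:: (7, false)]]); (Delete [:: (3, false); (7, false)], [:: [:: (2, false)]]); (Delete [:: (3, false); (7,
false)], [:: [:: (9, false)]]); (Delete [:: (3, true)], [:: [:: (4, true)]; [:: (5, true)]]); (Delete [:: (7,
true)], [:: [:: (2, false); (9, false)]; [:: (11, false)]]); (Delete [:: (8, true)], [:: [:: (7, true)]]);
(Delete [:: (3, false); (7, false)], [:: [:: (9, false)]]); (Delete [:: (3, true)], [:: [:: (3, true)]]);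
(Delete [:: (1, true)], [:: [:: (3, true)]; [:: (4, true)]; [:: (0, false); (11, false)]]); (Delete [:: (3,
false); (7, false)], [:: [:: (9, false)]]); (Delete [:: (3, true)], [:: [:: (3, true)]]); (Delete [:: (1,
true)], [:: [:: (3, true)]; [:: (5, true)]; [:: (0, false); (11, false)]]); (Expand 7, [:: [:: (7, false)]]);
(Delete [:: (3, false); (7, false)], [:: [:: (2, false)]]); (Delete [:: (3, false); (7, false)], [:: [:: (8,
false)]]); (Delete [:: (3, true)], [:: [:: (4, true)]; [:: (5, true)]]); (Delete [:: (7, true)], [:: [:: (2,
false); (8, false)]; [:: (11, false)]]); (Delete [:: (9, true)], [:: [:: (7, true)]]); (Delete [:: (3, false);
(7, false)], [:: [:: (8, false)]]); (Delete [:: (3, true)], [:: [:: (3, true)]]); (Delete [:: (1, true)], [::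
[:: (3, true)]; [:: (4, true)]; [:: (0, false); (11, false)]]); (Delete [:: (3, false); (7, false)], [:: [::
(8, false)]]); (Delete [:: (3, true)], [:: [:: (3, true)]]); (Delete [:: (1, true)], [:: [:: (3, true)]; [::
(5, true)]; [:: (0, false); (11, false)]]); (Expand 8, [:: [:: (8, false)]]); (Expand 6, [:: [:: (6,
false)]]); (Delete [:: (3, false); (6, false)], [:: [:: (2, false)]]); (Delete [:: (3, false); (6, false)],
[:: [:: (9, false)]]); (Delete [:: (3, true)], [:: [:: (4, true)]; [:: (5, true)]]); (Delete [:: (6, true)],
[:: [:: (2, false); (9, false)]; [:: (11, false)]]); (Delete [:: (8, true)], [:: [:: (6, true)]]); (Delete [::
(3, false); (6, false)], [:: [:: (9, false)]]); (Delete [:: (3, true)], [:: [:: (3, true)]]); (Delete [:: (1,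
true)], [:: [:: (3, true)]; [:: (4, true)]; [:: (0, false); (11, false)]]); (Delete [:: (3, false); (6,
false)], [:: [:: (9, false)]]); (Delete [:: (3, true)], [:: [:: (3, true)]]); (Delete [:: (1, true)], [:: [::
(3, true)]; [:: (5, true)]; [:: (0, false); (11, false)]]); (Expand 6, [:: [:: (6, false)]]); (Delete [:: (3,
false); (6, false)], [:: [:: (2, false)]]); (Delete [:: (3, false); (6, false)], [:: [:: (8, false)]]);
(Delete [:: (3, true)], [:: [:: (4, true)]; [:: (5, true)]]); (Delete [:: (6, true)], [:: [:: (2, false); (8,
false)]; [:: (11, false)]]); (Delete [:: (9, true)], [:: [:: (6, true)]]); (Delete [:: (3, false); (6,
false)], [:: [:: (8, false)]]); (Delete [:: (3, true)], [:: [:: (3, true)]]); (Delete [:: (1, true)], [:: [::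
(3, true)]; [:: (4, true)]; [:: (0, false); (11, false)]]); (Delete [:: (3, false); (6, false)], [:: [:: (8,
false)]]); (Delete [:: (3, true)], [:: [:: (3, true)]]); (Delete [:: (1, true)], [:: [:: (3, true)]; [:: (5,
true)]; [:: (0, false); (11, false)]]); (Expand 8, [:: [:: (8, false)]]); (Expand 6, [:: [:: (6, false)]]);
(Expand 6, [:: [:: (6, false)]]); (Expand 6, [:: [:: (6, false)]]); (Expand 5, [:: [:: (5, false)]]); (Delete
[:: (3, false); (5, false)], [:: [:: (1, false)]]); (Delete [:: (3, false); (5, false)], [:: [:: (9,
false)]]); (Delete [:: (3, true)], [:: [:: (4, true)]; [:: (9, false)]]); (Delete [:: (5, true)], [:: [:: (1,
false); (9, false)]; [:: (11, false)]]); (Delete [:: (8, true)], [:: [:: (5, true)]]); (Delete [:: (3, false);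
(5, false)], [:: [:: (9, false)]]); (Delete [:: (3, true)], [:: [:: (3, true)]]); (Delete [:: (1, true)], [::
[:: (3, true)]; [:: (4, true)]; [:: (0, false); (10, false)]]); (Delete [:: (3, false); (5, false)], [:: [::
(9, false)]]); (Delete [:: (3, true)], [:: [:: (3, true)]]); (Delete [:: (1, true)], [:: [:: (3, true)]; [::
(4, true)]; [:: (0, false); (10, false)]]); (Expand 5, [:: [:: (5, false)]]); (Delete [:: (3, false); (5,
false)], [:: [:: (1, false)]]); (Delete [:: (3, false); (5, false)], [:: [:: (8, false)]]); (Delete [:: (3,
true)], [:: [:: (4, true)]; [:: (8, false)]]); (Delete [:: (5, true)], [:: [:: (1, false); (8, false)]; [::
(11, false)]]); (Delete [:: (9, true)], [:: [:: (5, true)]]); (Delete [:: (3, false); (5, false)], [:: [:: (8,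
false)]]); (Delete [:: (3, true)], [:: [:: (3, true)]]); (Delete [:: (1, true)], [:: [:: (3, true)]; [:: (4,
true)]; [:: (0, false); (10, false)]]); (Delete [:: (3, false); (5, false)], [:: [:: (8, false)]]); (Delete
[:: (3, true)], [:: [:: (3, true)]]); (Delete [:: (1, true)], [:: [:: (3, true)]; [:: (4, true)]; [:: (0,
false); (10, false)]]); (Expand 8, [:: [:: (8, false)]]); (Expand 5, [:: [:: (5, false)]]); (Delete [:: (2,
false); (5, false)], [:: [:: (1, false)]]); (Delete [:: (2, false); (5, false)], [:: [:: (7, false)]]);
(Delete [:: (2, true)], [:: [:: (4, true)]; [:: (7, false)]]); (Delete [:: (5, true)], [:: [:: (1, false); (7,
false)]; [:: (11, false)]]); (Delete [:: (2, false); (5, false)], [:: [:: (7, false)]]); (Delete [:: (2,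
true)], [:: [:: (2, true)]]); (Delete [:: (1, true)], [:: [:: (2, true)]; [:: (4, true)]; [:: (0, false); (10,
false)]]); (Delete [:: (2, false); (5, false)], [:: [:: (7, false)]]); (Delete [:: (2, true)], [:: [:: (2,
true)]]); (Delete [:: (1, true)], [:: [:: (2, true)]; [:: (4, true)]; [:: (0, false); (10, false)]]); (Delete
[:: (6, true)], [:: [:: (5, true)]]); (Delete [:: (0, false); (10, false)], [:: [:: (1, false)]; [:: (2,
false)]; [:: (3, false)]]); (Delete [:: (4, true)], [:: [:: (0, true)]]); (Delete [:: (4, true)], [:: [:: (0,
true)]]); (Delete [:: (6, true)], [:: [:: (0, true)]]); (Delete [:: (6, true)], [:: [:: (0, true)]]); (Delete
[:: (8, true)], [:: [:: (0, true)]]); (Delete [:: (8, true)], [:: [:: (0, true)]]); (Delete [:: (0, false);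
(10, false)], [:: [:: (1, false)]; [:: (2, false)]; [:: (3, false)]]); (Delete [:: (4, true)], [:: [:: (0,
true)]]); (Delete [:: (4, true)], [:: [:: (0, true)]]); (Delete [:: (6, true)], [:: [:: (0, true)]]); (Delete
[:: (6, true)], [:: [:: (0, true)]]); (Delete [:: (9, true)], [:: [:: (0, true)]]); (Delete [:: (9, true)],
[:: [:: (0, true)]]); (Expand 5, [:: [:: (5, false)]]); (Delete [:: (2, false); (5, false)], [:: [:: (1,
false)]]); (Delete [:: (2, false); (5, false)], [:: [:: (6, false)]]); (Delete [:: (2, true)], [:: [:: (4,
true)]; [:: (6, false)]]); (Delete [:: (5, true)], [:: [:: (1, false); (6, false)]; [:: (11, false)]]);
(Delete [:: (2, false); (5, false)], [:: [:: (6, false)]]); (Delete [:: (2, true)], [:: [:: (2, true)]]);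
(Delete [:: (1, true)], [:: [:: (2, true)]; [:: (4, true)]; [:: (0, false); (10, false)]]); (Delete [:: (2,
false); (5, false)], [:: [:: (6, false)]]); (Delete [:: (2, true)], [:: [:: (2, true)]]); (Delete [:: (1,
true)], [:: [:: (2, true)]; [:: (4, true)]; [:: (0, false); (10, false)]]); (Delete [:: (7, true)], [:: [::
(5, true)]]); (Delete [:: (0, false); (10, false)], [:: [:: (1, false)]; [:: (2, false)]; [:: (3, false)]]);
(Delete [:: (4, true)], [:: [:: (0, true)]]); (Delete [:: (4, true)], [:: [:: (0, true)]]); (Delete [:: (7,
true)], [:: [:: (0, true)]]); (Delete [:: (7, true)], [:: [:: (0, true)]]); (Delete [:: (8, true)], [:: [::
(0, true)]]); (Delete [:: (8, true)], [:: [:: (0, true)]]); (Delete [:: (0, false); (10, false)], [:: [:: (1,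
false)]; [:: (2, false)]; [:: (3, false)]]); (Delete [:: (4, true)], [:: [:: (0, true)]]); (Delete [:: (4,
true)], [:: [:: (0, true)]]); (Delete [:: (7, true)], [:: [:: (0, true)]]); (Delete [:: (7, true)], [:: [::
(0, true)]]); (Delete [:: (9, true)], [:: [:: (0, true)]]); (Delete [:: (9, true)], [:: [:: (0, true)]]);
(Expand 6, [:: [:: (6, false)]]); (Expand 4, [:: [:: (4, false)]]); (Delete [:: (3, false); (4, false)], [::
[:: (1, false)]]); (Delete [:: (3, false); (4, false)], [:: [:: (9, false)]]); (Delete [:: (3, true)], [:: [::
(5, true)]; [:: (9, false)]]); (Delete [:: (4, true)], [:: [:: (1, false); (9, false)]; [:: (11, false)]]);
(Delete [:: (8, true)], [:: [:: (4, true)]]); (Delete [:: (3, false); (4, false)], [:: [:: (9, false)]]);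
(Delete [:: (3, true)], [:: [:: (3, true)]]); (Delete [:: (1, true)], [:: [:: (3, true)]; [:: (5, true)]; [::
(0, false); (10, false)]]); (Delete [:: (3, false); (4, false)], [:: [:: (9, false)]]); (Delete [:: (3,
true)], [:: [:: (3, true)]]); (Delete [:: (1, true)], [:: [:: (3, true)]; [:: (5, true)]; [:: (0, false); (10,
false)]]); (Expand 4, [:: [:: (4, false)]]); (Delete [:: (3, false); (4, false)], [:: [:: (1, false)]]);
(Delete [:: (3, false); (4, false)], [:: [:: (8, false)]]); (Delete [:: (3, true)], [:: [:: (5, true)]; [::
(8, false)]]); (Delete [:: (4, true)], [:: [:: (1, false); (8, false)]; [:: (11, false)]]); (Delete [:: (9,
true)], [:: [:: (4, true)]]); (Delete [:: (3, false); (4, false)], [:: [:: (8, false)]]); (Delete [:: (3,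
true)], [:: [:: (3, true)]]); (Delete [:: (1, true)], [:: [:: (3, true)]; [:: (5, true)]; [:: (0, false); (10,
false)]]); (Delete [:: (3, false); (4, false)], [:: [:: (8, false)]]); (Delete [:: (3, true)], [:: [:: (3,
true)]]); (Delete [:: (1, true)], [:: [:: (3, true)]; [:: (5, true)]; [:: (0, false); (10, false)]]); (Expand
8, [:: [:: (8, false)]]); (Expand 4, [:: [:: (4, false)]]); (Delete [:: (2, false); (4, false)], [:: [:: (1,
false)]]); (Delete [:: (2, false); (4, false)], [:: [:: (7, false)]]); (Delete [:: (2, true)], [:: [:: (5,
true)]; [:: (7, false)]]); (Delete [:: (4, true)], [:: [:: (1, false); (7, false)]; [:: (11, false)]]);
(Delete [:: (2, false); (4, false)], [:: [:: (7, false)]]); (Delete [:: (2, true)], [:: [:: (2, true)]]);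
(Delete [:: (1, true)], [:: [:: (2, true)]; [:: (5, true)]; [:: (0, false); (10, false)]]); (Delete [:: (2,
false); (4, false)], [:: [:: (7, false)]]); (Delete [:: (2, true)], [:: [:: (2, true)]]); (Delete [:: (1,
true)], [:: [:: (2, true)]; [:: (5, true)]; [:: (0, false); (10, false)]]); (Delete [:: (6, true)], [:: [::
(4, true)]]); (Delete [:: (0, false); (10, false)], [:: [:: (1, false)]; [:: (2, false)]; [:: (3, false)]]);
(Delete [:: (5, true)], [:: [:: (0, true)]]); (Delete [:: (5, true)], [:: [:: (0, true)]]); (Delete [:: (6,
true)], [:: [:: (0, true)]]); (Delete [:: (6, true)], [:: [:: (0, true)]]); (Delete [:: (8, true)], [:: [::
(0, true)]]); (Delete [:: (8, true)], [:: [:: (0, true)]]); (Delete [:: (0, false); (10, false)], [:: [:: (1,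
false)]; [:: (2, false)]; [:: (3, false)]]); (Delete [:: (5, true)], [:: [:: (0, true)]]); (Delete [:: (5,
true)], [:: [:: (0, true)]]); (Delete [:: (6, true)], [:: [:: (0, true)]]); (Delete [:: (6, true)], [:: [::
(0, true)]]); (Delete [:: (9, true)], [:: [:: (0, true)]]); (Delete [:: (9, true)], [:: [:: (0, true)]]);
(Expand 4, [:: [:: (4, false)]]); (Delete [:: (2, false); (4, false)], [:: [:: (1, false)]]); (Delete [:: (2,
false); (4, false)], [:: [:: (6, false)]]); (Delete [:: (2, true)], [:: [:: (5, true)]; [:: (6, false)]]);
(Delete [:: (4, true)], [:: [:: (1, false); (6, false)]; [:: (11, false)]]); (Delete [:: (2, false); (4,
false)], [:: [:: (6, false)]]); (Delete [:: (2, true)], [:: [:: (2, true)]]); (Delete [:: (1, true)], [:: [::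
(2, true)]; [:: (5, true)]; [:: (0, false); (10, false)]]); (Delete [:: (2, false); (4, false)], [:: [:: (6,
false)]]); (Delete [:: (2, true)], [:: [:: (2, true)]]); (Delete [:: (1, true)], [:: [:: (2, true)]; [:: (5,
true)]; [:: (0, false); (10, false)]]); (Delete [:: (7, true)], [:: [:: (4, true)]]); (Delete [:: (0, false);
(10, false)], [:: [:: (1, false)]; [:: (2, false)]; [:: (3, false)]]); (Delete [:: (5, true)], [:: [:: (0,
true)]]); (Delete [:: (5, true)], [:: [:: (0, true)]]); (Delete [:: (7, true)], [:: [:: (0, true)]]); (Delete
[:: (7, true)], [:: [:: (0, true)]]); (Delete [:: (8, true)], [:: [:: (0, true)]]); (Delete [:: (8, true)],
[:: [:: (0, true)]]); (Delete [:: (0, false); (10, false)], [:: [:: (1, false)]; [:: (2, false)]; [:: (3,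
false)]]); (Delete [:: (5, true)], [:: [:: (0, true)]]); (Delete [:: (5, true)], [:: [:: (0, true)]]); (Delete
[:: (7, true)], [:: [:: (0, true)]]); (Delete [:: (7, true)], [:: [:: (0, true)]]); (Delete [:: (9, true)],
[:: [:: (0, true)]]); (Delete [:: (9, true)], [:: [:: (0, true)]]); (Expand 6, [:: [:: (6, false)]]); (Expand
4, [:: [:: (4, false)]]); (Expand 4, [:: [:: (4, false)]]); (Expand 4, [:: [:: (4, false)]]); (Expand 4, [::
[:: (4, false)]]); (Expand 4, [:: [:: (4, false)]]); (Expand 3, [:: [:: (2, false)]]); (Expand 6, [:: [:: (2,
false)]]); (Expand 7, [:: [:: (3, false)]; [:: (1, true)]; [:: (6, true)]]); (Expand 4, [:: [:: (1, false)];
[:: (2, false); (4, false)]; [:: (3, false); (4, false)]]); (Delete [:: (0, true)], [:: [:: (0, false); (8,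
false)]; [:: (0, false); (9, false)]; [:: (0, false); (10, false)]; [:: (0, false); (11, false)]]); (Expand 5,
[:: [:: (2, false); (5, false)]; [:: (3, false); (5, false)]]); (Delete [:: (0, true)], [::]); (Delete [:: (1,
true)], [::]); (Expand 14, [:: [:: (5, true)]]); (Expand 13, [:: [:: (0, false); (13, false)]]); (Expand 13,
[:: [:: (0, false); (13, false)]]); (Delete [:: (1, false); (16, false)], [:: [:: (1, true)]]); (Expand 12,
[:: [:: (0, false); (12, false)]]); (Expand 12, [:: [:: (0, false); (12, false)]]); (Delete [:: (1, false);
(16, false)], [:: [:: (1, true)]]); (Expand 12, [:: [:: (4, true)]]); (Delete [:: (1, false); (16, false)],
[:: [:: (1, true)]]); (Delete [:: (1, false); (16, false)], [:: [:: (1, true)]]); (Delete [:: (0, false); (11,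
false)], [:: [:: (5, true)]]); (Delete [:: (3, false); (5, false)], [:: [:: (7, true)]]); (Delete [:: (0,
false); (10, false)], [:: [:: (5, true)]]); (Delete [:: (3, false); (5, false)], [:: [:: (7, true)]]); (Delete
[:: (0, false); (9, false)], [:: [:: (5, true)]]); (Delete [:: (2, false); (5, false)], [:: [:: (6, true)]]);
(Delete [:: (2, false); (5, false)], [:: [:: (6, true)]]); (Delete [:: (2, false); (5, false)], [:: [:: (6,
true)]]); (Delete [:: (0, false); (8, false)], [:: [:: (5, true)]]); (Delete [:: (2, false); (5, false)], [::
[:: (6, true)]]); (Delete [:: (2, false); (5, false)], [:: [:: (6, true)]]); (Delete [:: (2, false); (5,
false)], [:: [:: (6, true)]]); (Delete [:: (0, false); (11, false)], [:: [:: (4, true)]]); (Delete [:: (3,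
false); (4, false)], [:: [:: (7, true)]]); (Delete [:: (0, false); (10, false)], [:: [:: (4, true)]]); (Delete
[:: (3, false); (4, false)], [:: [:: (7, true)]]); (Delete [:: (0, false); (9, false)], [:: [:: (4, true)]]);
(Delete [:: (2, false); (4, false)], [:: [:: (6, true)]]); (Delete [:: (2, false); (4, false)], [:: [:: (6,
true)]]); (Delete [:: (2, false); (4, false)], [:: [:: (6, true)]]); (Delete [:: (0, false); (8, false)], [::
[:: (4, true)]]); (Delete [:: (2, false); (4, false)], [:: [:: (6, true)]]); (Delete [:: (2, false); (4,
false)], [:: [:: (6, true)]]); (Delete [:: (2, false); (4, false)], [:: [:: (6, true)]]); (Delete [:: (0,
true)], [:: [:: (1, true)]]); (Delete [:: (1, false); (7, false)], [:: [:: (1, true)]]); (Delete [:: (1,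
false); (7, false)], [:: [:: (1, true)]]); (Delete [:: (1, false); (6, false)], [:: [:: (1, true)]]); (Delete
[:: (1, false); (6, false)], [:: [:: (1, true)]]); (Delete [:: (2, true)], [:: [:: (6, true)]; [:: (0, false);
(8, false)]; [:: (0, false); (9, false)]]); (Delete [:: (2, true)], [:: [:: (6, true)]; [:: (0, false); (8,
false)]; [:: (0, false); (9, false)]]); (Delete [:: (0, true)], [:: [:: (1, true)]; [:: (0, false); (5,
false)]; [:: (0, false); (8, false)]; [:: (0, false); (9, false)]]); (Delete [:: (3, true)], [:: [:: (1,
true)]; [:: (0, true)]]); (Delete [:: (3, true)], [:: [:: (1, true)]; [:: (0, true)]]); (Delete [:: (0,
true)], [:: [:: (1, true)]; [:: (0, false); (4, false)]; [:: (0, false); (8, false)]; [:: (0, false); (9,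
false)]]); (Delete [:: (3, true)], [:: [:: (1, true)]; [:: (0, true)]]); (Delete [:: (3, true)], [:: [:: (1,
true)]; [:: (0, true)]]); (Delete [:: (0, true)], [:: [:: (5, true)]; [:: (7, true)]; [:: (0, false); (9,
false)]]); (Delete [:: (3, false); (6, false)], [:: [:: (1, true)]]); (Delete [:: (6, true)], [:: [:: (1,
true)]]); (Delete [:: (0, false); (9, false)], [:: [:: (0, true)]]); (Delete [:: (0, true)], [:: [:: (4,
true)]; [:: (7, true)]; [:: (0, false); (9, false)]]); (Delete [:: (3, false); (6, false)], [:: [:: (1,
true)]]); (Delete [:: (6, true)], [:: [:: (1, true)]]); (Delete [:: (0, false); (9, false)], [:: [:: (0,
true)]]); (Delete [:: (0, true)], [:: [:: (0, false); (6, false)]]); (Expand 3, [:: [:: (0, false)]; [:: (1,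
false)]]); (Expand 2, [:: [:: (0, false)]]); (Expand 4, [:: [:: (1, false)]]); (Expand 5, [:: [:: (3, false)];
[:: (2, true)]; [:: (4, true)]]); (Expand 6, [:: [:: (2, false)]; [:: (1, false); (6, false)]; [:: (3, false);
(6, false)]]); (Delete [:: (0, true)], [:: [:: (0, false); (8, false)]; [:: (0, false); (9, false)]; [:: (0,
false); (10, false)]; [:: (0, false); (11, false)]]); (Expand 7, [:: [:: (1, false); (7, false)]; [:: (3,
false); (7, false)]]); (Delete [:: (0, true)], [::]); (Delete [:: (2, true)], [::]); (Expand 14, [:: [:: (7,
true)]]); (Expand 13, [:: [:: (0, false); (13, false)]]); (Expand 13, [:: [:: (0, false); (13, false)]]);
(Delete [:: (2, false); (16, false)], [:: [:: (2, true)]]); (Expand 12, [:: [:: (0, false); (12, false)]]);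
(Expand 12, [:: [:: (0, false); (12, false)]]); (Delete [:: (2, false); (16, false)], [:: [:: (2, true)]]);
(Expand 12, [:: [:: (6, true)]]); (Delete [:: (2, false); (16, false)], [:: [:: (2, true)]]); (Delete [:: (2,
false); (16, false)], [:: [:: (2, true)]]); (Delete [:: (0, false); (11, false)], [:: [:: (5, false)]]);
(Delete [:: (3, false); (7, false)], [:: [:: (5, true)]]); (Delete [:: (0, false); (10, false)], [:: [:: (5,
false)]]); (Delete [:: (3, false); (7, false)], [:: [:: (5, true)]]); (Delete [:: (0, false); (9, false)], [::
[:: (4, false)]]); (Delete [:: (1, false); (7, false)], [:: [:: (4, true)]]); (Delete [:: (1, false); (7,
false)], [:: [:: (4, true)]]); (Delete [:: (1, false); (7, false)], [:: [:: (4, true)]]); (Delete [:: (0,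
false); (8, false)], [:: [:: (4, false)]]); (Delete [:: (1, false); (7, false)], [:: [:: (4, true)]]); (Delete
[:: (1, false); (7, false)], [:: [:: (4, true)]]); (Delete [:: (1, false); (7, false)], [:: [:: (4, true)]]);
(Delete [:: (0, false); (11, false)], [:: [:: (5, false)]]); (Delete [:: (3, false); (6, false)], [:: [:: (5,
true)]]); (Delete [:: (0, false); (10, false)], [:: [:: (5, false)]]); (Delete [:: (3, false); (6, false)],
[:: [:: (5, true)]]); (Delete [:: (0, false); (9, false)], [:: [:: (4, false)]]); (Delete [:: (1, false); (6,
false)], [:: [:: (4, true)]]); (Delete [:: (1, false); (6, false)], [:: [:: (4, true)]]); (Delete [:: (1,
false); (6, false)], [:: [:: (4, true)]]); (Delete [:: (0, false); (8, false)], [:: [:: (4, false)]]); (Delete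
[:: (1, false); (6, false)], [:: [:: (4, true)]]); (Delete [:: (1, false); (6, false)], [:: [:: (4, true)]]);
(Delete [:: (1, false); (6, false)], [:: [:: (4, true)]]); (Delete [:: (0, true)], [:: [:: (2, true)]]);
(Delete [:: (2, false); (5, false)], [:: [:: (2, true)]]); (Delete [:: (2, false); (5, false)], [:: [:: (2,
true)]]); (Delete [:: (2, false); (4, false)], [:: [:: (2, true)]]); (Delete [:: (2, false); (4, false)], [::
[:: (2, true)]]); (Delete [:: (1, true)], [:: [:: (4, true)]; [:: (0, false); (8, false)]; [:: (0, false); (9,
false)]]); (Delete [:: (1, true)], [:: [:: (4, true)]; [:: (0, false); (8, false)]; [:: (0, false); (9,
false)]]); (Delete [:: (0, true)], [:: [:: (2, true)]; [:: (0, false); (7, false)]; [:: (0, false); (8,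
false)]; [:: (0, false); (9, false)]]); (Delete [:: (3, true)], [:: [:: (2, true)]; [:: (0, true)]]); (Delete
[:: (3, true)], [:: [:: (2, true)]; [:: (0, true)]]); (Delete [:: (0, true)], [:: [:: (2, true)]; [:: (0,
false); (6, false)]; [:: (0, false); (8, false)]; [:: (0, false); (9, false)]]); (Delete [:: (3, true)], [::
[:: (2, true)]; [:: (0, true)]]); (Delete [:: (3, true)], [:: [:: (2, true)]; [:: (0, true)]]); (Delete [::
(0, true)], [:: [:: (7, true)]; [:: (5, true)]; [:: (0, false); (9, false)]]); (Delete [:: (3, false); (4,
false)], [:: [:: (1, true)]]); (Delete [:: (4, true)], [:: [:: (2, true)]]); (Delete [:: (0, false); (9,
false)], [:: [:: (0, true)]]); (Delete [:: (0, true)], [:: [:: (6, true)]; [:: (5, true)]; [:: (0, false); (9,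
false)]]); (Delete [:: (3, false); (4, false)], [:: [:: (1, true)]]); (Delete [:: (4, true)], [:: [:: (2,
true)]]); (Delete [:: (0, false); (9, false)], [:: [:: (0, true)]]); (Delete [:: (0, true)], [:: [:: (0,
false); (4, false)]]); (Expand 2, [:: [:: (0, false)]; [:: (1, false)]]); (Expand 3, [:: [:: (0, false)]]);
(Expand 4, [:: [:: (1, false)]]); (Expand 5, [:: [:: (2, false)]; [:: (3, true)]; [:: (4, true)]]); (Expand 6,
[:: [:: (3, false)]; [:: (1, false); (6, false)]; [:: (2, false); (6, false)]]); (Delete [:: (0, true)], [::
[:: (0, false); (8, false)]; [:: (0, false); (9, false)]; [:: (0, false); (10, false)]; [:: (0, false); (11,
false)]]); (Expand 7, [:: [:: (1, false); (7, false)]; [:: (2, false); (7, false)]]); (Delete [:: (0, true)],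
[::]); (Delete [:: (3, true)], [::]); (Expand 14, [:: [:: (7, true)]]); (Expand 13, [:: [:: (0, false); (13,
false)]]); (Expand 13, [:: [:: (0, false); (13, false)]]); (Delete [:: (3, false); (16, false)], [:: [:: (3,
true)]]); (Expand 12, [:: [:: (0, false); (12, false)]]); (Expand 12, [:: [:: (0, false); (12, false)]]);
(Delete [:: (3, false); (16, false)], [:: [:: (3, true)]]); (Expand 12, [:: [:: (6, true)]]); (Delete [:: (3,
false); (16, false)], [:: [:: (3, true)]]); (Delete [:: (3, false); (16, false)], [:: [:: (3, true)]]);
(Delete [:: (0, false); (11, false)], [:: [:: (5, false)]]); (Delete [:: (2, false); (7, false)], [:: [:: (5,
true)]]); (Delete [:: (0, false); (10, false)], [:: [:: (5, false)]]); (Delete [:: (2, false); (7, false)],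
[:: [:: (5, true)]]); (Delete [:: (0, false); (9, false)], [:: [:: (4, false)]]); (Delete [:: (1, false); (7,
false)], [:: [:: (4, true)]]); (Delete [:: (1, false); (7, false)], [:: [:: (4, true)]]); (Delete [:: (1,
false); (7, false)], [:: [:: (4, true)]]); (Delete [:: (0, false); (8, false)], [:: [:: (4, false)]]); (Delete
[:: (1, false); (7, false)], [:: [:: (4, true)]]); (Delete [:: (1, false); (7, false)], [:: [:: (4, true)]]);
(Delete [:: (1, false); (7, false)], [:: [:: (4, true)]]); (Delete [:: (0, false); (11, false)], [:: [:: (5,
false)]]); (Delete [:: (2, false); (6, false)], [:: [:: (5, true)]]); (Delete [:: (0, false); (10, false)],
[:: [:: (5, false)]]); (Delete [:: (2, false); (6, false)], [:: [:: (5, true)]]); (Delete [:: (0, false); (9,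
false)], [:: [:: (4, false)]]); (Delete [:: (1, false); (6, false)], [:: [:: (4, true)]]); (Delete [:: (1,
false); (6, false)], [:: [:: (4, true)]]); (Delete [:: (1, false); (6, false)], [:: [:: (4, true)]]); (Delete
[:: (0, false); (8, false)], [:: [:: (4, false)]]); (Delete [:: (1, false); (6, false)], [:: [:: (4, true)]]);
(Delete [:: (1, false); (6, false)], [:: [:: (4, true)]]); (Delete [:: (1, false); (6, false)], [:: [:: (4,
true)]]); (Delete [:: (0, true)], [:: [:: (3, true)]]); (Delete [:: (3, false); (5, false)], [:: [:: (3,
true)]]); (Delete [:: (3, false); (5, false)], [:: [:: (3, true)]]); (Delete [:: (3, false); (4, false)], [::
[:: (3, true)]]); (Delete [:: (3, false); (4, false)], [:: [:: (3, true)]]); (Delete [:: (1, true)], [:: [::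
(4, true)]; [:: (0, false); (8, false)]; [:: (0, false); (9, false)]]); (Delete [:: (1, true)], [:: [:: (4,
true)]; [:: (0, false); (8, false)]; [:: (0, false); (9, false)]]); (Delete [:: (0, true)], [:: [:: (3,
true)]; [:: (0, false); (7, false)]; [:: (0, false); (8, false)]; [:: (0, false); (9, false)]]); (Delete [::
(2, true)], [:: [:: (3, true)]; [:: (0, true)]]); (Delete [:: (2, true)], [:: [:: (3, true)]; [:: (0,
true)]]); (Delete [:: (0, true)], [:: [:: (3, true)]; [:: (0, false); (6, false)]; [:: (0, false); (8,
false)]; [:: (0, false); (9, false)]]); (Delete [:: (2, true)], [:: [:: (3, true)]; [:: (0, true)]]); (Delete
[:: (2, true)], [:: [:: (3, true)]; [:: (0, true)]]); (Delete [:: (0, true)], [:: [:: (7, true)]; [:: (5,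
true)]; [:: (0, false); (9, false)]]); (Delete [:: (2, false); (4, false)], [:: [:: (1, true)]]); (Delete [::
(4, true)], [:: [:: (3, true)]]); (Delete [:: (0, false); (9, false)], [:: [:: (0, true)]]); (Delete [:: (0,
true)], [:: [:: (6, true)]; [:: (5, true)]; [:: (0, false); (9, false)]]); (Delete [:: (2, false); (4,
false)], [:: [:: (1, true)]]); (Delete [:: (4, true)], [:: [:: (3, true)]]); (Delete [:: (0, false); (9,
false)], [:: [:: (0, true)]]); (Delete [:: (0, true)], [:: [:: (0, false); (4, false)]])].

Lemma check_rest : check 2 13 20 cert_rest point_root = Some [::].
Proof. by vm_compute. Qed.

(** * The stages of the case analysis *)

Lemma all_two x y z w : 2 <= x -> 2 <= y -> 2 <= z -> 2 <= w -> x + y + z + w = 8 ->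
  [/\ x = 2, y = 2, z = 2 & w = 2].
Proof. by move=> *; split; lia. Qed.

Lemma nb_two (S : {set T}) x y z : y \in S -> z \in S -> y != z -> e x y -> e x z ->
  deg S x = 2 -> nb S x = [set y; z].
Proof.
move=> yS zS yz xy xz x2; apply/esym/eqP.
rewrite eqEcard cards2 yz -/(deg S x) x2 andbT.
by apply/subsetP=> w /set2P[]->; apply/setIdP.
Qed.

Definition induced_c4 (S : {set T}) (a b c d : T) : bool :=
  [&& all (mem S) [:: a; b; c; d], [&& e a b, e b c, e c d & e d a]
    & [&& a != c, b != d, ~~ e a c & ~~ e b d]].

Lemma induced_c4_rot S a b c d : induced_c4 S a b c d -> induced_c4 S b c d a.
Proof.
case/and3P=> /and5P[aS bS cS dS _] /and4P[ab bc cd da] /and4P[ac bd nac nbd].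
apply/and3P; split; first by apply/and5P; split.
  by rewrite ab bc cd da.
by rewrite bd nbd eq_sym ac e_sym nac.
Qed.

Lemma edge_neq x y : e x y -> x != y.
Proof. by apply: contraTneq => ->; rewrite e_irr. Qed.

Lemma desc_c4_root S a b c d (x0 x1 x2 x3 : bool) : induced_c4 S a b c d ->
  (x0 -> deg S a = 2) -> (x1 -> deg S b = 2) -> (x2 -> deg S c = 2) ->
  (x3 -> deg S d = 2) -> desc S (c4_root x0 x1 x2 x3) (nth a [:: a; b; c; d]).
Proof.
case/and3P=> /and5P[aS bS cS dS _] /and4P[ab bc cd da] /and4P[ac bd nac nbd].
move=> a2 b2 c2 d2.
have u : uniq [:: a; b; c; d].
  rewrite /= !inE !negb_or ac bd (edge_neq ab) (edge_neq bc) (edge_neq cd) andbT /=.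
  by rewrite eq_sym (edge_neq da).
have out i : vtx (c4_root x0 x1 x2 x3) i.+4 = ([::], false) by rewrite /vtx /= nth_nil.
split.
- by move=> [|[|[|[|i]]]].
- by move=> i j iP jP /eqP; rewrite nth_uniq // => /eqP.
- by move=> [|[|[|[|i]]]] j; rewrite /adj ?out //= !inE => /orP[]/eqP->.
- by move=> [|[|[|[|i]]]] j; rewrite /adj ?out //= !inE => /orP[]/eqP->.
- move=> [|[|[|[|i]]]] j; rewrite /adj ?out //= !inE => /orP[]/eqP-> //=;
    by rewrite e_sym.
- by move=> [|[|[|[|i]]]]; rewrite /adj ?out.
move=> [|[|[|[|i]]]] w; rewrite ?out //= => xi wS ew.
- have : w \in nb S a by apply/setIdP.
  rewrite (nb_two bS dS bd ab _ (a2 xi)) 1?e_sym // => /set2P[]->; [exists 1|exists 3] => //.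
- have : w \in nb S b by apply/setIdP.
  rewrite (nb_two aS cS ac _ bc (b2 xi)) 1?e_sym // => /set2P[]->; [exists 0|exists 2] => //.
- have : w \in nb S c by apply/setIdP.
  rewrite (nb_two bS dS bd _ cd (c2 xi)) 1?e_sym // => /set2P[]->; [exists 1|exists 3] => //.
have : w \in nb S d by apply/setIdP.
by rewrite (nb_two aS cS ac da _ (d2 xi)) 1?e_sym // => /set2P[]->; [exists 0|exists 2].
Qed.

(** One stage: the bound [t] goes up by one as soon as the induced 4-cycles that attain it are shown
    to be reducible. *)
Lemma facts_low_c4 mind t S : facts mind t S ->
  (forall a b c d, induced_c4 S a b c d ->
     deg S a + deg S b + deg S c + deg S d = t -> reducible S) ->
  reducible S \/ facts mind t.+1 S.
Proof.
move=> F red; have [fm fc fd] := F.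
case: (boolP [exists a, exists b, exists c, exists d, induced_c4 S a b c d &&
   (deg S a + deg S b + deg S c + deg S d == t)]) => [|no].
  case/existsP=> a /existsP[b /existsP[c /existsP[d /andP[ind /eqP sum]]]].
  by left; apply: red sum.
right; split=> // a b c d mS ed nch; rewrite ltn_neqAle fc // andbT eq_sym.
apply: contra no => sum; apply/existsP; exists a; apply/existsP; exists b.
apply/existsP; exists c; apply/existsP; exists d; rewrite sum andbT.
by apply/and3P.
Qed.

(** Every corner has two neighbours on the cycle, so degree sums start at 8. With sum 8 there are no
    other neighbours, so the cycle is a component and [c4_reducible] applies; hence the first bound
    9. *)
Lemma facts_base S : reducible S \/ facts 1 9 S.
Proof.
case: (set_0Vmem (isolated S)) => [iso0|[v /isolated_reducible]]; last by left.
case: (boolP [exists s, exists a, exists b, exists c, exists d,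
   [&& all (mem S) [:: s; a; b; c; d], uniq [:: s; a; b; c; d]
     & [&& e s a, e s b, e a c, e a d, e b c, e b d & e c d]]]) => [|nd5].
  case/existsP=> s /existsP[a /existsP[b /existsP[c /existsP[d /and3P[m u ed]]]]].
  by left; apply: d5_reducible m u ed.
have d5 s a b c d : all (mem S) [:: s; a; b; c; d] -> uniq [:: s; a; b; c; d] ->
    ~~ [&& e s a, e s b, e a c, e a d, e b c, e b d & e c d].
  move=> m u; apply: contra nd5 => ed; apply/existsP; exists s; apply/existsP; exists a.
  apply/existsP; exists b; apply/existsP; exists c; apply/existsP; exists d.
  by apply/and3P.
have min1 v : v \in S -> 1 <= deg S v.
  move=> vS; rewrite lt0n; apply/negP=> /eqP/cards0_eq v0.
  have : v \in isolated S by apply/setIdP; rewrite v0.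
  by rewrite iso0 in_set0.
have two x y z : y \in S -> z \in S -> y != z -> e x y -> e x z -> 2 <= deg S x.
  move=> yS zS yz xy xz; have := cards2 y z; rewrite yz => <-.
  by apply: subset_leq_card; apply/subsetP=> w /set2P[]->; apply/setIdP.
have F8 : facts 1 8 S.
  split=> // a b c d /and5P[aS bS cS dS _] /and4P[ab bc cd da] /and4P[ac bd _ _].
  have da' : 2 <= deg S a by apply: (two _ b d) => //; rewrite e_sym.
  have db' : 2 <= deg S b by apply: (two _ a c) => //; rewrite e_sym.
  have dc' : 2 <= deg S c by apply: (two _ b d) => //; rewrite e_sym.
  have dd' : 2 <= deg S d by apply: (two _ a c) => //; rewrite e_sym.
  exact: (leq_add (leq_add (leq_add da' db') dc') dd').
apply: facts_low_c4 F8 _ => a b c d ind sum.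
have [mS ed nch] := and3P ind.
have /and5P[aS bS cS dS _] := mS; have /and4P[ab bc cd da] := ed.
have /and4P[ac bd nac nbd] := nch.
have da' : 2 <= deg S a by apply: (two _ b d) => //; rewrite e_sym.
have db' : 2 <= deg S b by apply: (two _ a c) => //; rewrite e_sym.
have dc' : 2 <= deg S c by apply: (two _ b d) => //; rewrite e_sym.
have dd' : 2 <= deg S d by apply: (two _ a c) => //; rewrite e_sym.
have [a2 b2 c2 d2] := all_two da' db' dc' dd' sum.
apply: (@c4_reducible S a b c d); apply/c4_atP; split.
- split=> //; rewrite /= !inE !negb_or ac bd (edge_neq ab) (edge_neq bc) (edge_neq cd).
  by rewrite eq_sym (edge_neq da).
- by apply: nb_two => //; rewrite e_sym.
- by apply: nb_two => //; rewrite e_sym.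
- by apply: nb_two => //; rewrite e_sym.
by apply: nb_two => //; rewrite e_sym.
Qed.

Lemma facts_leaf S : facts 1 9 S -> reducible S \/ facts 2 9 S.
Proof.
move=> F; have [fm fc fd] := F.
case: (boolP [exists v in S, deg S v < 2]) => [/exists_inP[v vS v2]|n2].
  left; have v1 : deg S v = 1 by apply/eqP; rewrite eqn_leq -ltnS v2 fm.
  have /cards1P[w nv] : #|nb S v| == 1 by rewrite -/(deg S v) v1.
  have /setIdP[wS vw] : w \in nb S v by rewrite nv set11.
  apply: (check_sound F check_leaf (f := nth v [:: v; w])).
  have out i : vtx leaf_root i.+2 = ([::], false) by rewrite /vtx /= nth_nil.
  split.
  - by move=> [|[|i]].
  - move=> [|[|i]] [|[|j]] // _ _ /= E; by move: vw; rewrite E e_irr.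
  - by move=> [|[|i]] j; rewrite /adj ?out //= !inE => /eqP->.
  - by move=> [|[|i]] j; rewrite /adj ?out //= !inE => /eqP->.
  - by move=> [|[|i]] j; rewrite /adj ?out //= !inE => /eqP->; rewrite //= e_sym.
  - by move=> [|[|i]]; rewrite /adj ?out.
  move=> [|[|i]] u; rewrite ?out //= => _ uS vu; exists 1 => //=.
  by apply/set1P; rewrite -nv; apply/setIdP.
right; split=> // v vS; rewrite leqNgt; apply: contra n2 => v2.
by apply/exists_inP; exists v.
Qed.

Section C4Stages.

Variables (S : {set T}) (t : nat).
Hypothesis F : facts 2 t S.

Lemma deg23 v : v \in S -> deg S v = 2 \/ deg S v = 3.
Proof.
move=> vS; have := facts_min F vS; have := deg_le3 S v.
by case: (deg S v) => [|[|[|[|n]]]] //; [left | right].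
Qed.

Lemma c4_root_reducible x0 x1 x2 x3 w w' a b c d :
  check 2 t 20 w (c4_root x0 x1 x2 x3) = Some w' -> induced_c4 S a b c d ->
  (x0 -> deg S a = 2) -> (x1 -> deg S b = 2) -> (x2 -> deg S c = 2) ->
  (x3 -> deg S d = 2) -> reducible S.
Proof.
by move=> ch ind a2 b2 c2 d2; apply: check_sound F ch (desc_c4_root ind a2 b2 c2 d2).
Qed.

End C4Stages.

(** With degrees 2 and 3 only, the degree sum tells how many corners have degree 2, and a rotation
    moves each pattern to the flags of its root. Two corners of degree 2 give two patterns up to
    rotation. *)
Lemma facts_c4_stages S : facts 2 9 S -> reducible S \/ facts 2 13 S.
Proof.
have wl t (red : forall a b c d, induced_c4 S a b c d ->
      deg S a + deg S b + deg S c + deg S d = t ->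
      deg S a = 2 \/ deg S a = 3 -> deg S b = 2 \/ deg S b = 3 ->
      deg S c = 2 \/ deg S c = 3 -> deg S d = 2 \/ deg S d = 3 -> reducible S) :
    facts 2 t S -> reducible S \/ facts 2 t.+1 S.
  move=> F; apply: (facts_low_c4 F) => a b c d ind sum.
  have /and3P[/and5P[aS bS cS dS _] _ _] := ind.
  by apply: (red a b c d ind sum); apply: (deg23 F).
move=> F9; have [||F10] := @wl 9 _ F9; [|by left|].
  move=> a b c d i0; have i1 := induced_c4_rot i0; have i2 := induced_c4_rot i1.
  have i3 := induced_c4_rot i2.
  move=> sum [a2|a2] [b2|b2] [c2|c2] [d2|d2]; move: sum; rewrite a2 b2 c2 d2 // => _.
  - exact: (c4_root_reducible F9 check_c1 i3).
  - exact: (c4_root_reducible F9 check_c1 i2).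
  - exact: (c4_root_reducible F9 check_c1 i1).
  exact: (c4_root_reducible F9 check_c1 i0).
have [||F11] := @wl 10 _ F10; [|by left|].
  move=> a b c d i0; have i1 := induced_c4_rot i0; have i2 := induced_c4_rot i1.
  have i3 := induced_c4_rot i2.
  move=> sum [a2|a2] [b2|b2] [c2|c2] [d2|d2]; move: sum; rewrite a2 b2 c2 d2 // => _.
  - exact: (c4_root_reducible F10 check_c2a i2).
  - exact: (c4_root_reducible F10 check_c2o i1).
  - exact: (c4_root_reducible F10 check_c2a i1).
  - exact: (c4_root_reducible F10 check_c2a i3).
  - exact: (c4_root_reducible F10 check_c2o i0).
  exact: (c4_root_reducible F10 check_c2a i0).
have [||F12] := @wl 11 _ F11; [|by left|].
  move=> a b c d i0; have i1 := induced_c4_rot i0; have i2 := induced_c4_rot i1.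
  have i3 := induced_c4_rot i2.
  move=> sum [a2|a2] [b2|b2] [c2|c2] [d2|d2]; move: sum; rewrite a2 b2 c2 d2 // => _.
  - exact: (c4_root_reducible F11 check_c3 i1).
  - exact: (c4_root_reducible F11 check_c3 i2).
  - exact: (c4_root_reducible F11 check_c3 i3).
  exact: (c4_root_reducible F11 check_c3 i0).
apply: (wl _ _ F12) => a b c d i0 _ _ _ _ _.
exact: (c4_root_reducible F12 check_c4 i0).
Qed.

Lemma reducible_nonempty (S : {set T}) : S != set0 -> reducible S.
Proof.
move=> /set0Pn[v vS]; have [//|F1] := facts_base S.
have [//|F2] := facts_leaf F1; have [//|F3] := facts_c4_stages F2.
(* The bound 13 exceeds every possible degree sum, so there are no induced 4-cycles any more. *)
apply: (check_sound F3 check_rest (f := fun=> v)).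
have out i : vtx point_root i = ([::], false) by case: i => [|i] //; rewrite /vtx /= nth_nil.
split=> //; try (by move=> i j; rewrite /adj out).
- by move=> [|i] [|j].
by move=> i; rewrite /adj out.
Qed.

(** Isolated vertices and both kinds of bad components contain a vertex of degree 0 or 2. A cubic
    graph has none, so [phi setT] is exactly three times the number of vertices. *)
Lemma cubic_covered : (forall v, #|[set w | e v w]| = 3) ->
  exists2 k, covered setT k & 3 * k <= #|T|.
Proof.
move=> e3; have [k Tk kphi] := reducible_covered reducible_nonempty setT.
exists k => //; have degT v : deg setT v = 3.
  by rewrite -(e3 v); apply: eq_card => w; rewrite !inE.
have iso0 : isolated setT = set0.
  apply/setP=> v; rewrite in_set0; apply/negbTE/negP=> /setIdP[_ /eqP v0].
  by have := degT v; rewrite /deg v0 cards0.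
have bad0 : bad setT = set0.
  apply/setP=> N; rewrite in_set0; apply/negbTE/negP=> /badP[/is_c4P|/is_d5P].
    case=> [a [b [c [d [/c4_atP[_ na _ _ _] _]]]]].
    by have := degT a; rewrite /deg na cards2; case: (_ != _).
  case=> [s [a [b [c [d [/and3P[_ _ /andP[/eqP ns _]] _]]]]]].
  by have := degT s; rewrite /deg ns cards2; case: (_ != _).
move: kphi; rewrite /phi iso0 bad0 !cards0 (eq_bigr (fun=> 3)) => [|v _].
  by rewrite sum_nat_const cardsT; move: #|T| => n; lia.
by rewrite degT.
Qed.

End Potential.

(** * From balls to graph distance *)

Lemma has_walk_dist_le (G : sgraph) (u v : G) n : has_walk u v n -> dist_le (dist u v) n.
Proof.
move=> uv; have cuv : connect (@edge G) u v.
  by have /existsP[p /andP[pP /eqP <-]] := uv; apply/connectP; exists p.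
rewrite /dist; case: {-}_ / boolP => [cuv'|]; last by rewrite cuv.
by case: ex_minnP => m _ /(_ n uv).
Qed.

Lemma near_dist_le (G : sgraph) (u v : G) r : near (@edge G) r u v ->
  dist_le (dist u v) r.
Proof.
have le_dist n m : n <= m -> has_walk u v n -> dist_le (dist u v) m.
  move=> nm /has_walk_dist_le; case: dist => //= k kn; exact: leq_trans nm.
have walk0 : u = v -> has_walk u v 0.
  by move=> ->; apply/existsP; exists [tuple]; rewrite /= eqxx.
have walk1 : edge u v -> has_walk u v 1.
  by move=> uv; apply/existsP; exists [tuple v]; rewrite /= uv eqxx.
case: r => [|[|r]] //=.
  by case/orP=> [/eqP/walk0|/walk1]; apply: le_dist.
case/or3P=> [/eqP/walk0|/walk1|/existsP[w /andP[uw wv]]]; try exact: le_dist.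
apply: (le_dist 2) => //; apply/existsP; exists [tuple w; v].
by rewrite /= uw wv eqxx.
Qed.

Theorem theorem1p5 (G : sgraph) (G_cubic : cubic G) :
  ((gamma_b2 G)%:R <= #|G|%:R / 3%:R :> rat)%R.
Proof.
have [|k [f [f_dom fk]] kG] :=
    cubic_covered (@edge_sym G) (@edge_irrefl G) _ G_cubic.
  by move=> v; rewrite -[#|_|]/(degree v) G_cubic.
have dom_f : dominating (f : broadcast G).
  apply/forallP=> u; have [v uv] := f_dom u (in_setT u).
  apply/existsP; exists v; rewrite near_dist_le // andbT.
  (* [near 0] is false, so the vertex that covers [u] has a positive value. *)
  by case: (nat_of_ord (f v)) uv.
have fG : gamma_b2 G <= k := leq_trans ((gamma_b2P G).2 _ dom_f) fk.
(* Clearing the denominator reduces the rational inequality to one between natural numbers. *)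
rewrite Num.Theory.ler_pdivlMr ?Num.Theory.ltr0n // -GRing.natrM Num.Theory.ler_nat.
by apply: leq_trans kG; rewrite mulnC leq_mul2l fG.
Qed.
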